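(* For every board $\Delta$ there is a good diagonal of $\Delta$ such that cut and paste along it yields a disjoint union $\Delta'$ of boards.
   Context: A square is a topological disk with four privileged boundary points, its vertices; its sides are the four boundary arcs between consecutive vertices. A quadriculated disk is a closed topological disk formed by the juxtaposition along sides of finitely many squares such that every interior vertex belongs to precisely four squares. A board is a quadriculated disk which is a topological subdisk of $\mathbb{R}^2$ consisting of unit squares with vertices in $\mathbb{Z}^2$ (equivalently, a quadriculated disk whose developing map, a map to $\mathbb{R}^2$ taking squares isometrically to unit lattice squares and locally injective in the interior, is injective). A corner is a boundary point which is a vertex of exactly one square. A diagonal is a sequence of vertices $v_0\ldots v_k$, $k>0$, with $v_0$ a corner, $v_1,\ldots,v_{k-1}$ interior, $v_k$ on the boundary, $v_i,v_{i+1}$ opposite vertices of a square $s_{i+1}$, and consecutive squares $s_i,s_{i+1}$ sharing only the vertex $v_i$. It is good if at least one side of $s_k$ containing $v_k$ lies in $\partial\Delta$; balanced if exactly one such side lies in $\partial\Delta$, unbalanced if both do. Cut and paste (with $\Delta$ oriented). Choose a side of the diagonal, called left: in the balanced case, the side on which the side of $s_k$ containing $v_k$ is not in $\partial\Delta$; otherwise either side. Label the vertices of $s_i$ counterclockwise $v_{i-1},v^r_{i-1/2},v_i,v^l_{i-1/2}$. For $1\le i\le k-1$, let $s^l_i$ be the square other than $s_i$ containing the side $v^l_{i-1/2}v_i$, with vertices counterclockwise $v^l_{i-1/2},v_i,v^l_{i+1/2},v^{ll}_i$. In the balanced case, $s^l_k$ is the square other than $s_k$ containing the side $v^l_{k-1/2}v_k$,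 with vertices $v^l_{k-1/2},v_k,v^l_{k+1/2},v^{ll}_k$. Put $k'=k$ if balanced, $k'=k-1$ otherwise. The excised squares are $s_1,\ldots,s_k,s^l_1,\ldots,s^l_{k'}$. Zig-zags: $\zeta^l=v^l_{1/2},v^{ll}_1,v^l_{3/2},\ldots,v^{ll}_{k-1},v^l_{k-1/2}$; $\zeta^r=v^r_{1/2},v_1,v^r_{3/2},\ldots,v_{k-1},v^r_{k-1/2}$; $\zeta^{l+}=\zeta^l$ if unbalanced, and $\zeta^l$ followed by $v^{ll}_k,v^l_{k+1/2}$ if balanced. The region between $\zeta^{l+}$ and $\zeta^r$ is exactly the union of the excised squares. Let $\Delta^r$ be the closed region to the right of $\zeta^r$ and $\Delta^l$ the closed region to the left of $\zeta^{l+}$. For $k>1$, $\tilde\Delta'$ is obtained by attaching $\Delta^l$ to $\Delta^r$ identifying $\zeta^l$ with $\zeta^r$ vertex by vertex in the listed order; it is a union of quadriculated disks $\Delta'_1,\ldots,\Delta'_\ell$ pairwise meeting in at most one vertex, and the result of cut and paste is their disjoint union $\Delta'$. For $k=1$, $\Delta'$ is obtained from $\Delta$ by excising $s_1$ and $s^l_1$ (if it exists). A disjoint union of boards means each $\Delta'_i$ is (isomorphic as a quadriculated disk to) a board. *)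

(* Defs.v *)
From HB Require Import structures.
From mathcomp Require Import all_boot all_order all_algebra finmap.
From mathcomp Require Import all_classical all_reals all_analysis.

Set Implicit Arguments.
Unset Strict Implicit.
Unset Printing Implicit Defensive.

Import Order.TTheory GRing.Theory Num.Theory.
Import numFieldNormedType.Exports.

Local Open Scope classical_set_scope.
Local Open Scope ring_scope.

(* A point of the lattice Z^2.  It also names the closed unit square of which
   it is the lower left vertex. *)
Notation Z2 := (int * int)%type.

(** * Unit squares of the lattice *)

(* Quarter turn about the centre of the square c: it sends each vertex of c to
   the next one in counterclockwise order. *)
Definition ccw (c p : Z2) : Z2 := (c.1 + c.2 + 1 - p.2, c.2 - c.1 + p.1).

Definition vertex (c : Z2) (i : nat) : Z2 := iter i (ccw c) c.

Definition verts (c : Z2) : seq Z2 := [seq vertex c i | i <- iota 0 4].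

Definition opposite (c p q : Z2) : Prop :=
  p \in verts c /\ q = iter 2 (ccw c) p.

(* The square other than c containing the side pq of c, that is, the image of c
   under the point reflection in the midpoint of pq. *)
Definition across (c p q : Z2) : Z2 :=
  (p.1 + q.1 - c.1 - 1, p.2 + q.2 - c.2 - 1).

(* The next vertex of c, counterclockwise for the orientation o of the plane:
   [true] is the standard orientation, [false] the opposite one. *)
Definition turn (o : bool) (c p : Z2) : Z2 :=
  if o then ccw c p else iter 3 (ccw c) p.

(** * Boards *)

Definition topological_disk (R : realType) (A : set (R * R)) : Prop :=
  let D := [set x : R * R | x.1 ^+ 2 + x.2 ^+ 2 <= 1] in
  exists f g : R * R -> R * R,
    [/\ {within D, continuous f}, {within A, continuous g},
        (forall x, D x -> A (f x) /\ g (f x) = x) &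
        (forall y, A y -> D (g y) /\ f (g y) = y)].

Definition region (R : realType) (S : {fset Z2}) : set (R * R) :=
  [set x | exists2 c : Z2, c \in S &
     c.1%:~R <= x.1 <= c.1%:~R + 1 /\ c.2%:~R <= x.2 <= c.2%:~R + 1].
Arguments region : clear implicits.

(* A set of unit squares; every vertex interior to the region is automatically
   a vertex of precisely four of them. *)
Definition is_board (R : realType) (S : {fset Z2}) : Prop :=
  topological_disk (region R S).

Definition lpoint (R : realType) (p : Z2) : R * R := (p.1%:~R, p.2%:~R).
Arguments lpoint : clear implicits.

Definition segment (R : realType) (p q : Z2) : set (R * R) :=
  [set x | exists2 t : R, 0 <= t <= 1 &
     x = (1 - t) *: lpoint R p + t *: lpoint R q].
Arguments segment : clear implicits.

(* For a board, the boundary of the disk is its frontier in the plane. *)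
Definition boundary (R : realType) (S : {fset Z2}) : set (R * R) :=
  region R S `\` interior (region R S).
Arguments boundary : clear implicits.

(** * Diagonals *)

Definition is_corner (R : realType) (S : {fset Z2}) (p : Z2) : Prop :=
  boundary R S (lpoint R p) /\ #|` [fset c in S | p \in verts c]%fset | = 1%N.

(* The vertices v_0, ..., v_k and the squares s_1, ..., s_k of a diagonal, with
   k = dlen; other values of dvert and dsq are irrelevant. *)
Record diag := Diag {
  dlen : nat;
  dvert : nat -> Z2;
  dsq : nat -> Z2 }.

Definition is_diagonal (R : realType) (S : {fset Z2}) (d : diag) : Prop :=
  let k := dlen d in let v := dvert d in let s := dsq d in
  [/\ (0 < k)%N,
      is_corner R S (v 0),
      (forall i, (0 < i < k)%N -> interior (region R S) (lpoint R (v i))),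
      boundary R S (lpoint R (v k)) &
      (forall i, (i < k)%N -> s i.+1 \in S /\ opposite (s i.+1) (v i) (v i.+1)) /\
      (forall i, (0 < i < k)%N ->
         forall p, (p \in verts (s i)) && (p \in verts (s i.+1)) = (p == v i))].

(* The side of s_k that contains v_k and lies to the left of the diagonal, for
   the orientation o, is in the boundary.  The right is the left for ~~ o. *)
Definition end_side_in_boundary (R : realType) (S : {fset Z2}) (d : diag)
    (o : bool) : Prop :=
  let p := dvert d (dlen d) in
  segment R p (turn o (dsq d (dlen d)) p) `<=` boundary R S.

Definition good (R : realType) (S : {fset Z2}) (d : diag) : Prop :=
  end_side_in_boundary R S d true \/ end_side_in_boundary R S d false.

Definition unbalanced (R : realType) (S : {fset Z2}) (d : diag) : Prop :=
  end_side_in_boundary R S d true /\ end_side_in_boundary R S d false.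

Definition balanced (R : realType) (S : {fset Z2}) (d : diag) : Prop :=
  good R S d /\ ~ unbalanced R S d.

(* The choice of a side of the diagonal as the left one is encoded by the
   orientation of the plane for which it is the left one. *)
Definition left_choice (R : realType) (S : {fset Z2}) (d : diag) (o : bool)
    : Prop :=
  balanced R S d -> ~ end_side_in_boundary R S d o.

(** * Square complexes *)

(* Finitely many squares, each with the cyclic list of its vertices.  Two sides
   are identified when they have the same endpoints. *)
Record complex := Complex {
  csq : finType;
  cvert : eqType;
  cnr : csq -> 'I_4 -> cvert }.

Definition lattice_complex (S : {fset Z2}) : complex :=
  @Complex S Z2 (fun c i => vertex (val c) i).

(* Indices in 'I_4 are added modulo 4. *)
Definition share_side (C : complex) : rel (csq C) := fun a b =>
  [exists i : 'I_4, exists j : 'I_4,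
     (cnr a i == cnr b j) && (cnr a (i + 1) == cnr b (j + 1)) ||
     (cnr a i == cnr b (j + 1)) && (cnr a (i + 1) == cnr b j)].

(* The squares that can be reached from a across sides. *)
Definition piece (C : complex) (a : csq C) : complex :=
  @Complex {b : csq C | connect (@share_side C) a b} (cvert C)
    (fun b i => cnr (val b) i).

Definition isomorphic (C C' : complex) : Prop :=
  exists (f : csq C -> csq C') (g : cvert C -> cvert C'),
    [/\ bijective f,
        (forall a b i j, g (cnr a i) = g (cnr b j) -> cnr a i = cnr b j) &
        (forall a, exists j : 'I_4,
           (forall i, g (cnr a i) = cnr (f a) (j + i)) \/
           (forall i, g (cnr a i) = cnr (f a) (j - i)))].

(* Pieces of C which only meet at vertices are made disjoint. *)
Definition disjoint_union_of_boards (R : realType) (C : complex) : Prop :=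
  forall a : csq C, exists B : {fset Z2},
    is_board R B /\ isomorphic (piece a) (lattice_complex B).

(** * Cut and paste *)

(* v^r_{i+1/2} and v^l_{i+1/2}, for i < k *)
Definition vr (d : diag) (o : bool) (i : nat) : Z2 :=
  turn o (dsq d i.+1) (dvert d i).

Definition vl (d : diag) (o : bool) (i : nat) : Z2 :=
  iter 3 (turn o (dsq d i.+1)) (dvert d i).

(* s^l_i and v^{ll}_i, for i > 0 *)
Definition sl (d : diag) (o : bool) (i : nat) : Z2 :=
  across (dsq d i) (vl d o i.-1) (dvert d i).

Definition vll (d : diag) (o : bool) (i : nat) : Z2 :=
  iter 3 (turn o (sl d o i)) (vl d o i.-1).

(* The zig-zags v^l_{1/2}, v^{ll}_1, v^l_{3/2}, ..., v^l_{k-1/2} and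
   v^r_{1/2}, v_1, v^r_{3/2}, ..., v^r_{k-1/2}. *)
Definition zigzag_l (d : diag) (o : bool) : seq Z2 :=
  mkseq (fun j => if odd j then vll d o j./2.+1 else vl d o j./2)
        (2 * dlen d).-1.

Definition zigzag_r (d : diag) (o : bool) : seq Z2 :=
  mkseq (fun j => if odd j then dvert d j./2.+1 else vr d o j./2)
        (2 * dlen d).-1.

Definition excised (R : realType) (S : {fset Z2}) (d : diag) (o : bool)
    : seq Z2 :=
  let k' := if `[< balanced R S d >] then dlen d else (dlen d).-1 in
  [seq dsq d i | i <- iota 1 (dlen d)] ++ [seq sl d o i | i <- iota 1 k'].

Definition remaining (R : realType) (S : {fset Z2}) (d : diag) (o : bool)
    : {fset Z2} :=
  [fset c in S | c \notin excised R S d o]%fset.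

(* The squares of the region to the right of the right zig-zag: since the
   squares with a side in that zig-zag and lying to its left are all excised,
   they are the remaining ones that can be reached from a remaining square with
   a side in the zig-zag.  The other remaining squares form the region to the
   left of the extended left zig-zag. *)
Definition right_part (R : realType) (S : {fset Z2}) (d : diag) (o : bool)
    : pred (remaining R S d o) :=
  let Q := lattice_complex (remaining R S d o) in
  let zr := zigzag_r d o in
  fun c => [exists e : csq Q, connect (@share_side Q) c e &&
    has (fun pq => (pq.1 \in verts (val e)) && (pq.2 \in verts (val e)))
        (zip zr (behead zr))].

(* The vertices of the two regions are made disjoint by a tag, true for the
   right one; then, for k > 1, each vertex of the left zig-zag is identified
   with the corresponding vertex of the right one.  For k = 1 the region
   right_part is empty and nothing is identified. *)
Definition paste_vertex (d : diag) (o : bool) (right : bool) (p : Z2)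
    : bool * Z2 :=
  if [&& (1 < dlen d)%N, ~~ right & p \in zigzag_l d o]
  then (true, nth p (zigzag_r d o) (index p (zigzag_l d o)))
  else (right, p).

Definition cut_and_paste (R : realType) (S : {fset Z2}) (d : diag) (o : bool)
    : complex :=
  @Complex (remaining R S d o) (bool * Z2)%type
    (fun c i => paste_vertex d o (right_part c) (vertex (val c) i)).

(* Main.v *)
Require Import Defs.
From mathcomp Require Import all_boot all_order all_algebra finmap.
From mathcomp Require Import all_classical all_reals all_analysis.
From mathcomp Require Import zify ring lra.

(* A finite set of unit squares is a disk if and only if it is nonempty, it is
   connected through sides, its nerve has no first cohomology over F_2, and no
   two of its squares meet in a pinch. For a disk, cochains are integrated along
   radii; conversely, such a set always has a free corner or a leaf, which is
   absorbed by a piecewise linear map. A diagonal starting at a corner is a chord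
   of the board, and the vanishing of the cohomology makes it cut the board in
   two parts. If a part cut off by a diagonal is not bounded by a staircase, a
   corner inside it, possibly after a reflection of the board, starts a diagonal
   which cuts off fewer squares. So some diagonal cuts off a part bounded by a
   staircase. Cut and paste along it moves that part by one diagonal step, so
   that the result is embedded in the plane as the board with a strip along the
   staircase removed, and removing the strip preserves acyclicity. *)

Set Implicit Arguments.
Unset Strict Implicit.
Unset Printing Implicit Defensive.

Import Order.TTheory GRing.Theory Num.Theory.
Import numFieldNormedType.Exports.

Local Open Scope classical_set_scope.
Local Open Scope ring_scope.

(** * Connectivity, acyclicity and pinches *)

Notation right_of c d := (d.1 = c.1 + 1 /\ d.2 = c.2) (only parsing).
Notation above c d := (d.1 = c.1 /\ d.2 = c.2 + 1) (only parsing).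

(** The Jordan and Schoenflies theorems are avoided: separation by curves is replaced by the
    solvability of coboundary equations over F_2, and regions are compared by explicit piecewise
    linear maps. [board_like] leaves out connectedness and admits a pinch whose two squares lie in
    different side-connected components, because cut and paste may split the board into pieces
    touching at a vertex. The staircase theorem serves twice: it gives the wanted diagonal, and the
    first square of such a diagonal is the removable square in the proof that acyclic boards are
    disks. All diagonals of the descent are parallel, so they do not cross, and the symmetries
    preserving their direction suffice. The two zig-zags along a diagonal differ by the translation
    by one step (-1, 1) or its inverse, which is why pasting is a motion in the plane; the staircase
    condition makes the moved part land inside the board. *)

Lemma pointP (c d : Z2) : c.1 = d.1 -> c.2 = d.2 -> c = d.
Proof. by case: c d => [? ?] [? ?] /= -> ->. Qed.

Lemma point_ex (x y : int) : exists d : Z2, d.1 = x /\ d.2 = y.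
Proof. by exists (x, y). Qed.

Lemma int_nat (x : int) : 0 <= x -> exists n : nat, x = n%:Z.
Proof. by case: x => // n _; exists n. Qed.

Definition side_const (S : {fset Z2}) (h : Z2 -> bool) : Prop :=
  (forall c d : Z2, c \in S -> d \in S -> right_of c d -> h c = h d) /\
  (forall c d : Z2, c \in S -> d \in S -> above c d -> h c = h d).

Definition side_connected (S : {fset Z2}) : Prop :=
  forall h, side_const S h -> forall c d : Z2, c \in S -> d \in S -> h c = h d.

(* [wx c] and [wy c] are the values on the right and the upper side of c of a
   1-cochain with values in F_2 of the nerve of S. *)
Definition coboundary (S : {fset Z2}) (h wx wy : Z2 -> bool) : Prop :=
  (forall c d : Z2, c \in S -> d \in S -> right_of c d -> h c (+) h d = wx c) /\
  (forall c d : Z2, c \in S -> d \in S -> above c d -> h c (+) h d = wy c).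

Definition cocycle (S : {fset Z2}) (wx wy : Z2 -> bool) : Prop :=
  forall a b c d : Z2, a \in S -> b \in S -> c \in S -> d \in S ->
    right_of a b -> above a c -> right_of c d ->
    wx a (+) wy b (+) wx c (+) wy a = false.

Definition acyclic (S : {fset Z2}) : Prop :=
  forall wx wy, cocycle S wx wy -> exists h, coboundary S h wx wy.

Definition pinch (S : {fset Z2}) (c d : Z2) : Prop :=
  [/\ c \in S, d \in S, `|c.1 - d.1| = 1, `|c.2 - d.2| = 1 &
      forall e : Z2, e \in S -> ~ (e.1 = c.1 /\ e.2 = d.2) /\ ~ (e.1 = d.1 /\ e.2 = c.2)].

(* The side-connected components of such a set are boards. *)
Definition board_like (S : {fset Z2}) : Prop :=
  acyclic S /\
  forall c d : Z2, pinch S c d -> exists2 h, side_const S h & h c != h d.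

Definition comb_board (S : {fset Z2}) : Prop :=
  [/\ S != fset0, side_connected S & board_like S].

Lemma no_pinch S c d : comb_board S -> ~ pinch S c d.
Proof.
case=> _ conn [_ sep] P; have [h hc /eqP] := sep _ _ P.
by case: P => cS dS _ _ _; apply; exact: conn.
Qed.

(** A 2 x 2 block of squares of [S] is either inside [Q] or disjoint from it, so cocycles on [Q]
    extend by zero. A square of [S] filling a pinch of [Q] would be a neighbour of its squares,
    hence in [Q]; so the pinch is one of [S]. *)
Lemma board_like_component (S Q : {fset Z2}) :
  board_like S -> (forall c : Z2, c \in Q -> c \in S) ->
  (forall c d : Z2, c \in Q -> d \in S ->
     right_of c d \/ right_of d c \/ above c d \/ above d c -> d \in Q) ->
  side_connected Q -> Q != fset0 -> comb_board Q.
Proof.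
move=> [acS sepS] QS clQ connQ Q0; split=> //; split.
- move=> wx wy wQ.
  have [|h [hx hy]] := acS (fun c => (c \in Q) && wx c) (fun c => (c \in Q) && wy c).
    move=> a b c d aS bS cS dS ab ac cd.
    case aQ: (a \in Q); last first.
      case bQ: (b \in Q); first by rewrite (clQ b a bQ aS) in aQ; [|lia].
      case cQ: (c \in Q); first by rewrite (clQ c a cQ aS) in aQ; [|lia].
      by [].
    have bQ : b \in Q by apply: (clQ a) => //; lia.
    have cQ : c \in Q by apply: (clQ a) => //; lia.
    have dQ : d \in Q by apply: (clQ c) => //; lia.
    by rewrite bQ cQ /=; apply: (wQ a b c d).
  exists h; split=> c d cQ dQ cd.
    by rewrite hx ?QS // cQ.
  by rewrite hy ?QS // cQ.
- move=> c d [cQ dQ cd1 cd2 P].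
  have [|h hS hcd] := sepS c d.
    split; rewrite ?QS // => e eS; split=> eE.
      by apply: (proj1 (P e _)) => //; apply: (clQ c) => //; lia.
    by apply: (proj2 (P e _)) => //; apply: (clQ c) => //; lia.
  exists h => //; case: hS => h1 h2; split=> a b aQ bQ ab.
    by apply: h1 => //; apply: QS.
  by apply: h2 => //; apply: QS.
Qed.

(* Cuts S along the side between the neighbours c and s. *)
Lemma cut_side (S : {fset Z2}) (c s : Z2) :
  acyclic S -> c \in S -> s \in S -> s.2 = c.2 -> `|s.1 - c.1| = 1 ->
  (forall d : Z2, d \in S -> above d c -> False) ->
  (forall e : Z2, e \in S -> e.2 = c.2 + 1 -> e.1 = s.1 -> False) ->
  exists2 h, side_const (S `\ c)%fset h &
    forall t : Z2, t \in S -> t.1 = c.1 -> t.2 = c.2 + 1 -> h s != h t.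
Proof.
move=> acS cS sS s2 s1 noc nos.
have [m mE] : exists m, (m = c.1 /\ s.1 = m + 1) \/ (m = s.1 /\ c.1 = m + 1).
  case: (lerP s.1 c.1) => sc; [exists s.1 | exists c.1]; lia.
(* The indicator of the side between [c] and [s] is a cocycle: a block in [S] containing that side
   would have a square below [c] or one above [s]. *)
have [|h [hx hy]] :=
    acS (fun d : Z2 => (d.2 == c.2) && (d.1 == m)) (fun _ => false).
  move=> x y z w xS yS zS wS xy xz zw.
  have {}noc (e : Z2) : e \in S -> ~ (e.1 = c.1 /\ c.2 = e.2 + 1).
    by move=> eS [e1 e2]; apply: (noc e).
  have {}nos (e : Z2) : e \in S -> ~ (e.2 = c.2 + 1 /\ e.1 = s.1).
    by move=> eS [e1 e2]; apply: (nos e).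
  have := noc _ xS; have := noc _ yS; have := nos _ zS; have := nos _ wS.
  clear -mE xy xz zw s2; case: mE => -[-> mE]; lia.
exists h; first split=> x y; rewrite ?inE.
- move=> /andP[xc xS] /andP[yc yS] xy.
  have := hx _ _ xS yS xy.
  have : ~ (x.1 = c.1 /\ x.2 = c.2).
    by move=> [? ?]; case/eqP: xc; apply: pointP.
  have : ~ (y.1 = c.1 /\ y.2 = c.2).
    by move=> [? ?]; case/eqP: yc; apply: pointP.
  clear -mE xy; case: mE => -[-> mE]; lia.
- move=> /andP[xc xS] /andP[yc yS] xy.
  by have := hy _ _ xS yS xy; case: (h x) (h y) => [] [].
- move=> t tS t1 t2.
  have ht := hy c t cS tS (conj t1 t2).
  have := hx c s cS sS; have := hx s c sS cS.
  clear -mE s2 ht; case: mE => -[-> mE]; lia.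
Qed.

(** Since nothing lies below [c], a block through [c] has it in its lower row and contains exactly
    one of its left and right sides, whose value is free; so cocycles extend to [c]. A pinch created
    by the removal is separated by [cut_side]. *)
Lemma board_like_remove (S : {fset Z2}) (c : Z2) :
  board_like S -> c \in S -> (forall d : Z2, above d c -> d \notin S) ->
  board_like (S `\ c)%fset.
Proof.
move=> [acS sepS] cS down; split.
- move=> wx wy wS.
  have [l [l1 l2]] := point_ex (c.1 - 1) c.2.
  have [r [r1 r2]] := point_ex (c.1 + 1) c.2.
  have [u [u1 u2]] := point_ex c.1 (c.2 + 1).
  have [v [v1 v2]] := point_ex (c.1 - 1) (c.2 + 1).
  (* With the value 0 on the upper side of [c], the blocks through [c] force the values on its right
     and left sides; the latter is stored at the left neighbour [l]. *)
  have [|h [hx hy]] := acS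
    (fun d => if d == c then wx u (+) wy r else if d == l then wx v (+) wy l else wx d)
    (fun d => if d == c then false else wy d).
    move=> a b e d aS bS eS dS ab ae ed.
    have dc : d != c.
      by apply/negP => /eqP E; subst d; have := down b; rewrite bS; lia.
    have ec : e != c.
      by apply/negP => /eqP E; subst e; have := down a; rewrite aS; lia.
    have el : e != l.
      by apply/negP => /eqP E; subst e; have := down b; rewrite bS; lia.
    have [ac|ac] := eqVneq a c.
      subst a; rewrite (negPf ec) (negPf el).
      have -> : b = r by apply: pointP; lia.
      have -> : e = u by apply: pointP; lia.
      have -> /= : (r == c) = false.
        by apply/negP => /eqP E; rewrite E in r1; lia.
      by case: (wx u) (wy r) => [] [].
    have [bc|bc] := eqVneq b c.
      subst b; rewrite (negPf ec) (negPf el).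
      have -> : a = l by apply: pointP; lia.
      have -> : e = v by apply: pointP; lia.
      by rewrite eqxx; case: (wx v) (wy l) => [] [].
    have al : a != l.
      by apply/negP => /eqP E; case/eqP: bc; apply: pointP; subst a; clear -ab l1 l2; lia.
    rewrite (negPf ec) (negPf el) (negPf al).
    by apply: (wS a b e d) => //; rewrite !inE ?ac ?bc ?ec ?dc.
  exists h; split=> a b; rewrite !inE => /andP[ac aS] /andP[bc bS] ab.
    rewrite hx // (negPf ac) ifN //.
    by apply: contra bc => /eqP E; apply/eqP; apply: pointP; subst a; lia.
  by rewrite hy // (negPf ac).
- move=> a b [].
  rewrite !inE => /andP[ac aS] /andP[bc bS] ab1 ab2 P.
  have sub h : side_const S h -> side_const (S `\ c)%fset h.
    case=> h1 h2; split=> x y; rewrite !inE => /andP[_ xS] /andP[_ yS] xy.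
      exact: h1.
    exact: h2.
  have PS (e : Z2) : e \in S -> (e.1 = a.1 /\ e.2 = b.2) \/ (e.1 = b.1 /\ e.2 = a.2) -> e = c.
    move=> eS; have [-> //|ec] := eqVneq e c.
    by have := P e; rewrite !inE ec => /(_ eS); lia.
  (* Either the pinch was already one of [S], or [c] is one of the two absent squares of its block;
     then one of [a], [b] lies beside [c] and the other above it. *)
  have [ca|nca] := pselect ((c.1 = a.1 /\ c.2 = b.2) \/ (c.1 = b.1 /\ c.2 = a.2)); last first.
    have [|h hS hab] := sepS a b; last by exists h => //; exact: sub.
    split=> // e eS; split=> E; have Ec : e = c by apply: PS => //; lia.
      by apply: nca; rewrite -Ec; lia.
    by apply: nca; rewrite -Ec; lia.
  have noc (d : Z2) : d \in S -> above d c -> False.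
    by move=> dS dc; move: (down d dc); rewrite dS.
  have nos (s : Z2) (e : Z2) : s \in S -> s.2 = c.2 -> (s = a \/ s = b) ->
      e \in S -> e.2 = c.2 + 1 -> e.1 = s.1 -> False.
    move=> sS s2 sab eS e2 e1; have Ec : e = c.
      by apply: PS => //; clear -s2 sab e2 e1 ca ab1 ab2 noc aS bS;
        have := noc _ aS; have := noc _ bS; case: sab => E; subst s; lia.
    by rewrite Ec in e2; clear -e2; lia.
  have ab0 : b.2 <> c.2 - 1 /\ a.2 <> c.2 - 1.
    by have := noc _ aS; have := noc _ bS; clear -ca ab1 ab2; lia.
  have [E|E] := eqVneq a.2 c.2.
    have [||h hS hc] := cut_side acS cS aS E _ noc.
    - by clear -E ab1 ab2 ca; lia.
    - by move=> e; apply: nos => //; left.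
    by exists h => //; apply: hc => //; clear -E ab0 ab1 ab2 ca; lia.
  have Eb : b.2 = c.2 by clear -E ca; lia.
  have [||h hS hc] := cut_side acS cS bS Eb _ noc.
  - by clear -E Eb ab1 ab2 ca; lia.
  - by move=> e; apply: nos => //; right.
  by exists h => //; rewrite eq_sym; apply: hc => //; clear -E Eb ab0 ab1 ab2 ca; lia.
Qed.

(** As squares are named by their lower left vertices, this acts on the plane as the point
    reflection in the centre of the square (0, 0), not in the origin. *)
Definition neg (c : Z2) : Z2 := (- c.1, - c.2).
Definition swap (c : Z2) : Z2 := (c.2, c.1).

Lemma negK : involutive neg.
Proof. by case=> a b; rewrite /neg /= !opprK. Qed.

Lemma swapK : involutive swap. Proof. by case. Qed.

Definition fimage (phi : Z2 -> Z2) (S : {fset Z2}) : {fset Z2} :=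
  [fset phi c | c in S]%fset.

Lemma mem_fimage phi S c : involutive phi -> (c \in fimage phi S) = (phi c \in S).
Proof.
move=> phiK; apply/imfsetP/idP => [[d dS ->]|cS]; first by rewrite phiK.
by exists (phi c); rewrite // phiK.
Qed.

Lemma fimageK phi : involutive phi -> involutive (fimage phi).
Proof.
by move=> phiK S; apply/fsetP => c; rewrite !mem_fimage // phiK.
Qed.

Lemma fimage0 phi S : involutive phi -> S != fset0 -> fimage phi S != fset0.
Proof.
move=> phiK /fset0Pn[c cS]; apply/fset0Pn; exists (phi c).
by rewrite mem_fimage // phiK.
Qed.

Lemma board_like_neg S : board_like S -> board_like (fimage neg S).
Proof.
case=> ac sep; have mS c : (c \in fimage neg S) = (neg c \in S).
  by rewrite mem_fimage //; exact: negK.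
split=> [wx wy w|c d [cS dS cd1 cd2 P]].
  (* [neg] exchanges right with left and upper with lower sides, whose values are stored at the left
     and at the lower neighbour; hence the shifts by -1. *)
  have [a b c d aS bS cS dS ab bc cd|h [hx hy]] := ac
    (fun c => wx (- c.1 - 1, - c.2)) (fun c => wy (- c.1, - c.2 - 1)).
    have := w (neg d) (neg c) (neg b) (neg a).
    rewrite !mS !negK /neg /= => /(_ dS cS bS aS).
    have -> : - a.1 - 1 = - b.1 by lia.
    have -> : - c.1 - 1 = - d.1 by lia.
    have -> : - b.2 - 1 = - d.2 by lia.
    have -> : - a.2 - 1 = - c.2 by lia.
    have -> : - c.1 = - a.1 by lia.
    have -> : - b.2 = - a.2 by lia.
    have -> : - d.2 = - c.2 by lia.
    have -> : - d.1 = - b.1 by lia.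
    lia.
  exists (fun c => h (neg c)); split=> c d; rewrite !mS => cS dS cd.
    rewrite addbC (hx (neg d) (neg c)) // /neg /=; last lia.
    by congr wx; apply: pointP => /=; lia.
  rewrite addbC (hy (neg d) (neg c)) // /neg /=; last lia.
  by congr wy; apply: pointP => /=; lia.
rewrite !mS in cS dS.
have [|h [hx hy] hcd] := sep (neg c) (neg d).
  split=> //; rewrite /neg /=; [lia|lia|move=> e eS].
  by have := P (neg e); rewrite mS negK => /(_ eS); rewrite /neg /=; lia.
exists (fun c => h (neg c)) => //; split=> x y; rewrite !mS => xS yS xy.
  by symmetry; apply: hx => //; rewrite /neg /=; lia.
by symmetry; apply: hy => //; rewrite /neg /=; lia.
Qed.

Lemma comb_board_neg S : comb_board S -> comb_board (fimage neg S).
Proof.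
case=> S0 conn bS; have mS c : (c \in fimage neg S) = (neg c \in S).
  by rewrite mem_fimage //; exact: negK.
split; first by apply: fimage0 => //; exact: negK.
- move=> h [hx hy] c d; rewrite !mS => cS dS.
  rewrite -(negK c) -(negK d); apply: (conn (fun c => h (neg c))) => //.
  split=> x y xS yS xy; symmetry.
    by apply: hx; rewrite ?mS ?negK // /neg /=; lia.
  by apply: hy; rewrite ?mS ?negK // /neg /=; lia.
- exact: board_like_neg.
Qed.

Lemma board_like_swap S : board_like S -> board_like (fimage swap S).
Proof.
case=> ac sep; have mS c : (c \in fimage swap S) = (swap c \in S).
  by rewrite mem_fimage //; exact: swapK.
split=> [wx wy w|c d [cS dS cd1 cd2 P]].
  have [a b c d aS bS cS dS ab bc cd|h [hx hy]] := ac
    (fun c => wy (swap c)) (fun c => wx (swap c)).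
    have := w (swap a) (swap c) (swap b) (swap d).
    rewrite !mS !swapK /swap /= => /(_ aS cS bS dS).
    lia.
  exists (fun c => h (swap c)); split=> c d; rewrite !mS => cS dS cd.
    by rewrite (hy (swap c) (swap d)) ?swapK // /swap /=; lia.
  by rewrite (hx (swap c) (swap d)) ?swapK // /swap /=; lia.
rewrite !mS in cS dS.
have [|h [hx hy] hcd] := sep (swap c) (swap d).
  split=> //; rewrite /swap /= => e eS.
  by have := P (swap e); rewrite mS swapK => /(_ eS); rewrite /swap /=; lia.
exists (fun c => h (swap c)) => //; split=> x y; rewrite !mS => xS yS xy.
  by apply: hy => //; rewrite /swap /=; lia.
by apply: hx => //; rewrite /swap /=; lia.
Qed.

Lemma comb_board_swap S : comb_board S -> comb_board (fimage swap S).
Proof.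
case=> S0 conn bS; have mS c : (c \in fimage swap S) = (swap c \in S).
  by rewrite mem_fimage //; exact: swapK.
split; first by apply: fimage0 => //; exact: swapK.
- move=> h [hx hy] c d; rewrite !mS => cS dS.
  rewrite -(swapK c) -(swapK d); apply: (conn (fun c => h (swap c))) => //.
  split=> x y xS yS xy.
    by apply: hy; rewrite ?mS ?swapK // /swap /=; lia.
  by apply: hx; rewrite ?mS ?swapK // /swap /=; lia.
- exact: board_like_swap.
Qed.

(** * Cuts along diagonals *)

(* The diagonal from the lower left vertex of c0 to the upper right vertex of
   c0 + (k - 1, k - 1): on_diag c0 k selects its squares. *)
Definition on_diag (c0 : Z2) (k : nat) (c : Z2) : bool :=
  (c.1 - c0.1 == c.2 - c0.2) && (0 <= c.1 - c0.1 < k%:Z).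

(** A diagonal in terms of squares: only [c0] contains the first vertex, the four squares around
    each intermediate vertex are present ([chord_block], where [c] is the lower left one), and one
    of the four around the last vertex is missing. *)
Record is_chord (S : {fset Z2}) (c0 : Z2) (k : nat) : Prop := IsChord {
  chord_gt0 : (0 < k)%N;
  chord_corner : forall d : Z2, d \in S -> c0.1 - 1 <= d.1 <= c0.1 ->
    c0.2 - 1 <= d.2 <= c0.2 -> d = c0;
  chord_mem : forall c : Z2, on_diag c0 k c -> c \in S;
  chord_block : forall c d : Z2, on_diag c0 k.-1 c ->
    c.1 <= d.1 <= c.1 + 1 -> c.2 <= d.2 <= c.2 + 1 -> d \in S;
  chord_end : exists d : Z2, [/\ d \notin S, c0.1 + k%:Z - 1 <= d.1 <= c0.1 + k%:Z &
    c0.2 + k%:Z - 1 <= d.2 <= c0.2 + k%:Z] }.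

(* For o = true, h changes exactly across the right and the lower sides of the
   squares in B; for o = false, across the left and the upper ones. *)
Definition is_cut (S : {fset Z2}) (B : Z2 -> bool) (o : bool) (h : Z2 -> bool) : Prop :=
  (forall c d : Z2, c \in S -> d \in S -> right_of c d ->
     h c (+) h d = B (if o then c else d)) /\
  (forall c d : Z2, c \in S -> d \in S -> above c d ->
     h c (+) h d = B (if o then d else c)).

Lemma seq_min (T : eqType) (f : T -> int) (s : seq T) : s != [::] ->
  exists2 c, c \in s & forall d, d \in s -> f c <= f d.
Proof.
elim: s => // a s IH _; case: (eqVneq s [::]) => [->|/IH[c cs cmin]].
  by exists a; rewrite ?mem_head // => d; rewrite inE => /eqP ->.
case: (lerP (f a) (f c)) => ac.
  exists a; rewrite ?mem_head // => d; rewrite inE => /orP[/eqP -> //|/cmin].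
  exact: le_trans.
exists c; rewrite ?inE ?cs ?orbT // => d; rewrite inE => /orP[/eqP ->|/cmin //].
exact: ltW.
Qed.

Lemma fset_min (f : Z2 -> int) (S : {fset Z2}) : S != fset0 ->
  exists2 c : Z2, c \in S & forall d : Z2, d \in S -> f c <= f d.
Proof.
move=> S0; have [|c cS cmin] := @seq_min _ f (enum_fset S).
  by move: S0 => /fset0Pn[c cS]; apply/eqP => E; move: (cS : c \in enum_fset S); rewrite E.
by exists c.
Qed.

(** The diagonal is continued as long as the block ahead of it is full, and finiteness of [S] stops
    it. *)
Lemma chord_exists (S : {fset Z2}) (c0 : Z2) : c0 \in S ->
  (forall d : Z2, d \in S -> c0.1 - 1 <= d.1 <= c0.1 ->
     c0.2 - 1 <= d.2 <= c0.2 -> d = c0) ->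
  exists k, is_chord S c0 k.
Proof.
move=> c0S corner.
pose sq (i : nat) : Z2 := (c0.1 + i%:Z, c0.2 + i%:Z).
pose full (c : Z2) :=
  [&& c \in S, (c.1 + 1, c.2) \in S, (c.1, c.2 + 1) \in S & (c.1 + 1, c.2 + 1) \in S].
have fullE (c d : Z2) : full c -> c.1 <= d.1 <= c.1 + 1 -> c.2 <= d.2 <= c.2 + 1 -> d \in S.
  move=> /and4P[x1 x2 x3 x4] d1 d2.
  have [e1|e1] := eqVneq d.1 c.1; have [e2|e2] := eqVneq d.2 c.2.
  - by rewrite (pointP e1 e2).
  - by rewrite (_ : d = (c.1, c.2 + 1)) //; apply: pointP => //=; lia.
  - by rewrite (_ : d = (c.1 + 1, c.2)) //; apply: pointP => //=; lia.
  - by rewrite (_ : d = (c.1 + 1, c.2 + 1)) //; apply: pointP => /=; lia.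
have ex : exists i, ~~ full (sq i).
  have [|m mS mmax] := fset_min (fun c : Z2 => - c.1) (S := S).
    by apply/fset0Pn; exists c0.
  exists (absz (m.1 - c0.1)).+1; apply/negP => /and4P[xS _ _ _].
  have := mmax _ xS; have := mmax _ c0S; rewrite /sq /=; lia.
case: (ex_minnP ex) => n nfull nmin.
have full_lt i : (i < n)%N -> full (sq i).
  by move=> ilt; apply/negPn/negP => /nmin; rewrite leqNgt ilt.
have diagE (c : Z2) j : on_diag c0 j c -> exists2 i, (i < j)%N & c = sq i.
  move=> /andP[/eqP e1 e2]; exists (absz (c.1 - c0.1)); first lia.
  by apply: pointP; rewrite /sq /=; lia.
exists n.+1; split=> //.
- move=> c /diagE[[|i] ilt ->].
    by rewrite (_ : sq 0%N = c0) //; apply: pointP; rewrite /sq /= ?addr0.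
  by apply: (fullE (sq i)); rewrite ?full_lt // /sq /=; lia.
- by move=> c d /diagE[i ilt ->]; apply: fullE; apply: full_lt.
- case: (pselect (exists d : Z2, [/\ d \notin S, c0.1 + n.+1%:Z - 1 <= d.1 <= c0.1 + n.+1%:Z &
    c0.2 + n.+1%:Z - 1 <= d.2 <= c0.2 + n.+1%:Z])) => // nex.
  case/negP: nfull; apply/and4P.
  by split; apply/negPn/negP => dS; apply: nex; eexists; (split; first exact: dS); clear;
    rewrite /sq /=; lia.
Qed.

(** On a block with lower left square [a] and upper right square [d], the cocycle condition reduces
    to [on_diag c0 k a = on_diag c0 k d]. It holds because a full block surrounds neither the corner
    nor the end of the chord. *)
Lemma cut_exists (S : {fset Z2}) (c0 : Z2) (k : nat) :
  acyclic S -> is_chord S c0 k ->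
  exists h, is_cut S (on_diag c0 k) true h /\ h c0 = false.
Proof.
move=> ac C.
have [|h [hx hy]] := ac (on_diag c0 k) (fun c => on_diag c0 k (c.1, c.2 + 1)).
  move=> a b c d aS bS cS dS ab bc cd.
  have -> : (b.1, b.2 + 1) = d by apply: pointP => /=; lia.
  have -> : (a.1, a.2 + 1) = c by apply: pointP => /=; lia.
  suff -> : on_diag c0 k a = on_diag c0 k d by case: on_diag (on_diag _ _ c) => [] [].
  have := chord_corner C aS; have := chord_corner C bS.
  have [e [eS e1 e2]] := chord_end C; move: (chord_gt0 C) => k0.
  have [E|E] := eqVneq (a.1 - c0.1) (k%:Z - 1).
    case: (eqVneq (a.2 - c0.2) (k%:Z - 1)) => E2; last by rewrite /on_diag; lia.
    case/negP: eS.
    case: (eqVneq e.1 a.1) (eqVneq e.2 a.2) => e1' [] e2'.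
    - by rewrite (_ : e = a) //; apply: pointP.
    - by rewrite (_ : e = c) //; apply: pointP; lia.
    - by rewrite (_ : e = b) //; apply: pointP; lia.
    - by rewrite (_ : e = d) //; apply: pointP; lia.
  have [E'|E'] := eqVneq d c0; last first.
    have {}E' : ~ (d.1 = c0.1 /\ d.2 = c0.2) by case=> ? ?; case/eqP: E'; exact: pointP.
    by rewrite /on_diag => _ _; clear -E E' ab bc cd; lia.
  have := chord_corner C aS; subst d; move=> /(_ ltac:(lia) ltac:(lia)) E1; subst a; lia.
exists (fun c => h c (+) h c0); split; last by rewrite addbb.
split=> c d cS dS cd.
  by rewrite -(hx c d) //; case: (h c) (h d) (h c0) => [] [] [].
have := hy c d cS dS cd; rewrite (_ : (c.1, c.2 + 1) = d); last by apply: pointP => /=; lia.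
by move=> <-; case: (h c) (h d) (h c0) => [] [] [].
Qed.

(** Two consecutive squares of the diagonal are joined through the square [m] at their upper left,
    across sides that are not cut. *)
Lemma cut_on_diag (S : {fset Z2}) (c0 : Z2) (k : nat) h c :
  is_chord S c0 k -> is_cut S (on_diag c0 k) true h -> h c0 = false ->
  on_diag c0 k c -> h c = false.
Proof.
move=> C [hx hy] h0 ck.
have [n En] : exists n : nat, c.1 = c0.1 + n%:Z.
  by exists (absz (c.1 - c0.1)); move: ck; rewrite /on_diag; lia.
elim: n => [|n IH] in c ck En *.
  by rewrite (_ : c = c0) //; apply: pointP; move: ck; rewrite /on_diag; lia.
have [p [p1 p2]] := point_ex (c.1 - 1) (c.2 - 1).
have [m [m1 m2]] := point_ex (c.1 - 1) c.2.
have pk : on_diag c0 k.-1 p by move: ck; rewrite /on_diag; lia.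
have pk' : on_diag c0 k p by move: pk; rewrite /on_diag; lia.
have mS : m \in S by apply: (chord_block C pk); lia.
have hm := hy p m (chord_mem C pk') mS; have hc := hx m c mS (chord_mem C ck).
have mk : ~~ on_diag c0 k m by move: ck; rewrite /on_diag; lia.
  have := IH p pk'; clear -p1 p2 m1 m2 En hm hc mk; lia.
Qed.

Lemma cuts_disjoint (S : {fset Z2}) (B : Z2 -> bool) h1 h2 b c :
  side_connected S ->
  is_cut S B true h1 -> is_cut S B false h2 ->
  (forall d, B d -> h1 d = false /\ h2 d = false) ->
  (forall d e : Z2, B d -> B e -> right_of d e \/ above d e -> False) ->
  b \in S -> B b -> c \in S -> ~~ (h1 c && h2 c).
Proof.
move=> conn [x1 y1] [x2 y2] B0 Badj bS Bb cS.
rewrite (conn (fun d => h1 d && h2 d) _ c b) ?(proj1 (B0 b Bb)) //.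
split=> d e dS eS de.
- have nB : ~~ (B d && B e) by apply/negP => /andP[Bd Be]; apply: (Badj d e); auto.
  have := x1 d e dS eS de; have := x2 d e dS eS de.
  have := B0 d; have := B0 e; clear -nB; lia.
- have nB : ~~ (B d && B e) by apply/negP => /andP[Bd Be]; apply: (Badj d e); auto.
  have := y1 d e dS eS de; have := y2 d e dS eS de.
  have := B0 d; have := B0 e; clear -nB; lia.
Qed.

(** The function [~~ h c && hB c] is constant: it vanishes on both sides of every side where [h] or
    [hB] changes, since [hB] vanishes along the diagonal and [h] holds on [B]. Its value at [c0] is
    false. *)
Lemma cut_sub (S : {fset Z2}) (c0 : Z2) (k : nat) h (B : Z2 -> bool) (o : bool) hB :
  side_connected S ->
  is_chord S c0 k -> is_cut S (on_diag c0 k) true h -> h c0 = false ->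
  is_cut S B o hB -> (forall b, b \in S -> B b -> h b) -> hB c0 = false ->
  forall c, c \in S -> hB c -> h c.
Proof.
move=> conn C [hx hy] h0 [Bx By] BR B0.
have hq c : on_diag c0 k c -> h c = false by apply: cut_on_diag C _ h0; split.
have qS c : on_diag c0 k c -> c \in S by exact: chord_mem.
have BL c : c \in S -> h c = false -> B c = false.
  by move=> cS hc; apply/negP => /(BR c cS); rewrite hc.
have hBq c : on_diag c0 k c -> hB c = false.
  move=> ck; have [n En] : exists n : nat, c.1 = c0.1 + n%:Z.
    by exists (absz (c.1 - c0.1)); move: ck; rewrite /on_diag; lia.
  elim: n => [|n IH] in c ck En *.
    by rewrite (_ : c = c0) //; apply: pointP; move: ck; rewrite /on_diag; lia.
  have [p [p1 p2]] := point_ex (c.1 - 1) (c.2 - 1).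
  have [m [m1 m2]] := point_ex (c.1 - 1) c.2.
  have pk : on_diag c0 k.-1 p by move: ck; rewrite /on_diag; lia.
  have pk' : on_diag c0 k p by move: pk; rewrite /on_diag; lia.
  have mS : m \in S by apply: (chord_block C pk); lia.
  have := By p m (qS _ pk') mS; have := Bx m c mS (qS _ ck).
  have hm : h m = false.
    have := hy p m (qS _ pk') mS; rewrite (hq _ pk').
    have mk : ~~ on_diag c0 k m by move: ck; rewrite /on_diag; lia.
    by clear -p1 p2 m1 m2 mk; lia.
  have := BL m mS hm; have := BL p (qS _ pk') (hq _ pk'); have := BL c (qS _ ck) (hq _ ck).
  have := IH p pk'; clear -p1 p2 m1 m2 En.
  by case: o; lia.
have FE : side_const S (fun c => ~~ h c && hB c).
  split=> c d cS dS cd.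
  - have := hx c d cS dS cd; have := Bx c d cS dS cd.
    have := BL c cS; have := BL d dS; have := hq c; have := hBq c.
    clear; case: o; lia.
  - have := hy c d cS dS cd; have := By c d cS dS cd.
    have := BL c cS; have := BL d dS; have := hq d; have := hBq d.
    clear; case: o; lia.
move=> c cS hc; have c0S : c0 \in S by apply: qS; rewrite /on_diag; have := chord_gt0 C; lia.
by have := conn _ FE c c0 cS c0S; rewrite B0 hc; case: (h c); rewrite // andbF.
Qed.

Definition cut_part (S : {fset Z2}) (h : Z2 -> bool) : {fset Z2} :=
  [fset c in S | h c]%fset.

Lemma mem_cut_part S h c : (c \in cut_part S h) = (c \in S) && h c.
Proof. by rewrite !inE. Qed.

Lemma cut_part_fimage phi S h : involutive phi ->
  #|` cut_part (fimage phi S) h| = #|` cut_part S (fun c => h (phi c))|.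
Proof.
move=> phiK; have -> : cut_part (fimage phi S) h = fimage phi (cut_part S (fun c => h (phi c))).
  by apply/fsetP => c; rewrite mem_fimage // !mem_cut_part mem_fimage // phiK.
by rewrite card_imfset //; exact: inv_inj.
Qed.

Lemma chord_swap S c0 k : is_chord S c0 k -> is_chord (fimage swap S) (swap c0) k.
Proof.
case=> k0 corner mem block [e [eS e1 e2]].
have mS c : (c \in fimage swap S) = (swap c \in S) by rewrite mem_fimage //; exact: swapK.
split=> //.
- move=> d; rewrite mS => dS /= d1 d2; rewrite -(swapK d); congr swap.
  by apply: corner.
- by move=> c ck; rewrite mS; apply: mem; move: ck; rewrite /on_diag /swap /=; lia.
- move=> c d ck d1 d2; rewrite mS; apply: (block (swap c)) => //.
  by move: ck; rewrite /on_diag /swap /=; lia.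
- by exists (swap e); rewrite mS swapK.
Qed.

(** The cuts along the two zig-zags of one diagonal. The second is a cut of the board reflected by
    [swap], and the last clause keeps it in that form, so that the descent can go on in the
    reflected board. *)
Lemma corner_cuts (S : {fset Z2}) (c : Z2) :
  comb_board S -> c \in S ->
  (forall d : Z2, d \in S -> c.1 - 1 <= d.1 <= c.1 -> c.2 - 1 <= d.2 <= c.2 -> d = c) ->
  exists k h1 h2, [/\ is_chord S c k,
    is_cut S (on_diag c k) true h1 /\ h1 c = false,
    is_cut S (on_diag c k) false h2 /\ h2 c = false &
    is_cut (fimage swap S) (on_diag (swap c) k) true (fun d => h2 (swap d))].
Proof.
move=> cb cS corner; have [k C] := chord_exists cS corner.
have [h1 [H1 h10]] : exists h, is_cut S (on_diag c k) true h /\ h c = false.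
  by apply: cut_exists => //; case: cb => _ _ [].
have [h2 [[hx hy] h20]] : exists h,
    is_cut (fimage swap S) (on_diag (swap c) k) true h /\ h (swap c) = false.
  apply: cut_exists; last exact: chord_swap.
  by case: (comb_board_swap cb) => _ _ [].
have mS d : (d \in fimage swap S) = (swap d \in S) by rewrite mem_fimage //; exact: swapK.
have dE d : on_diag (swap c) k (swap d) = on_diag c k d by rewrite /on_diag /swap /=; lia.
exists k, h1, (fun d => h2 (swap d)); split=> //.
  split=> //; split=> d e dS eS de.
    by rewrite -dE; apply: hy; rewrite ?mS ?swapK // /swap /=; lia.
  by rewrite -dE; apply: hx; rewrite ?mS ?swapK // /swap /=; lia.
by split=> d e dS eS de; rewrite !swapK; [exact: hx | exact: hy].
Qed.

(* The good diagonals along which cut and paste only shrinks the board: on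
   their right the boundary of S is a staircase. *)
Record is_staircase (S : {fset Z2}) (c0 : Z2) (k : nat) (h : Z2 -> bool) : Prop :=
IsStaircase {
  stair_chord : is_chord S c0 k;
  stair_cut : is_cut S (on_diag c0 k) true h;
  stair_base : h c0 = false;
  stair_end : forall d : Z2, d.1 = c0.1 + k%:Z -> d.2 = c0.2 + k%:Z - 1 -> d \notin S;
  stair_left : forall c d : Z2, c \in S -> h c -> right_of d c ->
    d \in S /\ (h d || on_diag c0 k d);
  stair_above : forall c d : Z2, c \in S -> h c -> above c d ->
    d \in S /\ (h d || on_diag c0 k d) }.

Definition has_staircase (S : {fset Z2}) : Prop :=
  exists c0 k h, is_staircase S c0 k h.

Definition cut_side_part (S : {fset Z2}) (c0 : Z2) (k : nat) (h : Z2 -> bool) (c : Z2) :=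
  (c \in S) && (h c || on_diag c0 k c).

(** * Parts without lower left and upper right corners are bounded by staircases *)

Section Chord.
Context (S : {fset Z2}) (c0 : Z2) (k : nat) (h : Z2 -> bool).
Context (cb : comb_board S) (C : is_chord S c0 k).
Context (hcut : is_cut S (on_diag c0 k) true h) (h0 : h c0 = false).

Let hx := proj1 hcut.
Let hy := proj2 hcut.
Let hq (c : Z2) : on_diag c0 k c -> h c = false.
Proof. exact: cut_on_diag C hcut h0. Qed.
Let P := cut_side_part S c0 k h.

Lemma part_mem (c : Z2) : P c -> c \in S. Proof. by case/andP. Qed.

Lemma part_right (c d : Z2) : P c -> d \in S -> right_of c d -> P d.
Proof.
move=> /andP[cS cP] dS cd; have := hx cS dS cd; rewrite /P /cut_side_part dS /=.
have := hq (c := c); move: cP; clear; lia.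
Qed.

Lemma part_left (c d : Z2) : P c -> h c -> d \in S -> right_of d c -> P d.
Proof.
move=> /andP[cS cP] hc dS cd; have := hx dS cS cd; rewrite /P /cut_side_part dS /=.
by move: hc; clear; lia.
Qed.

Lemma part_above (c d : Z2) : P c -> h c -> d \in S -> above c d -> P d.
Proof.
move=> /andP[cS cP] hc dS cd; have := hy cS dS cd; rewrite /P /cut_side_part dS /=.
by move: hc; clear; lia.
Qed.

Lemma part_below (c d : Z2) : P c -> d \in S -> above d c -> P d.
Proof.
move=> /andP[cS cP] dS cd; have := hy dS cS cd; rewrite /P /cut_side_part dS /=.
have := hq (c := c); move: cP; clear; lia.
Qed.

(** A neighbour in [S] would belong to the part by the cut, and a square meeting [c] only in the
    vertex would form a pinch with it. The sign [s] treats the upper right and the lower left vertex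
    at once. *)
Lemma part_corner (s : int) (c : Z2) : s = 1 \/ s = -1 -> P c -> h c ->
  (forall d : Z2, P d -> ~ (d.2 = c.2 /\ d.1 = c.1 + s)) ->
  (forall d : Z2, P d -> ~ (d.1 = c.1 /\ d.2 = c.2 + s)) ->
  forall d : Z2, d \in S -> (d.1 = c.1 \/ d.1 = c.1 + s) ->
    (d.2 = c.2 \/ d.2 = c.2 + s) -> d = c.
Proof.
move=> s1 Pc hc noh nov d dS d1 d2.
have noh' (e : Z2) : e \in S -> ~ (e.2 = c.2 /\ e.1 = c.1 + s).
  move=> eS ee; apply: (noh e _ ee); case: s1 ee => -> ee.
    by apply: (part_right Pc) => //; clear -ee; lia.
  by apply: (part_left Pc hc) => //; clear -ee; lia.
have nov' (e : Z2) : e \in S -> ~ (e.1 = c.1 /\ e.2 = c.2 + s).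
  move=> eS ee; apply: (nov e _ ee); case: s1 ee => -> ee.
    by apply: (part_above Pc hc) => //; clear -ee; lia.
  by apply: (part_below Pc) => //; clear -ee; lia.
have [E|E] := pselect (c.1 <> d.1 /\ c.2 <> d.2).
  case: (@no_pinch S c d cb); split => //; first exact: part_mem.
  - by clear -E d1 s1; lia.
  - by clear -E d2 s1; lia.
  - move=> e eS; have := noh' e eS; have := nov' e eS.
    by clear -E d1 d2 s1; lia.
by apply: pointP; have := noh' d dS; have := nov' d dS; clear -E d1 d2 s1; lia.
Qed.

Context (noSW : forall c : Z2, c \in S -> h c -> ~ (forall d : Z2, d \in S ->
  c.1 - 1 <= d.1 <= c.1 -> c.2 - 1 <= d.2 <= c.2 -> d = c)).
Context (noNE : forall c : Z2, c \in S -> h c -> ~ (forall d : Z2, d \in S ->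
  c.1 <= d.1 <= c.1 + 1 -> c.2 <= d.2 <= c.2 + 1 -> d = c)).

Let last (c : Z2) := c.1 = c0.1 + k%:Z - 1 /\ c.2 = c0.2 + k%:Z - 1.

(** A square of the cut off part that cannot be left to the right or upwards would have a corner
    excluded by [noNE]; from a diagonal square other than the last one, the block ahead gives the
    right neighbour. *)
Lemma part_climb (c : Z2) : P c -> ~ last c ->
  exists2 d : Z2, P d & right_of c d \/ above c d.
Proof.
move=> Pc nl; case: (pselect (exists2 d : Z2, P d & right_of c d \/ above c d)) => // nd.
have cS := part_mem Pc; have [hc|hc] := boolP (h c).
  case: (noNE cS hc) => d dS d1 d2.
  apply: (@part_corner 1 c _ Pc hc) => //; first by left.
  - by move=> e Pe ee; apply: nd; exists e => //; left; clear -ee; lia.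
  - by move=> e Pe ee; apply: nd; exists e => //; right; clear -ee; lia.
  - by clear -d1; lia.
  - by clear -d2; lia.
have ck : on_diag c0 k c by move: Pc hc; rewrite /P /cut_side_part; lia.
case: nd; have [d [d1 d2]] := point_ex (c.1 + 1) c.2.
exists d; last by left.
apply: (part_right Pc) => //; apply: (chord_block C (c := c)); [|lia|lia].
by move: ck nl; rewrite /on_diag /last; clear; lia.
Qed.

Let k_gt0 : (0 < k)%N := chord_gt0 C.

Lemma part_max : exists M : int, forall c : Z2, P c -> c.1 + c.2 <= M.
Proof.
have [|m _ mmax] := @fset_min (fun c => - (c.1 + c.2)) S; first by case: cb.
by exists (m.1 + m.2) => c /part_mem /mmax; clear; lia.
Qed.

(** Otherwise one could climb forever from [d], which is already beyond the only square where
    climbing may stop. *)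
Lemma part_end (d : Z2) : d.1 = c0.1 + k%:Z -> d.2 = c0.2 + k%:Z - 1 -> d \notin S.
Proof.
move=> d1 d2; apply/negP => dS; have [M PM] := part_max.
have [l [l1 l2]] := point_ex (c0.1 + k%:Z - 1) (c0.2 + k%:Z - 1).
have lk : on_diag c0 k l by rewrite /on_diag; move: k_gt0; clear -l1 l2; lia.
have Pl : P l by rewrite /P /cut_side_part lk orbT (chord_mem C).
have Pd : P d by apply: (part_right Pl) => //; clear -l1 l2 d1 d2; lia.
have dl : d.1 + d.2 > l.1 + l.2 by clear -l1 l2 d1 d2; lia.
have [n En] : exists n : nat, M - (d.1 + d.2) = n%:Z.
  by apply: int_nat; have := PM _ Pd; clear; lia.
elim: n d {dS d1 d2} Pd dl En => [|n IH] d Pd dl En.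
  have [|e Pe de] := part_climb Pd; first by rewrite /last; clear -l1 l2 dl; lia.
  by have := PM _ Pe; clear -de En; lia.
have [|e Pe de] := part_climb Pd; first by rewrite /last; clear -l1 l2 dl; lia.
by apply: (IH e Pe); clear -de En dl; lia.
Qed.

(* Otherwise two monotone paths from a and b to the last square would enclose
   the square m, which is not in S: the cut along the diagonal ray from m
   crosses their union once. *)
Lemma part_convex (r a b m : Z2) : P r -> P a -> P b ->
  right_of r a -> above r b -> right_of b m -> P m.
Proof.
move=> Pr Pa Pb ra rb bm; apply/negPn/negP => nPm.
have mS : m \notin S.
  apply/negP => mS; move: nPm; rewrite (part_right Pb) //.
have [rS aS bS] : [/\ r \in S, a \in S & b \in S] by split; exact: part_mem.
case: (cb) => _ _ [ac _].
pose ray (c : Z2) := (c.1 - m.1 == c.2 - m.2) && (0 <= c.1 - m.1).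
have [|g [gx gy]] := ac ray (fun c => ray (c.1, c.2 + 1)).
  move=> x y z w xS yS zS wS xy xz zw.
  have -> : (y.1, y.2 + 1) = w by apply: pointP => /=; clear -xy xz zw; lia.
  have -> : (x.1, x.2 + 1) = z by apply: pointP => /=; clear -xy xz zw; lia.
  have wm : ~ (w.1 = m.1 /\ w.2 = m.2).
    by move=> [? ?]; case/negP: mS; rewrite (_ : m = w) //; apply: pointP.
  by rewrite /ray; clear -xy xz zw wm; lia.
have {}gy (c d : Z2) : c \in S -> d \in S -> above c d -> g c (+) g d = ray d.
  by move=> cS dS cd; rewrite gy //; congr ray; apply: pointP => /=; clear -cd; lia.
(* For squares with [c.1 + c.2] at least [m.1 + m.2 - 1], a step right or up changes [g] exactly
   when it crosses the line of the ray. So [F] is constant along climbing paths, whereas [a] and [b]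
   lie on opposite sides of that line and [g a = g r = g b]. *)
pose F (c : Z2) := g c (+) (c.1 - m.1 <= c.2 - m.2).
have [M PM] := part_max.
have [l [l1 l2]] := point_ex (c0.1 + k%:Z - 1) (c0.2 + k%:Z - 1).
have FE (c : Z2) : P c -> m.1 + m.2 - 1 <= c.1 + c.2 -> F c = F l.
  move=> Pc cm; have [n En] : exists n : nat, M - (c.1 + c.2) = n%:Z.
    by apply: int_nat; have := PM _ Pc; clear; lia.
  elim: n c Pc cm En => [|n IH] c Pc cm En.
    have [cl|cl] := pselect (last c); first by congr F; apply: pointP; move: cl; rewrite /last; clear -l1 l2; lia.
    by have [d Pd cd] := part_climb Pc cl; have := PM _ Pd; clear -cd En; lia.
  have [cl|cl] := pselect (last c); first by congr F; apply: pointP; move: cl; rewrite /last; clear -l1 l2; lia.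
  have [d Pd cd] := part_climb Pc cl.
  rewrite -(IH d Pd); [|by clear -cd cm; lia|by clear -cd En; lia].
  have gd1 := gx c d (part_mem Pc) (part_mem Pd); have gd2 := gy c d (part_mem Pc) (part_mem Pd).
  by rewrite /F; move: gd1 gd2; rewrite /ray; clear -cd cm; lia.
have Fa : F a = F l by apply: FE => //; clear -ra rb bm; lia.
have Fb : F b = F l by apply: FE => //; clear -ra rb bm; lia.
have := gx r a rS aS ra; have := gy r b rS bS rb.
by move: Fa; rewrite -Fb /F /ray; clear -ra rb bm; lia.
Qed.

(** Induction on [c.1 + c.2]. A missing left or upper neighbour of [c] entails one for the left, the
    lower or the lower left square, which is then on the diagonal; the next diagonal square or the
    cut decides each case. [part_end] ensures that there is a next one. *)
Lemma part_rim (c : Z2) : P c ->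
  (forall d : Z2, P d -> ~ right_of d c) \/ (forall d : Z2, P d -> ~ above c d) ->
  on_diag c0 k c.
Proof.
have [|m _ mmin] := @fset_min (fun c => c.1 + c.2) S; first by case: cb.
move=> Pc; have [n En] : exists n : nat, c.1 + c.2 - (m.1 + m.2) = n%:Z.
  by apply: int_nat; have := mmin _ (part_mem Pc); clear; lia.
elim/ltn_ind: n c Pc En => n IH c Pc En rim.
have {}IH (d : Z2) : P d -> d.1 + d.2 < c.1 + c.2 ->
    (forall e : Z2, P e -> ~ right_of e d) \/ (forall e : Z2, P e -> ~ above d e) ->
    on_diag c0 k d.
  move=> Pd dc erim; have [i Ei] : exists i : nat, d.1 + d.2 - (m.1 + m.2) = i%:Z.
    by apply: int_nat; have := mmin _ (part_mem Pd); clear; lia.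
  by apply: (IH i) => //; clear -dc Ei En; lia.
have notlast (d : Z2) : on_diag c0 k d -> (exists2 e : Z2, P e & right_of d e) ->
    d.1 - c0.1 < k%:Z - 1.
  move=> dk [e Pe de]; case: (ltrP (d.1 - c0.1) (k%:Z - 1)) => // dl.
  have := @part_end e; rewrite (part_mem Pe) => ne.
  by case/negP: (ne ltac:(move: dk; rewrite /on_diag; clear -de dl; lia)
    ltac:(move: dk; rewrite /on_diag; clear -de dl; lia)).
have [hc|hc] := boolP (h c); last by move: Pc hc; rewrite /P /cut_side_part; case/andP; lia.
case: (pselect (exists2 l : Z2, P l & right_of l c)) => [[l Pl lc]|nl].
  case: rim => [/(_ l Pl)//|noa].
  case: (pselect (exists2 b : Z2, P b & above l b)) => [[b Pb lb]|nb].
    have [d [d1 d2]] := point_ex c.1 (c.2 + 1).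
    have Pd : P d by apply: (part_convex Pl Pc Pb) => //; clear -lc lb d1 d2; lia.
    by case: (noa d Pd).
  have lk : on_diag c0 k l.
    apply: IH => //; first by clear -lc; lia.
    by right=> e Pe le; apply: nb; exists e.
  have ll := notlast l lk ltac:(by exists c).
  have [d [d1 d2]] := point_ex c.1 (c.2 + 1).
  have dk : on_diag c0 k d by move: lk ll; rewrite /on_diag; clear -lc d1 d2; lia.
  by case: (noa d); rewrite // /P /cut_side_part dk orbT (chord_mem C).
case: (pselect (exists2 b : Z2, P b & above b c)) => [[b Pb bc]|nb]; last first.
  case: (noSW (part_mem Pc) hc) => d dS d1 d2.
  apply: (@part_corner (-1) c _ Pc hc) => //; first by right.
  - by move=> e Pe ee; apply: nl; exists e => //; clear -ee; lia.
  - by move=> e Pe ee; apply: nb; exists e => //; clear -ee; lia.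
  - by clear -d1; lia.
  - by clear -d2; lia.
case: (pselect (exists2 e : Z2, P e & right_of e b)) => [[e Pe eb]|ne]; last first.
  have bk : on_diag c0 k b.
    apply: IH => //; first by clear -bc; lia.
    by left=> e Pe eb; apply: ne; exists e.
  have := hy (part_mem Pb) (part_mem Pc) bc; rewrite (hq bk) hc.
  by move: bk; rewrite /on_diag; clear -bc; lia.
have ek : on_diag c0 k e.
  apply: IH => //; first by clear -bc eb; lia.
  by right=> f Pf ef; apply: nl; exists f => //; clear -bc eb ef; lia.
have el := notlast e ek ltac:(by exists b).
by move: ek el; rewrite /on_diag; clear -eb bc; lia.
Qed.

Lemma chord_staircase : is_staircase S c0 k h.
Proof.
have Rk c : h c -> on_diag c0 k c -> False by move=> hc /hq; rewrite hc.
split=> //; first exact: part_end.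
- move=> c d cS hc dc; have Pc : P c by rewrite /P /cut_side_part cS hc.
  apply/andP/negPn/negP => nP; apply: (Rk c hc); apply: part_rim => //.
  by left=> e Pe ec; case/negP: nP; rewrite -/(P d) (_ : d = e) //; apply: pointP; lia.
- move=> c d cS hc dc; have Pc : P c by rewrite /P /cut_side_part cS hc.
  apply/andP/negPn/negP => nP; apply: (Rk c hc); apply: part_rim => //.
  by right=> e Pe ec; case/negP: nP; rewrite -/(P d) (_ : d = e) //; apply: pointP; lia.
Qed.

End Chord.

(** * Descent to a staircase *)

Lemma cut_part_lt (S : {fset Z2}) (h g : Z2 -> bool) (b : Z2) :
  (forall c, c \in S -> g c -> h c) -> b \in S -> h b -> ~~ g b ->
  (#|` cut_part S g| < #|` cut_part S h|)%N.
Proof.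
move=> gh bS hb gb; apply: fproper_ltn_card; rewrite fproperEneq; apply/andP; split.
  by apply/eqP => E; have := mem_cut_part S h b; rewrite -E mem_cut_part bS hb (negPf gb).
by apply/fsubsetP => c; rewrite !mem_cut_part => /andP[cS gc]; rewrite cS gh.
Qed.

(** By [cuts_disjoint] one of the two parts along [B] avoids [c0]; by [cut_sub] it lies in the part
    of [h], strictly, because of [b]. *)
Lemma smaller_cut (S : {fset Z2}) (c0 : Z2) (k : nat) h (B : Z2 -> bool) h1 h2 (b : Z2) :
  comb_board S -> is_chord S c0 k -> is_cut S (on_diag c0 k) true h -> h c0 = false ->
  is_cut S B true h1 -> is_cut S B false h2 ->
  (forall d : Z2, B d -> [/\ d \in S, h d, h1 d = false & h2 d = false]) ->
  (forall d e : Z2, B d -> B e -> right_of d e \/ above d e -> False) -> B b ->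
  (#|` cut_part S h1| < #|` cut_part S h|)%N \/
  (#|` cut_part S h2| < #|` cut_part S h|)%N.
Proof.
move=> cb C hcut h0 B1 B2 BE Badj Bb.
have [_ conn _] := cb; have [bS hb b1 b2] := BE b Bb.
have c0S : c0 \in S by apply: (chord_mem C); rewrite /on_diag; have := chord_gt0 C; lia.
have : ~~ (h1 c0 && h2 c0).
  by apply: (cuts_disjoint conn B1 B2 _ Badj bS) => // d /BE[].
have BR d : d \in S -> B d -> h d by move=> _ /BE[].
rewrite negb_and => /orP[] /negPf c00; [left|right]; apply: (@cut_part_lt _ _ _ b) => //.
- exact: (cut_sub conn C hcut h0 B1 BR c00).
- by rewrite b1.
- exact: (cut_sub conn C hcut h0 B2 BR c00).
- by rewrite b2.
Qed.

(** Passing through the lower right square [m] of the block crosses the cut at [p] and at the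
    opposite square or at neither, as a full block surrounds no end of the chord. *)
Lemma parallel_same_side (S : {fset Z2}) (c0 : Z2) (k : nat) h (p : Z2) :
  is_chord S c0 k -> is_cut S (on_diag c0 k) true h -> h c0 = false ->
  (forall d : Z2, p.1 <= d.1 <= p.1 + 1 -> p.2 <= d.2 <= p.2 + 1 -> d \in S) ->
  h p = h (p.1 + 1, p.2 + 1).
Proof.
move=> C [hx hy] h0 full.
have [q [q1 q2]] := point_ex (p.1 + 1) (p.2 + 1).
have [m [m1 m2]] := point_ex (p.1 + 1) p.2.
rewrite -[(_, _)]/((p.1 + 1, p.2 + 1) : Z2).
have -> : ((p.1 + 1, p.2 + 1) : Z2) = q by apply: pointP.
have pS : p \in S by apply: full; lia.
have qS : q \in S by apply: full; lia.
have mS : m \in S by apply: full; lia.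
have := hx p m pS mS ltac:(lia); have := hy m q mS qS ltac:(lia).
suff : on_diag c0 k p = on_diag c0 k q by clear; lia.
have [qc|qc] := pselect (q.1 = c0.1 /\ q.2 = c0.2).
  by have /(congr1 fst) := chord_corner C pS ltac:(lia) ltac:(lia); move: qc q1; clear; lia.
have [e [eS e1 e2]] := chord_end C.
have [pc|pc] := pselect (p.1 = c0.1 + k%:Z - 1 /\ p.2 = c0.2 + k%:Z - 1).
  by case/negP: eS; apply: full; clear -pc e1 e2; lia.
rewrite /on_diag; clear -qc pc q1 q2; lia.
Qed.

(** The images under the symmetries of the square lattice that preserve the direction (1, 1) up to
    sign: all diagonals considered keep that direction. *)
Definition flips (S : {fset Z2}) : seq {fset Z2} :=
  [:: S; fimage neg S; fimage swap S; fimage swap (fimage neg S)].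

Lemma swap_negC (S : {fset Z2}) : fimage swap (fimage neg S) = fimage neg (fimage swap S).
Proof.
apply/fsetP => c; rewrite !mem_fimage //; first [exact: negK | exact: swapK | by []].
Qed.

Lemma flips_sub S T U : T \in flips S -> U \in flips T -> U \in flips S.
Proof.
have negI := fimageK negK; have swapI := fimageK swapK.
rewrite !inE => /or4P[] /eqP -> /or4P[] /eqP ->;
  by rewrite -?swap_negC ?swapI ?negI ?eqxx ?orbT // swap_negC ?swapI ?negI ?eqxx ?orbT.
Qed.

Lemma comb_board_flips S T : comb_board S -> T \in flips S -> comb_board T.
Proof.
move=> cb; rewrite !inE => /or4P[] /eqP -> //; first exact: comb_board_neg.
  exact: comb_board_swap.
by apply: comb_board_swap; apply: comb_board_neg.
Qed.

(** A diagonal starting at a lower left or an upper right corner inside the part is parallel to the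
    chord and hence stays in the part, so [smaller_cut] applies. An upper right corner is treated as
    a lower left one of [fimage neg S]. *)
Lemma staircase_or_smaller (S : {fset Z2}) (c0 : Z2) (k : nat) h :
  comb_board S -> is_chord S c0 k -> is_cut S (on_diag c0 k) true h -> h c0 = false ->
  is_staircase S c0 k h \/
  exists T c0' k' h', [/\ T \in flips S, is_chord T c0' k',
    is_cut T (on_diag c0' k') true h', h' c0' = false &
    (#|` cut_part T h'| < #|` cut_part S h|)%N].
Proof.
move=> cb C hcut h0; have cbn := comb_board_neg cb.
have [SW|noSW] := pselect (exists c : Z2, [/\ c \in S, h c & forall d : Z2, d \in S ->
    c.1 - 1 <= d.1 <= c.1 -> c.2 - 1 <= d.2 <= c.2 -> d = c]).
  right; have [c [cS hc corner]] := SW.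
  have [k' [h1 [h2 [C' [H1 h10] [H2 h20] H2']]]] := corner_cuts cb cS corner.
  have BE d : on_diag c k' d -> [/\ d \in S, h d, h1 d = false & h2 d = false].
    move=> dk; split; first exact: (chord_mem C').
    - have [n En] : exists n : nat, d.1 - c.1 = n%:Z.
        by apply: int_nat; move: dk; rewrite /on_diag; lia.
      elim: n d dk En => [|n IH] d dk En.
        by rewrite (_ : d = c) //; apply: pointP; move: dk; rewrite /on_diag; lia.
      have [p [p1 p2]] := point_ex (d.1 - 1) (d.2 - 1).
      have pk : on_diag c k'.-1 p by move: dk; rewrite /on_diag; lia.
      rewrite (_ : d = (p.1 + 1, p.2 + 1)); last by apply: pointP => /=; lia.
      rewrite -(parallel_same_side C hcut h0); last by move=> e; apply: (chord_block C').
      by apply: IH; [move: pk; rewrite /on_diag; lia | lia].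
    - exact: cut_on_diag C' H1 h10 dk.
    - rewrite -(swapK d); apply: (cut_on_diag (chord_swap C') H2').
        by rewrite swapK.
      by move: dk; rewrite /on_diag /swap /=; lia.
  have Badj (d e : Z2) : on_diag c k' d -> on_diag c k' e ->
      right_of d e \/ above d e -> False by rewrite /on_diag; lia.
  have cc : on_diag c k' c by rewrite /on_diag; have := chord_gt0 C'; lia.
  case: (smaller_cut cb C hcut h0 H1 H2 BE Badj cc) => lt.
    by exists S, c, k', h1; rewrite mem_head.
  exists (fimage swap S), (swap c), k', (fun d => h2 (swap d)); split=> //.
  - by rewrite !inE eqxx !orbT.
  - exact: chord_swap.
  - by rewrite swapK.
  - rewrite cut_part_fimage; last exact: swapK.
    by under eq_fun do rewrite swapK.
have [NE|noNE] := pselect (exists c : Z2, [/\ c \in S, h c & forall d : Z2, d \in S ->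
    c.1 <= d.1 <= c.1 + 1 -> c.2 <= d.2 <= c.2 + 1 -> d = c]); last first.
  by left; apply: chord_staircase => // c cS hc corner; [apply: noSW | apply: noNE]; exists c.
right; have [c [cS hc corner]] := NE.
have mS d : (d \in fimage neg S) = (neg d \in S) by rewrite mem_fimage //; exact: negK.
have cS' : neg c \in fimage neg S by rewrite mS negK.
have corner' (d : Z2) : d \in fimage neg S -> (neg c).1 - 1 <= d.1 <= (neg c).1 ->
    (neg c).2 - 1 <= d.2 <= (neg c).2 -> d = neg c.
  rewrite mS /= => dS d1 d2; rewrite -(negK d); congr neg.
  by apply: corner => //=; clear -d1 d2; lia.
have [k' [h1 [h2 [C' [H1 h10] [H2 h20] H2']]]] := corner_cuts cbn cS' corner'.
pose B d := on_diag (neg c) k' (neg d).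
have BE d : B d -> [/\ d \in S, h d, h1 (neg d) = false & h2 (neg d) = false].
  move=> dk; split.
  - by have := chord_mem C' dk; rewrite mS negK.
  - have [n En] : exists n : nat, c.1 - d.1 = n%:Z.
      by apply: int_nat; move: dk; rewrite /B /on_diag /neg /=; lia.
    elim: n d dk En => [|n IH] d dk En.
      by rewrite (_ : d = c) //; apply: pointP; move: dk; rewrite /B /on_diag /neg /=; lia.
    have [p [p1 p2]] := point_ex (d.1 + 1) (d.2 + 1).
    have pk : on_diag (neg c) k'.-1 (neg p) by move: dk; rewrite /B /on_diag /neg /=; lia.
    rewrite (parallel_same_side C hcut h0); last first.
      move=> e e1 e2; have := chord_block C' (d := neg e) pk; rewrite mS negK.
      by apply; rewrite /neg /=; clear -p1 p2 e1 e2; lia.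
    rewrite (_ : (_, _) = p); last by apply: pointP => /=; lia.
    by apply: IH; [move: pk; rewrite /B /on_diag /neg /=; lia | lia].
  - exact: cut_on_diag C' H1 h10 dk.
  - rewrite -(swapK (neg d)); apply: (cut_on_diag (chord_swap C') H2').
      by rewrite swapK.
    by move: dk; rewrite /B /on_diag /swap /neg /=; lia.
have Badj (d e : Z2) : B d -> B e -> right_of d e \/ above d e -> False.
  by rewrite /B /on_diag /neg /=; lia.
have cc : B c by rewrite /B /on_diag; have := chord_gt0 C'; lia.
(* The point reflection turns right and lower sides into left and upper ones, so the two kinds of
   cut are exchanged. *)
have neg_cut o g : is_cut (fimage neg S) (on_diag (neg c) k') o g ->
    is_cut S B (~~ o) (fun d => g (neg d)).
  move=> [gx gy]; split=> d e dS eS de.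
    by rewrite addbC gx ?mS ?negK //; [case: (o) | rewrite /neg /=; clear -de; lia].
  by rewrite addbC gy ?mS ?negK //; [case: (o) | rewrite /neg /=; clear -de; lia].
case: (smaller_cut cb C hcut h0 (neg_cut _ _ H2) (neg_cut _ _ H1) _ Badj cc) => [d /BE[] //|lt|lt].
- exists (fimage swap (fimage neg S)), (swap (neg c)), k', (fun d => h2 (swap d)); split=> //.
  + by rewrite !inE eqxx !orbT.
  + exact: chord_swap.
  + rewrite cut_part_fimage; last exact: swapK.
    by under eq_fun do rewrite swapK; rewrite cut_part_fimage //; exact: negK.
- exists (fimage neg S), (neg c), k', h1; split=> //; first by rewrite !inE eqxx !orbT.
  by rewrite cut_part_fimage //; exact: negK.
Qed.

Theorem staircase_exists (S : {fset Z2}) : comb_board S ->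
  exists2 T, T \in flips S & has_staircase T.
Proof.
move=> cb; have [c0 [k [h [C hcut h0]]]] : exists c0 k h,
    [/\ is_chord S c0 k, is_cut S (on_diag c0 k) true h & h c0 = false].
  have [S0 _ _] := cb; have [c cS cmin] := fset_min (fun c => c.1 + c.2) S0.
  have [|k [h [_ [C [H hc] _ _]]]] := @corner_cuts S c cb cS.
    by move=> d dS d1 d2; have := cmin d dS; move=> ?; apply: pointP; lia.
  by exists c, k, h.
have [n En] : exists n, (#|` cut_part S h| < n)%N by exists #|` cut_part S h|.+1.
elim: n S cb c0 k h C hcut h0 En => // n IH S cb c0 k h C hcut h0 En.
have [st|[T [c0' [k' [h' [TS C' H' h0' lt]]]]]] := staircase_or_smaller cb C hcut h0.
  by exists S; [rewrite mem_head | exists c0, k, h].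
have [U UT stU] := IH T (comb_board_flips cb TS) c0' k' h' C' H' h0' (leq_trans lt En).
by exists U => //; apply: flips_sub UT.
Qed.

(** * Removing a strip along a staircase *)

Lemma board_like_trim (S K : {fset Z2}) : board_like S -> (K `<=` S)%fset ->
  (forall c d : Z2, c \in K -> d \in S -> above d c -> d \in K) ->
  board_like (S `\` K)%fset.
Proof.
move=> bS; have [n En] : exists n, #|` K| = n by eexists.
elim: n K En => [|n IH] K En KS down.
  by move/cardfs0_eq: En => ->; rewrite fsetD0.
(* Squares are removed from bottom to top, so that nothing is left below a square when it goes; the
   topmost one is the last. *)
have [|c cK cmax] := fset_min (fun c => - c.2) (S := K).
  by rewrite -cardfs_gt0 En.
have K'S : (K `\ c `<=` S)%fset by apply: fsubset_trans KS; exact: fsubD1set.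
have cS : c \in S by exact: (fsubsetP KS).
have -> : (S `\` K = (S `\` (K `\ c)) `\ c)%fset.
  by apply/fsetP => d; rewrite !inE; have [->|] := eqVneq d c; rewrite ?cK //= negb_and.
apply: board_like_remove.
- apply: IH => //; first by move: En; rewrite (cardfsD1 c K) cK => -[].
  move=> a d; rewrite !inE => /andP[ac aK] dS da; rewrite (down a d aK dS da) andbT.
  by apply/eqP => dc; subst d; have := cmax a aK; clear -da; lia.
- by rewrite !inE eqxx cS.
- move=> d dc; rewrite !inE negb_and negbK; apply/orP.
  have [dS|] := boolP (d \in S); last by right.
  left; rewrite (down c d cK dS dc) andbT.
  by apply/eqP => E; subst d; clear -dc; lia.
Qed.

Section Staircase.
Context (S : {fset Z2}) (c0 : Z2) (k : nat) (h : Z2 -> bool).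
Context (cb : comb_board S) (st : is_staircase S c0 k h).

Let C := stair_chord st.
Let hx := proj1 (stair_cut st).
Let hy := proj2 (stair_cut st).

Lemma stair_gt0 : (0 < k)%N. Proof. exact: chord_gt0 C. Qed.

Lemma stair_diag (c : Z2) : on_diag c0 k c -> h c = false.
Proof. exact: cut_on_diag C (stair_cut st) (stair_base st). Qed.

Lemma stair_mem (c : Z2) : on_diag c0 k c -> c \in S.
Proof. exact: (chord_mem C). Qed.

Lemma stair_last (c : Z2) : c \in S -> h c ->
  ~ (c.1 = c0.1 + k%:Z /\ c.2 = c0.2 + k%:Z - 2).
Proof.
move=> cS hc [c1 c2]; have [d [d1 d2]] := point_ex c.1 (c.2 + 1).
have [dS _] := stair_above st cS hc (conj d1 d2).
by have := stair_end st (d := d) ltac:(lia) ltac:(lia); rewrite dS.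
Qed.

(** The last alternative concerns the squares in the angles of the zig-zag below the diagonal:
    between two consecutive diagonal squares, they jump over the diagonal. *)
Lemma stair_shift (c d : Z2) : c \in S -> h c -> d.1 = c.1 - 1 -> d.2 = c.2 + 1 ->
  d \in S /\ [|| h d, on_diag c0 k d |
    on_diag c0 k (c.1 - 1, c.2) && on_diag c0 k (c.1, c.2 + 1)].
Proof.
move=> cS hc d1 d2; have [e [e1 e2]] := point_ex c.1 (c.2 + 1).
have [eS he] := stair_above st cS hc (conj e1 e2).
have [he'|he'] := boolP (h e).
  have [dS hd] := stair_left st eS he' (d := d) ltac:(lia).
  by split=> //; rewrite orbA hd.
have ek : on_diag c0 k e by move: he; rewrite (negPf he').
have eE : (c.1, c.2 + 1) = e by apply: pointP.
have [p [p1 p2]] := point_ex (c.1 - 1) c.2.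
have pE : (c.1 - 1, c.2) = p by apply: pointP.
rewrite pE eE ek andbT.
have e0 : e.1 - c0.1 <> 0.
  move=> e0; have /(congr1 snd) := chord_corner C cS ltac:(lia)
    ltac:(move: ek; rewrite /on_diag; clear -e0 e1 e2; lia).
  by move: ek; rewrite /on_diag; clear -e0 e1 e2; lia.
have pk : on_diag c0 k.-1 p by move: ek; rewrite /on_diag; clear -e0 e1 e2 p1 p2; lia.
split; first by apply: (chord_block C pk); clear -d1 d2 p1 p2; lia.
by rewrite [on_diag c0 k p](_ : _ = true) ?orbT //; move: pk; rewrite /on_diag; clear; lia.
Qed.

(** The last square listed is the upper neighbour of the end of the diagonal, excised in the
    balanced case. The other upper neighbours of diagonal squares are not listed because each is
    covered by a moved square. *)
Definition near_rim (c : Z2) : bool :=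
  [|| h c, on_diag c0 k c | c == (c0.1 + k%:Z - 1, c0.2 + k%:Z)].

Definition is_kept (c : Z2) : bool :=
  near_rim c ==> ((c.1 + 1, c.2 - 1) \in cut_part S h).

(* The squares covered once the right part is moved by (-1, 1) onto the diagonal
   and the squares excised along it. *)
Definition trim : {fset Z2} := [fset c in S | is_kept c]%fset.

Lemma mem_trim (c : Z2) : (c \in trim) = (c \in S) && is_kept c.
Proof. by rewrite /trim !inE. Qed.

(** The squares lost are those near the rim onto which no square is moved. Within a column of
    neighbouring squares they are closed downwards, by [stair_above] and the cut, so they can be
    removed from the bottom. *)
Lemma board_like_trim_stair : board_like trim.
Proof.
pose K := [fset c in S | ~~ is_kept c]%fset.
have -> : trim = (S `\` K)%fset.
  by apply/fsetP => c; rewrite mem_trim !inE; case: (c \in S); rewrite /= ?andbF // negbK andbT.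
have bS : board_like S by case: cb.
apply: board_like_trim => //; first by apply/fsubsetP => c; rewrite !inE => /andP[].
move=> c d; rewrite !inE /is_kept !negb_imply => /and3P[cS cP cR] dS dc; rewrite dS /=.
have {}cS : c \in S := cS.
have [e [e1 e2]] := point_ex (d.1 + 1) (d.2 - 1).
have [f [f1 f2]] := point_ex (c.1 + 1) (c.2 - 1).
rewrite (_ : (d.1 + 1, d.2 - 1) = e); last by apply: pointP.
rewrite (_ : (c.1 + 1, c.2 - 1) = f) in cR; last by apply: pointP.
rewrite !mem_cut_part in cR *; rewrite /near_rim in cP *.
have k0 := stair_gt0.
apply/andP; split.
  have [cE|cE] := eqVneq c (c0.1 + k%:Z - 1, c0.2 + k%:Z).
    apply/or3P; apply: Or32; by rewrite /on_diag; subst c; move: dc k0 => /=; clear; lia.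
  have := hy dS cS dc; have := stair_diag (c := c).
  by move: cP; rewrite (negPf cE) orbF; clear; lia.
apply/negP => /andP[eS he].
have [fS hf] := stair_above st eS he (d := f) ltac:(clear -dc e1 e2 f1 f2; lia).
have [hf'|hf'] := boolP (h f); first by rewrite fS hf' in cR.
have fk : on_diag c0 k f by move: hf; rewrite (negPf hf').
have cb1 : c.1 - c0.1 = c.2 - c0.2 - 2 by move: fk; rewrite /on_diag; clear -f1 f2; lia.
have hc : h c.
  have : c != (c0.1 + k%:Z - 1, c0.2 + k%:Z) by apply/eqP => E; move: cb1; rewrite E /=; clear; lia.
  have : ~~ on_diag c0 k c by rewrite /on_diag; clear -cb1; lia.
  by move: cP; clear; case: (h c) => //=; lia.
have dk : ~~ on_diag c0 k d by rewrite /on_diag; clear -cb1 dc; lia.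
have := hy dS cS dc; have := hx dS fS ltac:(clear -dc f1 f2; lia).
have : ~~ on_diag c0 k c by rewrite /on_diag; clear -cb1; lia.
by move: hc hf' dk; clear; lia.
Qed.

(** The cut of a chord with one square crosses no side of the board: [stair_end] leaves nothing to
    the right of [c0], and the corner nothing below. This matches the absence of identifications for
    diagonals of length 1. *)
Lemma stair_part_nil : k = 1%N -> forall c : Z2, c \in S -> h c = false.
Proof.
move=> k1 c cS; have [_ conn _] := cb.
have c0k : on_diag c0 k c0 by rewrite /on_diag; have := stair_gt0; lia.
rewrite (conn h _ c c0 cS (stair_mem c0k)); first exact: stair_diag.
have diagE (d : Z2) : on_diag c0 k d -> d.1 = c0.1 /\ d.2 = c0.2.
  by rewrite /on_diag; lia.
split=> d e dS eS de.
  have := hx dS eS de; have := stair_end st (d := e); rewrite eS.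
  by have := diagE d; clear -de k1; lia.
have := hy dS eS de; have := chord_corner C dS; have := diagE e.
move=> dE corner; have : ~~ on_diag c0 k e; last by clear; lia.
by apply/negP => /dE ?; have /(congr1 snd) := corner ltac:(lia) ltac:(lia); lia.
Qed.

End Staircase.

(** * Removable squares *)

Definition is_free_corner (S : {fset Z2}) (c : Z2) : Prop :=
  (forall d : Z2, d \in S -> c.1 - 1 <= d.1 <= c.1 -> c.2 - 1 <= d.2 <= c.2 -> d = c) /\
  (forall d : Z2, c.1 <= d.1 <= c.1 + 1 -> c.2 <= d.2 <= c.2 + 1 -> d \in S).

Definition is_leaf (S : {fset Z2}) (c : Z2) : Prop :=
  (forall d : Z2, d \in S -> c.1 - 1 <= d.1 <= c.1 + 1 -> c.2 - 1 <= d.2 <= c.2 -> d = c) /\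
  (forall d : Z2, above c d -> d \in S).

(** The removable square is the first one of a staircase diagonal. If the diagonal has more squares,
    the block ahead is full; if not, nothing lies on the right, a square at the lower right would be
    a pinch, and connectedness gives the upper neighbour. *)
Lemma free_square (S : {fset Z2}) : comb_board S -> (1 < #|` S|)%N ->
  exists T c, [/\ T \in flips S, comb_board T, c \in T, comb_board (T `\ c)%fset &
    is_free_corner T c \/ is_leaf T c].
Proof.
move=> cbS S2; have [T TS [c0 [k [h st]]]] := staircase_exists cbS.
have cbT := comb_board_flips cbS TS; exists T, c0.
have C := stair_chord st; have k0 := chord_gt0 C.
have c0T : c0 \in T by apply: (stair_mem st); rewrite /on_diag; lia.
have corner := chord_corner C; have [_ conn bdT] := cbT.
have T2 : (1 < #|` T|)%N.
  suff -> : #|` T| = #|` S| by [].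
  have card phi U : involutive phi -> #|` fimage phi U| = #|` U|.
    by move=> phiK; rewrite card_imfset //; exact: inv_inj.
  by move: TS; rewrite !inE => /or4P[] /eqP ->; rewrite ?card //; first [exact: negK | exact: swapK].
have T0 : (T `\ c0)%fset != fset0.
  by rewrite -cardfs_gt0; move: T2; rewrite (cardfsD1 c0) c0T.
have bdT' : board_like (T `\ c0)%fset.
  apply: board_like_remove => // d dc; apply/negP => dT.
  by have /(congr1 snd) := corner d dT ltac:(lia) ltac:(lia); lia.
(* Connectedness survives if constant functions on the rest extend to [c0] by their value at a
   neighbour [e]. *)
have extend (e : Z2) : (forall g, side_const (T `\ c0)%fset g ->
      side_const T (fun c => if c == c0 then g e else g c)) ->
    comb_board (T `\ c0)%fset.
  move=> H; split=> // g gc c d; rewrite !inE => /andP[/negPf cc cT] /andP[/negPf dc dT].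
  by have := conn _ (H g gc) c d cT dT; rewrite cc dc.
have ne1 (c : Z2) : c.1 <> c0.1 \/ c.2 <> c0.2 -> (c == c0) = false.
  by move=> cc; apply/negP => /eqP E; subst c; lia.
have nbr (c d : Z2) : c \in T -> d \in T -> right_of c d \/ above c d -> (d == c0) = false.
  move=> cT dT cd; apply/negP => /eqP E; subst d.
  have E := corner c cT ltac:(lia) ltac:(lia).
  by move: cd; rewrite E; clear; lia.
have [k1|k1] := eqVneq k 1%N.
  have right_absent (d : Z2) : d \in T -> ~ right_of c0 d.
    by move=> dT d0; have := stair_end st (d := d); rewrite dT; clear -d0 k1; lia.
  have leafE (d : Z2) : d \in T -> c0.1 - 1 <= d.1 <= c0.1 + 1 -> c0.2 - 1 <= d.2 <= c0.2 -> d = c0.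
    move=> dT d1 d2; have [dr|dr] := pselect (d.1 = c0.1 + 1); last by apply: corner => //; lia.
    have d2' : d.2 <> c0.2 by move=> d2'; apply: (right_absent d).
    case: (@no_pinch T c0 d cbT); split => //; [lia|lia|move=> e eT; split=> ee].
      by have /(congr1 snd) := corner e eT ltac:(lia) ltac:(lia); clear -ee d2'; lia.
    by apply: (right_absent e) => //; clear -ee dr; lia.
  have [n [n1 n2]] := point_ex c0.1 (c0.2 + 1).
  have nT : n \in T.
    apply/negPn/negP => nT; have [c] := fset0Pn _ T0; rewrite !inE => /andP[/negPf cc cT].
    have := conn (fun c => c == c0) _ c c0 cT c0T; rewrite cc eqxx => /(_ _) E.
    have // : false = true; apply: E; split=> a b aT bT ab.
      rewrite (nbr a b) //; last by left.
      by apply/negP => /eqP E; subst a; apply: (right_absent b).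
    rewrite (nbr a b) //; last by right.
    apply/negP => /eqP E; subst a; case/negP: nT; rewrite (_ : n = b) //.
    by apply: pointP; lia.
  split=> //; last first.
    by right; split=> // d d0; rewrite (_ : d = n) //; apply: pointP; lia.
  apply: (extend n) => g [gx gy]; split=> a b aT bT ab.
    rewrite (nbr a b) //; last by left.
    case: eqVneq => [E|ac]; first by subst a; case: (right_absent b).
    by apply: gx; rewrite ?inE ?ac ?aT // (nbr a b) //; left.
  rewrite (nbr a b) //; last by right.
  case: eqVneq => [E|ac]; first by subst a; congr g; apply: pointP; lia.
  by apply: gy; rewrite ?inE ?ac ?aT // (nbr a b) //; right.
have full (d : Z2) : c0.1 <= d.1 <= c0.1 + 1 -> c0.2 <= d.2 <= c0.2 + 1 -> d \in T.
  by apply: (chord_block C); rewrite /on_diag; move: k1 k0; clear; lia.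
split=> //; last by left.
have [e [e1 e2]] := point_ex (c0.1 + 1) c0.2.
have [n [n1 n2]] := point_ex c0.1 (c0.2 + 1).
have [m [m1 m2]] := point_ex (c0.1 + 1) (c0.2 + 1).
apply: (extend e) => g [gx gy].
have mem (d : Z2) : d.1 <> c0.1 \/ d.2 <> c0.2 -> c0.1 <= d.1 <= c0.1 + 1 ->
    c0.2 <= d.2 <= c0.2 + 1 -> d \in (T `\ c0)%fset.
  by move=> dc d1 d2; rewrite !inE ne1 // full.
have gen : g e = g n.
  rewrite (gy e m) ?mem //; try (clear -e1 e2 m1 m2; lia).
  by rewrite (gx n m) ?mem //; clear -n1 n2 m1 m2; lia.
split=> a b aT bT ab.
  rewrite (nbr a b) //; last by left.
  case: eqVneq => [E|ac]; first by subst a; congr g; apply: pointP; lia.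
  by apply: gx; rewrite ?inE ?ac ?aT // (nbr a b) //; left.
rewrite (nbr a b) //; last by right.
case: eqVneq => [E|ac]; first by subst a; rewrite gen; congr g; apply: pointP; lia.
by apply: gy; rewrite ?inE ?ac ?aT // (nbr a b) //; right.
Qed.

(** * Disks are acyclic *)

Definition close (R : realType) (e : R) (x y : R * R) : Prop :=
  `|x.1 - y.1| < e /\ `|x.2 - y.2| < e.

Definition cont_on (R : realType) (A : set (R * R)) (f : R * R -> R * R) : Prop :=
  forall x, A x -> forall e : R, 0 < e ->
    exists2 d : R, 0 < d & forall y, A y -> close d x y -> close e (f x) (f y).

Lemma close_ball (R : realType) (e : R) (x y : R * R) : ball x e y <-> close e x y.
Proof.
have E (a b : R) : ball a e b = (`|a - b| < e) :> Prop by rewrite -ball_normE.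
by rewrite /close -!E.
Qed.

Lemma cont_onP (R : realType) (A : set (R * R)) (f : R * R -> R * R) :
  {within A, continuous f} <-> cont_on A f.
Proof.
rewrite subspace_continuousP; split=> H x Ax.
  move=> e e0; have := H x Ax; move=> /cvg_ballP /(_ e e0).
  rewrite near_withinE near_simpl => /nbhs_ballP[d d0 Hd].
  exists d => // y Ay xy; apply/close_ball; apply: Hd => //; exact/close_ball.
apply/cvg_ballP => e e0; have [d d0 Hd] := H x Ax e e0.
rewrite near_withinE near_simpl; apply/nbhs_ballP; exists d => // y /close_ball xy Ay.
by apply/close_ball; apply: Hd.
Qed.

Lemma close_sym (R : realType) (e : R) (x y : R * R) : close e x y -> close e y x.
Proof. by case=> ? ?; split; rewrite distrC. Qed.

Lemma close_le (R : realType) (d e : R) (x y : R * R) : d <= e -> close d x y -> close e x y.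
Proof. by move=> de [? ?]; split; apply: lt_le_trans de. Qed.

Lemma close_trans (R : realType) (d e : R) (x y z : R * R) :
  close d x y -> close e y z -> close (d + e) x z.
Proof.
move=> [x1 x2] [y1 y2]; split.
  by apply: le_lt_trans (ler_distD y.1 _ _) _; exact: ltrD.
by apply: le_lt_trans (ler_distD y.2 _ _) _; exact: ltrD.
Qed.

Lemma close_refl (R : realType) (e : R) (x : R * R) : 0 < e -> close e x x.
Proof. by move=> e0; split; rewrite subrr normr0. Qed.

Definition homeo (R : realType) (A B : set (R * R)) : Prop :=
  exists f g : R * R -> R * R,
    [/\ cont_on A f, cont_on B g,
        (forall x, A x -> B (f x) /\ g (f x) = x) &
        (forall y, B y -> A (g y) /\ f (g y) = y)].

Lemma homeo_sym (R : realType) (A B : set (R * R)) : homeo A B -> homeo B A.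
Proof. by move=> [f [g [cf cg fg gf]]]; exists g, f. Qed.

Lemma homeo_trans (R : realType) (A B C : set (R * R)) :
  homeo A B -> homeo B C -> homeo A C.
Proof.
move=> [f [g [cf cg fg gf]]] [f' [g' [cf' cg' fg' gf']]].
exists (f' \o f), (g \o g'); split.
- move=> x Ax e e0; have [Bx _] := fg x Ax.
  have [d d0 Hd] := cf' _ Bx e e0; have [c c0 Hc] := cf x Ax d d0.
  by exists c => // y Ay xy; apply: Hd; [case: (fg y Ay) | apply: Hc].
- move=> x Cx e e0; have [Bx _] := gf' x Cx.
  have [d d0 Hd] := cg _ Bx e e0; have [c c0 Hc] := cg' x Cx d d0.
  by exists c => // y Ay xy; apply: Hd; [case: (gf' y Ay) | apply: Hc].
- by move=> x /fg[/fg'[? E] gfx] /=; rewrite E.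
- by move=> x /gf'[/gf[? E] gfx] /=; rewrite E.
Qed.

Lemma topological_diskE (R : realType) (A : set (R * R)) :
  topological_disk A <-> homeo [set x : R * R | x.1 ^+ 2 + x.2 ^+ 2 <= 1] A.
Proof.
split=> -[f [g [cf cg fg gf]]]; exists f, g; split=> //; exact/cont_onP.
Qed.

Lemma cont_on_unif (R : realType) (A : set (R * R)) (f : R * R -> R * R) :
  compact A -> cont_on A f -> forall e : R, 0 < e ->
  exists2 d : R, 0 < d & forall x y, A x -> A y -> close d x y -> close e (f x) (f y).
Proof.
move=> /compact_near_coveringP cA cf e e0.
pose P (d : R) (x : R * R) := A x -> forall y, A y -> close d x y -> close e (f x) (f y).
have /cA : forall x, A x -> \forall x' \near x & d \near (0 : R)^'+, P d x'.
  move=> x Ax; have e2 : 0 < e / 2 by rewrite divr_gt0.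
  have [d d0 Hd] := cf x Ax _ e2; have d2 : 0 < d / 2 by rewrite divr_gt0.
  exists (ball x (d / 2), [set c | c < d / 2]); first split.
  - exact: nbhsx_ballx.
  - exact: nbhs_right_lt.
  - move=> [x' c] /= [/close_ball xx' cd] Ax' y Ay x'y.
    rewrite [e]splitr; apply: (@close_trans _ _ _ _ (f x)).
      by apply: close_sym; apply: Hd => //; apply: close_le xx'; lra.
    apply: Hd => //; rewrite [d]splitr; apply: close_trans xx' _.
    by apply: close_le x'y; exact: ltW.
move=> H; have : \forall d \near (0:R)^'+, 0 < d /\ A `<=` P d.
  near=> d; split; first by near: d; exact: nbhs_right_gt.
  by near: d.
move=> /filter_ex[d [d0 Hd]]; exists d => // x y Ax Ay xy; exact: Hd.
Unshelve. all: by end_near.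
Qed.

Lemma disk_compact (R : realType) :
  compact [set x : R * R | x.1 ^+ 2 + x.2 ^+ 2 <= 1].
Proof.
apply: (@subclosed_compact (R * R)%type _
  ([set` `[-1 : R, 1]] `*` [set` `[-1 : R, 1]])).
- apply: (@closed_comp _ _ (fun x : R * R => x.1 ^+ 2 + x.2 ^+ 2) [set y | y <= 1]); last exact: closed_le.
  move=> x _; exact: (cvgD (cvgM cvg_fst cvg_fst) (cvgM cvg_snd cvg_snd)).
- by apply: compact_setX; exact: segment_compact.
- move=> [x y] /= xy; split => /=; rewrite in_itv /=; apply/andP; split; nra.
Qed.

Lemma locally_const_itv (R : realType) (b : R -> bool) :
  (forall t : R, 0 <= t <= 1 -> exists2 d : R, 0 < d &
     forall s : R, 0 <= s <= 1 -> `|t - s| < d -> b s = b t) -> b 0 = b 1.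
Proof.
move=> H; pose phi t : R := if b t then 1 else 0.
have cphi : {within `[0, 1], continuous phi}.
  apply/subspace_continuousP => t; rewrite /= in_itv /= => t01.
  apply/cvg_ballP => e e0; have [d d0 Hd] := H t t01.
  rewrite near_withinE near_simpl; apply/nbhs_ballP; exists d => // s st.
  move=> s01; have {}s01 : 0 <= s <= 1 by move: s01; rewrite /= in_itv.
  change (ball (phi t) e (phi s)); suff -> : phi s = phi t by exact: ballxx.
  by rewrite /phi Hd //; move: st; rewrite -ball_normE.
apply/eqP/negPn/negP => b01.
have [||t _] := @IVT R phi 0 1 (1/2) _ cphi; first exact: ler01.
- by rewrite ge_min le_max /phi; case: (b 0) (b 1) b01 => [] [] // _; apply/andP; split; apply/orP; (try by left; lra); right; lra.
- by rewrite /phi; case: (b t); lra.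
Qed.

(** The closed squares [c] and [d] meet, possibly in a single vertex: these are the edges of the
    nerve of the cover by closed squares. *)
Definition near_sq (c d : Z2) : Prop :=
  (c.1 - 1 <= d.1 <= c.1 + 1) /\ (c.2 - 1 <= d.2 <= c.2 + 1).

Definition in_sq (R : realType) (c : Z2) (p : R * R) : Prop :=
  c.1%:~R <= p.1 <= c.1%:~R + 1 /\ c.2%:~R <= p.2 <= c.2%:~R + 1.

Definition center (R : realType) (c : Z2) : R * R := (c.1%:~R + 1 / 2, c.2%:~R + 1 / 2).

Lemma in_sq_center (R : realType) (c : Z2) : in_sq c (center R c).
Proof. by split; rewrite /center /=; lra. Qed.

Lemma int_le_near (R : realType) (x y : int) (a b : R) :
  x%:~R <= a <= x%:~R + 1 -> y%:~R <= b <= y%:~R + 1 -> `|a - b| < 1 ->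
  x - 1 <= y <= x + 1.
Proof.
move=> xa yb ab; have : - 1 < a - b < 1 by rewrite -ltr_norml.
move=> {}ab; apply/andP; split; rewrite -ltzD1 -(ltr_int R) !intrD ?intrN ?mulr1z; lra.
Qed.

Lemma close_near (R : realType) (c d : Z2) (p q : R * R) :
  in_sq c p -> in_sq d q -> close 1 p q -> near_sq c d.
Proof.
by case=> c1 c2 [d1 d2] [pq1 pq2]; split; [apply: int_le_near c1 d1 pq1 | apply: int_le_near c2 d2 pq2].
Qed.

Lemma near_common (R : realType) (c d : Z2) : near_sq c d ->
  exists p : R * R, in_sq c p /\ in_sq d p.
Proof.
move=> [cd1 cd2]; exists ((Num.max c.1 d.1)%:~R, (Num.max c.2 d.2)%:~R).
have aux (x y : int) : x - 1 <= y <= x + 1 ->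
    (x%:~R <= (Num.max x y)%:~R :> R) && ((Num.max x y)%:~R <= x%:~R + 1 :> R) &&
    (y%:~R <= (Num.max x y)%:~R :> R) && ((Num.max x y)%:~R <= y%:~R + 1 :> R).
  by move=> xy; rewrite -[1](mulr1z 1) -!intrD !ler_int; lia.
by have := aux _ _ cd1; have := aux _ _ cd2; rewrite /in_sq /= => /andP[/andP[/andP[-> ->] ->] ->]
  /andP[/andP[/andP[-> ->] ->] ->].
Qed.

Lemma in_sq_segment (R : realType) (c : Z2) (p q : R * R) (t : R) :
  in_sq c p -> in_sq c q -> 0 <= t <= 1 ->
  in_sq c (p.1 + t * (q.1 - p.1), p.2 + t * (q.2 - p.2)).
Proof. by move=> [p1 p2] [q1 q2] t01; split => /=; nra. Qed.

Section Nerve.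
Context (R : realType) (S : {fset Z2}).
Context (disk : topological_disk (region R S)).

(* psi is integrated along the radii of the disk. *)
Lemma near_cochain (psi : Z2 -> Z2 -> bool) :
  (forall a b c : Z2, a \in S -> b \in S -> c \in S ->
     near_sq a b -> near_sq b c -> near_sq a c -> psi a b (+) psi b c = psi a c) ->
  exists h : Z2 -> bool, forall c d : Z2, c \in S -> d \in S -> near_sq c d ->
    psi c d = h c (+) h d.
Proof.
move=> cocyc; move/topological_diskE: disk => [f [g [cf cg fg gf]]].
set D := [set x : R * R | _] in cf fg gf.
have psi0 a : a \in S -> psi a a = false.
  have aa : near_sq a a by rewrite /near_sq; lia.
  by move=> aS; have := cocyc a a a aS aS aS aa aa aa; case: (psi a a).
(* [sq p] is an arbitrarily chosen square of [S] containing [p]; (0, 0) is a default off the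
   region. *)
have sqP p : exists c : Z2, region R S p -> c \in S /\ in_sq c p.
  have [[c cS cp]|np] := pselect (region R S p); first by exists c.
  by exists (0, 0).
pose sq p := projT1 (cid (sqP p)).
have sqE p : region R S p -> sq p \in S /\ in_sq (sq p) p := projT2 (cid (sqP p)).
have [e e0 fe] := cont_on_unif (@disk_compact R) cf (@ltr01 R).
have phiE x y : D x -> D y -> close e x y -> near_sq (sq (f x)) (sq (f y)).
  move=> Dx Dy xy; have [fx _] := fg x Dx; have [fy _] := fg y Dy.
  by apply: close_near (proj2 (sqE _ fx)) (proj2 (sqE _ fy)) _; exact: fe.
pose phi x y := psi (sq (f x)) (sq (f y)).
(* Each radius is cut into [N] steps shorter than [e / 2], so that a step combined with a
   displacement below [e / 2] is still below [e]. *)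
have [N N0 eN] : exists2 N : nat, (0 < N)%N & 2 / N%:R < e.
  exists (Num.truncn (2 / e)).+1 => //.
  rewrite ltr_pdivrMr ?ltr0n // mulrC -ltr_pdivrMr //.
  by rewrite truncnS_gt.
have N0' : 0 < N%:R :> R by rewrite ltr0n.
pose sc (j : nat) (x : R * R) : R * R := (j%:R / N%:R * x.1, j%:R / N%:R * x.2).
have Dsc j x : (j <= N)%N -> D x -> D (sc j x).
  move=> jN; rewrite /D /sc /= => xD.
  have j01 : 0 <= (j%:R / N%:R : R) <= 1.
    by rewrite divr_ge0 //= ler_pdivrMr // mul1r ler_nat.
  by move: (_ / _) j01 => r r01; nra.
have Dbound x : D x -> `|x.1| <= 1 /\ `|x.2| <= 1.
  by rewrite /D /= => xD; rewrite !ler_norml; split; nra.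
have scN x : sc N x = x.
  by case: x => a b; rewrite /sc /= divff ?gt_eqF // !mul1r.
have sc0 x : sc 0%N x = (0, 0) by rewrite /sc !mul0r.
have sc_close j x y : (j < N)%N -> D x -> D y -> close (e / 2) x y ->
    close e (sc j x) (sc j.+1 y) /\ close e (sc j x) (sc j y).
  move=> jN Dx Dy xy; have [y1 y2] := Dbound y Dy.
  have j01 : 0 <= (j%:R / N%:R : R) <= 1.
    by rewrite divr_ge0 //= ler_pdivrMr // mul1r ler_nat ltnW.
  have S1 : j.+1%:R / N%:R = j%:R / N%:R + 1 / N%:R :> R.
    by rewrite -mulrDl -natr1.
  have N2 : 1 / N%:R < e / 2 by lra.
  have N3 : 0 < 1 / N%:R :> R by rewrite divr_gt0.
  rewrite /sc S1; move: (j%:R / _) (1 / _) j01 N2 N3 => r s r01 se s0.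
  have aux (u v : R) : `|u - v| < e / 2 -> `|v| <= 1 ->
      `|r * u - (r + s) * v| < e /\ `|r * u - r * v| < e.
    move=> uv v1; have ruv : `|r * u - r * v| < e / 2.
      rewrite -mulrBr normrM ger0_norm; last by case/andP: r01.
      by apply: le_lt_trans uv; rewrite ler_piMl //; case/andP: r01.
    split; last by lra.
    rewrite mulrDl opprD addrA; apply: le_lt_trans (ler_normB _ _) _.
    rewrite [e]splitr ltrD // normrM gtr0_norm //.
    by apply: le_lt_trans se; rewrite ler_piMr // ltW.
  case: xy => xy1 xy2; have [? ?] := aux _ _ xy1 y1; have [? ?] := aux _ _ xy2 y2.
  by split; split.
pose H x := \big[addb/false]_(j < N) phi (sc j x) (sc j.+1 x).
have phi_tri x y z : D x -> D y -> D z -> close e x y -> close e y z -> close e x z ->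
    phi x y (+) phi y z = phi x z.
  move=> Dx Dy Dz xy yz xz; have [fx _] := fg x Dx; have [fy _] := fg y Dy.
  have [fz _] := fg z Dz.
  apply: cocyc; try exact: phiE; by [case: (sqE _ fx)|case: (sqE _ fy)|case: (sqE _ fz)].
have e2 : e / 2 <= e by lra.
(* The strip between two nearby radii is filled with two triangles per step, on each of which [psi]
   is additive; at the centre the strip is degenerate. *)
have HE x y : D x -> D y -> close (e / 2) x y -> H x (+) H y = phi x y.
  move=> Dx Dy xy; rewrite /H.
  have Hn n : (n <= N)%N -> \big[addb/false]_(j < n) phi (sc j x) (sc j.+1 x) (+)
      \big[addb/false]_(j < n) phi (sc j y) (sc j.+1 y) = phi (sc n x) (sc n y).
    elim: n => [_|n IH nN].
      rewrite !big_ord0 !sc0 /phi psi0 //.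
      have D0 : D (0, 0) by rewrite /D /= !expr0n /= addr0.
      by case: (fg _ D0) => /sqE[].
    rewrite !big_ord_recr /= addbACA IH ?(ltnW nN) //.
    have xx : close (e / 2) x x by apply: close_refl; lra.
    have yy : close (e / 2) y y by apply: close_refl; lra.
    have nN' := ltnW nN.
    have [xy1 xy2] := sc_close n x y nN Dx Dy xy.
    have [xx1 _] := sc_close n x x nN Dx Dx xx.
    have [yy1 _] := sc_close n y y nN Dy Dy yy.
    have S2 : close e (sc n.+1 x) (sc n.+1 y).
      move: nN; rewrite leq_eqVlt => /orP[/eqP ->|nN2].
        by rewrite !scN; apply: close_le xy.
      by have [] := sc_close n.+1 x y nN2 Dx Dy xy.
    have t1 : phi (sc n x) (sc n y) (+) phi (sc n y) (sc n.+1 y) = phi (sc n x) (sc n.+1 y).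
      by apply: phi_tri => //; apply: Dsc.
    have t2 : phi (sc n x) (sc n.+1 x) (+) phi (sc n.+1 x) (sc n.+1 y) = phi (sc n x) (sc n.+1 y).
      by apply: phi_tri => //; apply: Dsc.
    by move: t2; rewrite -t1; do 4![case: (phi _ _)].
  by rewrite (Hn N) // !scN.
(* Moving [p] to the centre of [c] along a segment changes the corrected value nowhere, since it is
   locally constant. So the correction removes the dependence on [p] and on the choice of [sq p]. *)
have Hsq c p : c \in S -> in_sq c p ->
    H (g p) (+) psi (sq p) c = H (g (center R c)) (+) psi (sq (center R c)) c.
  move=> cS cp; pose gam t : R * R := ((center R c).1 + t * (p.1 - (center R c).1),
    (center R c).2 + t * (p.2 - (center R c).2)).
  have gamc t : 0 <= t <= 1 -> in_sq c (gam t).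
    by apply: in_sq_segment => //; exact: in_sq_center.
  have gamS t : 0 <= t <= 1 -> region R S (gam t) by move=> /gamc ?; exists c.
  have gam1 : gam 1 = p.
    by rewrite /gam !mul1r; case: (p) => a b /=; congr pair; ring.
  have gam0 : gam 0 = center R c by rewrite /gam !mul0r !addr0; case: (center R c).
  rewrite -gam0 -{1 2}gam1; apply/esym.
  apply: (@locally_const_itv R (fun t => H (g (gam t)) (+) psi (sq (gam t)) c)) => t t01.
  have [d d0 gd] := cg _ (gamS t t01) (e / 2) ltac:(lra).
  have cp1 : `|p.1 - (center R c).1| < 1.
    by rewrite ltr_norml; case: cp; rewrite /center /=; lra.
  have cp2 : `|p.2 - (center R c).2| < 1.
    by rewrite ltr_norml; case: cp; rewrite /center /=; lra.
  exists (Num.min d 1); first by rewrite lt_min d0 ltr01.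
  move=> s s01; rewrite lt_min => /andP[st st1].
  have gamE u : close u (gam t) (gam s) <-> `|t - s| * `|p.1 - (center R c).1| < u /\
      `|t - s| * `|p.2 - (center R c).2| < u.
    by rewrite /close /gam /= -!normrM; split=> -[h1 h2]; split;
      [move: h1|move: h2|move: h1|move: h2]; congr (is_true (`|_| < _)); ring.
  have aux (u v w : R) : 0 <= u < w -> 0 <= v < 1 -> u * v < w by nra.
  have gts : close d (gam t) (gam s) by apply/gamE; split; apply: aux; rewrite normr_ge0.
  have gts1 : close 1 (gam t) (gam s) by apply/gamE; split; apply: aux; rewrite normr_ge0.
  have [sqt int] := sqE _ (gamS t t01); have [sqs ins] := sqE _ (gamS s s01).
  have [Dt ft] := gf _ (gamS t t01); have [Ds fs] := gf _ (gamS s s01).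
  have := HE _ _ Dt Ds (gd _ (gamS s s01) gts); rewrite /phi ft fs => E.
  have self q r : in_sq q (gam r) -> in_sq c (gam r) -> near_sq q c.
    by move=> q1 q2; apply: close_near q1 q2 _; exact: close_refl.
  have := cocyc _ _ c sqt sqs cS (close_near int ins gts1)
    (self _ _ ins (gamc s s01)) (self _ _ int (gamc t t01)).
  by move: E => <-; do 2![case: (psi _ _)]; do 2![case: (H _)].
exists (fun c => H (g (center R c)) (+) psi (sq (center R c)) c) => c d cS dS cd.
have [p [cp dp]] := near_common R cd.
rewrite -(Hsq c p cS cp) -(Hsq d p dS dp).
have pS : region R S p by exists c.
have [spS sp] := sqE p pS.
have self q : in_sq q p -> near_sq (sq p) q.
  by move=> qp; apply: close_near sp qp _; exact: close_refl.
have := cocyc (sq p) c d spS cS dS (self c cp) cd (self d dp).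
by case: (H _); do 3![case: (psi _ _)].
Qed.
End Nerve.

(** * Side-connectedness of disks *)

Lemma int_itv (R : realType) (m n : int) : m%:~R <= (n%:~R : R) <= m%:~R + 1 ->
  n = m + 0 \/ n = m + 1.
Proof.
rewrite (_ : m%:~R + 1 = (m + 1)%:~R :> R); last by rewrite intrD mulr1z.
by rewrite !ler_int; lia.
Qed.

Lemma small_avoiding (R : realType) (s0 : R) (l : seq R) : 0 < s0 ->
  exists s, [/\ 0 < s, s <= s0 & forall z, z \in l -> 0 < z -> s < z].
Proof.
move=> s00; elim: l => [|a l [s [s1 s2 s3]]]; first by exists s0.
case: (lerP a 0) => a0.
  exists s; split=> // z; rewrite inE => /orP[/eqP -> |]; last exact: s3.
  by rewrite ltNge a0.
exists (Num.min s (a / 2)); split.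
- by rewrite lt_min s1 divr_gt0.
- by rewrite ge_min s2.
- move=> z; rewrite inE gt_min => /orP[/eqP -> _|/s3 H /H -> //].
  by apply/orP; right; lra.
Qed.

Lemma sq_far (R : realType) (c : Z2) (p : R * R) : ~ in_sq c p ->
  exists2 d : R, 0 < d & forall q, close d p q -> ~ in_sq c q.
Proof.
move=> np; have aux (x : int) (a : R) : ~ (x%:~R <= a <= x%:~R + 1) ->
    exists2 d : R, 0 < d & forall b, `|a - b| < d -> ~ (x%:~R <= b <= x%:~R + 1).
  move=> /negP; rewrite negb_and -!ltNge => /orP[ax|ax].
    by exists (x%:~R - a); [lra | move=> b; rewrite ltr_norml; lra].
  by exists (a - x%:~R - 1); [lra | move=> b; rewrite ltr_norml; lra].
case: (pselect (c.1%:~R <= p.1 <= c.1%:~R + 1)) => [h1|/aux[d d0 H]].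
  case: (pselect (c.2%:~R <= p.2 <= c.2%:~R + 1)) => [h2|/aux[d d0 H]].
    by case: np.
  by exists d => // q [_ /H] nq [].
by exists d => // q [/H] nq _ [].
Qed.

Lemma squares_far (R : realType) (S : {fset Z2}) (p : R * R) :
  exists2 d : R, 0 < d & forall c q, c \in S -> ~ in_sq c p -> close d p q -> ~ in_sq c q.
Proof.
suff [d d0 H] : exists2 d : R, 0 < d & forall c, c \in enum_fset S ->
    ~ in_sq c p -> forall q, close d p q -> ~ in_sq c q.
  by exists d => // c q cS np; apply: H.
elim: (enum_fset S) => [|a l [d d0 H]]; first by exists 1.
have [ap|/sq_far[e e0 He]] := pselect (in_sq a p).
  exists d => // c; rewrite inE => /orP[/eqP -> //|]; exact: H.
exists (Num.min d e); first by rewrite lt_min d0.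
move=> c; rewrite inE => /orP[/eqP ->|cl] np q pq.
  by apply: He; apply: close_le pq; rewrite ge_min lexx orbT.
by apply: (H c cl np); apply: close_le pq; rewrite ge_min lexx.
Qed.

Lemma sq_cap (R : realType) (c d : Z2) (p : R * R) : in_sq c p -> in_sq d p ->
  [\/ c.1 = d.1, c.2 = d.2 | exists q : Z2, [/\ p = lpoint R q,
     c.1 <= q.1 <= c.1 + 1 & c.2 <= q.2 <= c.2 + 1]].
Proof.
move=> cp dp; have [n1 n2] := close_near cp dp (close_refl p (@ltr01 R)).
case: (eqVneq c.1 d.1) => [->|e1]; first by constructor 1.
case: (eqVneq c.2 d.2) => [->|e2]; first by constructor 2.
constructor 3.
have aux (x y : int) (a : R) : x - 1 <= y <= x + 1 -> x != y ->
    x%:~R <= a <= x%:~R + 1 -> y%:~R <= a <= y%:~R + 1 ->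
    a = (Num.max x y)%:~R /\ x <= Num.max x y <= x + 1.
  move=> xy xny xa ya; have [E|E] : y = x + 1 \/ x = y + 1 by lia.
    have -> : Num.max x y = y by lia.
    by split; [move: ya; rewrite E intrD mulr1z; lra | lia].
  have -> : Num.max x y = x by lia.
  by split; [move: xa; rewrite E intrD mulr1z; lra | lia].
case: cp dp => c1 c2 [d1 d2].
have [E1 F1] := aux _ _ _ n1 e1 c1 d1; have [E2 F2] := aux _ _ _ n2 e2 c2 d2.
by exists (Num.max c.1 d.1, Num.max c.2 d.2); split=> //; case: p E1 E2 {c1 c2 d1 d2} => a b /= -> ->.
Qed.

(** By strict convexity, the chord has room [t * (1 - t) * L] inside the disk, of the same order at
    the ends as the deviation. The determinant is at most 2, so [s <= L / 8] and [s <= 1 / 2] bound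
    the cost by [L / 2] and [L / 4] times [t * (1 - t)]. *)
Lemma parabola_disk (R : realType) (x1 x2 y1 y2 s t : R) :
  x1 ^+ 2 + x2 ^+ 2 <= 1 -> y1 ^+ 2 + y2 ^+ 2 <= 1 -> 0 < s -> s <= 1 / 2 ->
  s <= ((y1 - x1) ^+ 2 + (y2 - x2) ^+ 2) / 8 -> 0 <= t <= 1 ->
  (x1 + t * (y1 - x1) - s * (t * (1 - t)) * (y2 - x2)) ^+ 2 +
  (x2 + t * (y2 - x2) + s * (t * (1 - t)) * (y1 - x1)) ^+ 2 <= 1.
Proof.
set L := (y1 - x1) ^+ 2 + (y2 - x2) ^+ 2 => Dx Dy s0 s1 s3 t01.
have -> : (x1 + t * (y1 - x1) - s * (t * (1 - t)) * (y2 - x2)) ^+ 2 +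
  (x2 + t * (y2 - x2) + s * (t * (1 - t)) * (y1 - x1)) ^+ 2 =
  (1 - t) * (x1 ^+ 2 + x2 ^+ 2) + t * (y1 ^+ 2 + y2 ^+ 2) +
  (t * (1 - t)) * (- L + 2 * (s * (x2 * y1 - x1 * y2)) + s ^+ 2 * (t * (1 - t)) * L).
  by rewrite /L; ring.
have det : x2 * y1 - x1 * y2 <= 2.
  by have := sqr_ge0 (x2 - y1); have := sqr_ge0 (x1 + y2); nra.
have L0 : 0 < L by lra.
clearbody L.
have tau : 0 <= t * (1 - t) <= 1 by nra.
have b1 : s * (x2 * y1 - x1 * y2) <= s * 2 by rewrite ler_wpM2l // ltW.
have b2 : s ^+ 2 * (t * (1 - t)) <= 1 / 4 * 1.
  by apply: ler_pM; rewrite ?sqr_ge0 //; [case/andP: tau | nra | case/andP: tau].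
have b3 : s ^+ 2 * (t * (1 - t)) * L <= 1 / 4 * 1 * L by rewrite ler_wpM2r //; exact: ltW.
have b4 : (t * (1 - t)) * (- L + 2 * (s * (x2 * y1 - x1 * y2)) + s ^+ 2 * (t * (1 - t)) * L) <= 0.
  by rewrite mulr_ge0_le0 //; [case/andP: tau | lra].
have b5 : (1 - t) * (x1 ^+ 2 + x2 ^+ 2) <= (1 - t) * 1 by rewrite ler_wpM2l //; lra.
have b6 : t * (y1 ^+ 2 + y2 ^+ 2) <= t * 1 by rewrite ler_wpM2l //; lra.
by lra.
Qed.

Section Disk.
Context (R : realType) (S : {fset Z2}).
Context (disk : topological_disk (region R S)).

(* Two points of the disk are joined by an arc of parabola avoiding the finitely
   many points corresponding to vertices of squares. *)
Lemma disk_side_connected : side_connected S.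
Proof.
move=> h [hx hy] c d cS dS; move/topological_diskE: disk => [f [g [cf cg fg gf]]].
set D := [set x : R * R | _] in cf fg gf.
have Sc (e : Z2) : e \in S -> region R S (center R e).
  by move=> eS; exists e => //; exact: in_sq_center.
have [Dx fx] := gf _ (Sc c cS); have [Dy fy] := gf _ (Sc d dS).
set x := g _ in Dx fx; set y := g (center R d) in Dy fy.
pose w : R * R := (y.1 - x.1, y.2 - x.2).
pose L := w.1 ^+ 2 + w.2 ^+ 2.
have sqP p : exists e : Z2, region R S p -> e \in S /\ in_sq e p.
  have [[e eS ep]|np] := pselect (region R S p); first by exists e.
  by exists (0, 0).
pose sq p := projT1 (cid (sqP p)).
have sqE p : region R S p -> sq p \in S /\ in_sq (sq p) p := projT2 (cid (sqP p)).
have same (e e' : Z2) p : e \in S -> e' \in S -> in_sq e p -> in_sq e' p ->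
    (forall q : Z2, region R S (lpoint R q) -> p <> lpoint R q) -> h e = h e'.
  move=> eS eS' ep ep' np; have [n1 n2] := close_near ep ep' (close_refl p (@ltr01 R)).
  have [E|E|[q [pq _ _]]] := sq_cap ep ep'.
  - have [E2|[E2|E2]] : e.2 = e'.2 \/ e'.2 = e.2 + 1 \/ e.2 = e'.2 + 1 by lia.
    + by congr h; apply: pointP.
    + by apply: hy.
    + by symmetry; apply: hy.
  - have [E2|[E2|E2]] : e.1 = e'.1 \/ e'.1 = e.1 + 1 \/ e.1 = e'.1 + 1 by lia.
    + by congr h; apply: pointP.
    + by apply: hx.
    + by symmetry; apply: hx.
  - by case: (np q) => //; rewrite -pq; exists e.
have center_lat (e q : Z2) : center R e <> lpoint R q.
  move=> [E _]; have /eqP : (2 * e.1 + 1)%:~R = (2 * q.1)%:~R :> R.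
    by rewrite intrD !intrM mulr1z -[1 in LHS]/(1 : R) -E; lra.
  by rewrite eqr_int; lia.
have [xy|xy] := eqVneq x y.
  have E : center R c = center R d by rewrite -fx -fy xy.
  apply: (same _ _ (center R c)) => //; first exact: in_sq_center.
    by rewrite E; exact: in_sq_center.
have L0 : 0 < L.
  rewrite /L lt0r addr_ge0 ?sqr_ge0 // andbT paddr_eq0 ?sqr_ge0 // !sqrf_eq0 /w /= !subr_eq0.
  apply: contra xy => /andP[/eqP e1 /eqP e2]; apply/eqP.
  by case: (x) (y) e1 e2 => a b [a' b'] /= -> ->.
pose V := [seq ((e.1 + i.1, e.2 + i.2) : Z2) | e <- enum_fset S, i <- [:: (0,0); (1,0); (0,1); (1,1)]].
(* [al] and [be] are coordinates along the chord and across it, so [bad z] is the parameter of the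
   parabola through [z]; [s] is taken below all its positive values at vertices. *)
pose al (z : R * R) := ((z.1 - x.1) * w.1 + (z.2 - x.2) * w.2) / L.
pose be (z : R * R) := (- (z.1 - x.1) * w.2 + (z.2 - x.2) * w.1) / L.
pose bad (z : R * R) := be z / (al z * (1 - al z)).
have [s [s0 s1 s2]] := @small_avoiding R (Num.min (1 / 2) (L / 8))
  [seq bad (g (lpoint R p)) | p <- V] ltac:(by rewrite lt_min; apply/andP; split; lra).
have {s1}[s1 s3] : s <= 1 / 2 /\ s <= L / 8 by move: s1; rewrite le_min => /andP.
pose gam (t : R) : R * R :=
  (x.1 + t * w.1 - s * (t * (1 - t)) * w.2, x.2 + t * w.2 + s * (t * (1 - t)) * w.1).
have Dgam t : 0 <= t <= 1 -> D (gam t).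
  by move=> t01; apply: (parabola_disk Dx Dy s0 s1 s3 t01).
have gam0 : gam 0 = x by rewrite /gam; case: (x) => a b /=; congr pair; ring.
have gam1 : gam 1 = y.
  by rewrite /gam /w; case: (x) (y) => a b [a' b'] /=; congr pair; ring.
have avoid t (q : Z2) : 0 <= t <= 1 -> region R S (lpoint R q) -> f (gam t) <> lpoint R q.
  move=> t01 qS E; have gE : gam t = g (lpoint R q).
    by rewrite -E; case: (fg _ (Dgam t t01)).
  (* The ends of the arc correspond to centres of squares, which are not lattice points; there [bad]
     would divide by zero. *)
  have [t0|t0] := eqVneq t 0.
    by apply: (@center_lat c q); rewrite -E t0 gam0 fx.
  have [t1|t1] := eqVneq t 1.
    by apply: (@center_lat d q); rewrite -E t1 gam1 fy.
  have alE : al (gam t) = t.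
    rewrite /al /gam /=; apply: (@mulIf _ L); first by rewrite gt_eqF.
    by rewrite divfK ?gt_eqF // /L /w /=; ring.
  have beE : be (gam t) = s * (t * (1 - t)).
    rewrite /be /gam /=; apply: (@mulIf _ L); first by rewrite gt_eqF.
    by rewrite divfK ?gt_eqF // /L /w /=; ring.
  have badE : bad (gam t) = s.
    rewrite /bad alE beE mulfK // mulf_neq0 // subr_eq0 eq_sym //.
  have qV : q \in V.
    have [e eS [e1 e2]] := qS; rewrite /lpoint /= in e1 e2.
    have mem (i : int * int) : i \in [:: (0,0); (1,0); (0,1); (1,1)] ->
        q = (e.1 + i.1, e.2 + i.2) -> q \in V.
      by move=> iI ->; apply/allpairsP; exists (e, i).
    by case: (int_itv e1) (int_itv e2) => q1 [] q2;
      [apply: (mem (0,0))|apply: (mem (0,1))|apply: (mem (1,0))|apply: (mem (1,1))] => //;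
      case: (q) q1 q2 => a b /= -> ->.
  have := s2 (bad (gam t)) _; rewrite badE ltxx => H.
  by have // : false by apply: H => //; rewrite -badE gE; apply: map_f.
have := @locally_const_itv R (fun t => h (sq (f (gam t)))) _.
rewrite gam0 gam1 fx fy => H.
have center_sq (e : Z2) : e \in S -> h (sq (center R e)) = h e.
  move=> eS; have [h1 h2] := sqE _ (Sc e eS).
  by apply: (same _ _ (center R e)) => //; exact: in_sq_center.
rewrite -(center_sq c) // -(center_sq d) //; apply: H => t t01.
have [ft _] := fg _ (Dgam t t01); have [e e0 He] := squares_far S (f (gam t)).
have [b b0 Hb] := cf _ (Dgam t t01) e e0.
have wb : `|w.1| <= 2 /\ `|w.2| <= 2.
  have Dbound (z : R * R) : D z -> -1 <= z.1 <= 1 /\ -1 <= z.2 <= 1.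
    by rewrite /D /= => zD; split; nra.
  have [? ?] := Dbound x Dx; have [? ?] := Dbound y Dy.
  by rewrite /w /= !ler_norml; split; lra.
(* The components of the chord are at most 2 and [s] is at most 1/2, so the arc moves by at most
   three times the change of the parameter. *)
exists (b / 4); first by lra.
move=> t' t'01 tt'; have [ft' _] := fg _ (Dgam t' t'01).
have [s1' i1] := sqE _ ft; have [s2' i2] := sqE _ ft'.
apply: (same _ _ (f (gam t))) => //; last by move=> q; exact: avoid.
apply: contrapT => ni; apply: (He _ (f (gam t')) s2' ni) => //.
apply: Hb; first exact: Dgam.
have tau : `|t * (1 - t) - t' * (1 - t')| <= `|t - t'|.
  rewrite (_ : _ - _ = (t - t') * (1 - t - t')); last by ring.
  by rewrite normrM ler_piMr // ler_norml; lra.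
have aux (u v : R) : `|u| <= 2 -> `|v| <= 2 ->
    `|(t - t') * u + s * (t * (1 - t) - t' * (1 - t')) * v| < b.
  move=> u2 v2; apply: le_lt_trans (ler_normD _ _) _; rewrite !normrM (gtr0_norm s0).
  have c1 : `|t - t'| * `|u| <= `|t - t'| * 2 by rewrite ler_wpM2l.
  have c2 : s * `|t * (1 - t) - t' * (1 - t')| <= 1 / 2 * `|t - t'|.
    by apply: ler_pM => //; exact: ltW.
  have c3 : s * `|t * (1 - t) - t' * (1 - t')| * `|v| <= (1 / 2 * `|t - t'|) * 2.
    by apply: ler_pM => //; rewrite mulr_ge0 // ltW.
  by lra.
case: wb; rewrite /w /= => w1 w2; split; rewrite /gam /w /=.
  rewrite (_ : _ - _ = (t - t') * (y.1 - x.1) +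
    s * (t * (1 - t) - t' * (1 - t')) * (- (y.2 - x.2))); last by ring.
  by apply: aux; rewrite ?normrN.
rewrite (_ : _ - _ = (t - t') * (y.2 - x.2) +
  s * (t * (1 - t) - t' * (1 - t')) * (y.1 - x.1)); last by ring.
exact: aux.
Qed.

(* A potential, on the 2 x 2 block of which e is the lower left square, of a
   cochain given by wx and wy on the sides and by pv on the pinches. *)
Definition block_potential (wx wy pv : Z2 -> bool) (e c : Z2) : bool :=
  let E : Z2 := (e.1 + 1, e.2) in let N : Z2 := (e.1, e.2 + 1) in
  match c.1 != e.1, c.2 != e.2 with
  | false, false => false
  | true, false => if e \in S then wx e else wy E
  | false, true => if e \in S then wy e else
      if (e.1 + 1, e.2 + 1) \in S then wx N else wy E (+) pv e
  | true, true => if e \in S then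
      (if N \in S then wy e (+) wx N else if E \in S then wx e (+) wy E else pv e)
      else false
  end.

(** Three squares that meet pairwise lie in one 2 x 2 block, so a cochain on meeting pairs that has
    a potential on every block satisfies the hypothesis of [near_cochain]. *)
Lemma disk_cochain (wx wy pv : Z2 -> bool) : cocycle S wx wy ->
  exists2 h, coboundary S h wx wy &
    forall c d : Z2, pinch S c d -> h c (+) h d = pv (Num.min c.1 d.1, Num.min c.2 d.2).
Proof.
move=> cocyc; pose lam := block_potential wx wy pv.
have lamE (e c : Z2) : lam e c = block_potential wx wy pv e c by [].
have lam_x (e c d : Z2) : c \in S -> d \in S -> right_of c d -> c.1 = e.1 ->
    e.2 <= c.2 <= e.2 + 1 -> lam e c (+) lam e d = wx c.
  move=> cS dS cd c1 c2; rewrite !lamE /block_potential.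
  have -> : (c.1 != e.1) = false by lia.
  have -> : (d.1 != e.1) = true by lia.
  have [e2|e2] : c.2 = e.2 \/ c.2 = e.2 + 1 by lia.
    have E : c = e by exact: pointP.
    have -> : (c.2 != e.2) = false by lia.
    have -> : (d.2 != e.2) = false by lia.
    by rewrite -E cS.
  have -> : (c.2 != e.2) = true by lia.
  have -> : (d.2 != e.2) = true by lia.
  have -> : (e.1, e.2 + 1) = c by apply: pointP => /=; lia.
  have -> : (e.1 + 1, e.2 + 1) = d by apply: pointP => /=; lia.
  by rewrite cS dS; case: (e \in S); rewrite ?addbF // addKb.
have lam_y (e c d : Z2) : c \in S -> d \in S -> above c d -> c.2 = e.2 ->
    e.1 <= c.1 <= e.1 + 1 -> lam e c (+) lam e d = wy c.
  move=> cS dS cd c1 c2; rewrite !lamE /block_potential.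
  have -> : (c.2 != e.2) = false by lia.
  have -> : (d.2 != e.2) = true by lia.
  have [e2|e2] : c.1 = e.1 \/ c.1 = e.1 + 1 by lia.
    have E : c = e by exact: pointP.
    have -> : (c.1 != e.1) = false by lia.
    have -> : (d.1 != e.1) = false by lia.
    by rewrite -E cS.
  have -> : (c.1 != e.1) = true by lia.
  have -> : (d.1 != e.1) = true by lia.
  have -> : (e.1 + 1, e.2) = c by apply: pointP => /=; lia.
  rewrite cS; have [eS|eS] := boolP (e \in S); last by rewrite addbF.
  have [NS|NS] := boolP (_ \in S); last by rewrite addKb.
  have := cocyc e c (e.1, e.2 + 1) d eS cS NS dS.
  move=> /= H; have {H} := H (conj e2 c1) (conj erefl erefl) ltac:(clear -cd c1 e2; lia).
  by case: (wx e) (wy c) (wx (e.1, _)) (wy e) => [] [] [] [].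
(* Any block containing both squares may be used instead: two blocks containing the same two
   distinct squares share a side crossing, whose value is given by [wx] or [wy]. *)
pose psi (c d : Z2) := let e := (Num.min c.1 d.1, Num.min c.2 d.2) in lam e c (+) lam e d.
have psiE (e c d : Z2) : c \in S -> d \in S ->
    e.1 <= c.1 <= e.1 + 1 -> e.2 <= c.2 <= e.2 + 1 ->
    e.1 <= d.1 <= e.1 + 1 -> e.2 <= d.2 <= e.2 + 1 -> psi c d = lam e c (+) lam e d.
  move=> cS dS c1 c2 d1 d2; rewrite /psi.
  have [m [m1 m2]] := point_ex (Num.min c.1 d.1) (Num.min c.2 d.2).
  have -> : (Num.min c.1 d.1, Num.min c.2 d.2) = m by apply: pointP => /=; lia.
  have [e1|[e1|e1]] : c.1 = d.1 \/ d.1 = c.1 + 1 \/ c.1 = d.1 + 1 by lia.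
  - have [e2|[e2|e2]] : c.2 = d.2 \/ d.2 = c.2 + 1 \/ c.2 = d.2 + 1 by lia.
    + by have -> : c = d by [exact: pointP]; rewrite !addbb.
    + by rewrite (lam_y e c d) ?(lam_y m c d) //; lia.
    + by rewrite (addbC (lam m c)) (addbC (lam e c)) (lam_y e d c) ?(lam_y m d c) //; lia.
  - have [e2|e2] : c.2 = d.2 \/ c.2 <> d.2 by lia.
      by rewrite (lam_x e c d) ?(lam_x m c d) //; lia.
    by have -> : m = e by apply: pointP; lia.
  - have [e2|e2] : c.2 = d.2 \/ c.2 <> d.2 by lia.
      by rewrite (addbC (lam m c)) (addbC (lam e c)) (lam_x e d c) ?(lam_x m d c) //; lia.
    by have -> : m = e by apply: pointP; lia.
have [|h hE] := @near_cochain R S disk psi.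
  move=> a b c aS bS cS; rewrite /near_sq => ab bc ac.
  have [m [m1 m2]] := point_ex (Num.min a.1 (Num.min b.1 c.1)) (Num.min a.2 (Num.min b.2 c.2)).
  rewrite (psiE m a b) ?(psiE m b c) ?(psiE m a c) //; clear -m1 m2 ab bc ac; lia.
exists h.
  split=> c d cS dS cd.
    rewrite -hE //; last by rewrite /near_sq; lia.
    by rewrite (psiE c) //; [apply: lam_x => //; lia|lia|lia|lia|lia].
  rewrite -hE //; last by rewrite /near_sq; lia.
  by rewrite (psiE c) //; [apply: lam_y => //; lia|lia|lia|lia|lia].
move=> c d [cS dS cd1 cd2 P].
rewrite -hE //; last by rewrite /near_sq; clear -cd1 cd2; lia.
have aux (c' d' : Z2) : c' \in S -> d' \in S -> d'.1 = c'.1 + 1 ->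
    d'.2 = c'.2 + 1 \/ c'.2 = d'.2 + 1 ->
    (forall e : Z2, e \in S -> ~ (e.1 = c'.1 /\ e.2 = d'.2) /\ ~ (e.1 = d'.1 /\ e.2 = c'.2)) ->
    psi c' d' = pv (Num.min c'.1 d'.1, Num.min c'.2 d'.2).
  move=> cS' dS' e1 e2 P'; rewrite /psi; have [m [m1 m2]] := point_ex (Num.min c'.1 d'.1) (Num.min c'.2 d'.2).
  have -> : (Num.min c'.1 d'.1, Num.min c'.2 d'.2) = m by apply: pointP => /=; lia.
  have abs (e : Z2) : (e.1 = c'.1 /\ e.2 = d'.2) \/ (e.1 = d'.1 /\ e.2 = c'.2) -> (e \in S) = false.
    by move=> ee; apply/negP => /P'; clear -ee; lia.
  rewrite !lamE /block_potential.
  have -> : (c'.1 != m.1) = false by lia.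
  have -> : (d'.1 != m.1) = true by lia.
  case: e2 => e2.
    have -> : (c'.2 != m.2) = false by lia.
    have -> : (d'.2 != m.2) = true by lia.
    have E : c' = m by apply: pointP; lia.
    rewrite -E cS' abs /=; last lia.
    by rewrite abs //=; lia.
  have -> : (c'.2 != m.2) = true by lia.
  have -> : (d'.2 != m.2) = false by lia.
  rewrite abs; last lia.
  rewrite abs /=; last lia.
  by rewrite addbC addKb.
have [E|E] : d.1 = c.1 + 1 \/ c.1 = d.1 + 1 by clear -cd1; lia.
  by apply: aux => //; clear -cd2; lia.
have -> : psi c d = psi d c.
  rewrite /psi addbC; congr (lam (_, _) _ (+) lam (_, _) _); clear; lia.
rewrite aux //; first by congr pv; apply: pointP => /=; clear; lia.
- by clear -cd2; lia.
- by move=> e eS; have := P e eS; clear; lia.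
Qed.

Lemma disk_comb_board : comb_board S.
Proof.
split; last split.
- move/topological_diskE: disk => [f [g [_ _ fg _]]].
  have [|[c cS _] _] := fg (0, 0); first by rewrite /= !expr0n /= addr0.
  by apply/fset0Pn; exists c.
- exact: disk_side_connected.
- move=> wx wy w; have [h hc _] := disk_cochain (fun _ => false) w.
  by exists h.
(* The cochain that is 0 on sides and 1 on pinches has a potential, which is constant across sides
   and separates every pinch. *)
- move=> c d P; have [|h [hx hy] hp] := @disk_cochain (fun _ => false) (fun _ => false)
    (fun _ => true) _; first by [].
  exists h; last by have := hp c d P; case: (h c) (h d) => [] [].
  split=> a b aS bS ab.
    by have := hx a b aS bS ab; case: (h a) (h b) => [] [].
  by have := hy a b aS bS ab; case: (h a) (h b) => [] [].
Qed.

End Disk.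

(** * Acyclic boards are disks *)

Lemma cont_on_region (R : realType) (A B : {fset Z2}) (f : R * R -> R * R) :
  cont_on (region R A) f -> cont_on (region R B) f -> cont_on (region R (A `|` B)%fset) f.
Proof.
move=> cA cB x _ e e0.
have far (C : {fset Z2}) : cont_on (region R C) f ->
    exists2 d : R, 0 < d & forall y, region R C y -> close d x y -> close e (f x) (f y).
  move=> cC; have [xC|xC] := pselect (region R C x); first exact: cC.
  have [d d0 H] := squares_far C x; exists d => // y [c cS cy] xy.
  by case: (H c y cS _ xy) => // cx; apply: xC; exists c.
have [a a0 Ha] := far A cA; have [b b0 Hb] := far B cB.
exists (Num.min a b); first by rewrite lt_min a0.
move=> y [c]; rewrite inE => /orP[] cS cy xy.
  by apply: Ha; [exists c | apply: close_le xy; rewrite ge_min lexx].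
by apply: Hb; [exists c | apply: close_le xy; rewrite ge_min lexx orbT].
Qed.

Lemma cont_on_eq (R : realType) (A : set (R * R)) (f g : R * R -> R * R) :
  (forall x, A x -> f x = g x) -> cont_on A g -> cont_on A f.
Proof.
move=> fg cg x Ax e e0; have [d d0 H] := cg x Ax e e0.
by exists d => // y Ay xy; rewrite !fg //; apply: H.
Qed.

Lemma cont_on_pair (R : realType) (A : set (R * R)) (f g : R * R -> R) :
  continuous f -> continuous g -> cont_on A (fun p => (f p, g p)).
Proof.
move=> cf cg; apply/cont_onP; apply: continuous_subspaceT => x.
exact: (cvg_pair (cf x) (cg x)).
Qed.

Lemma continuous_max2 (R : realType) (f g : R * R -> R) :
  continuous f -> continuous g -> continuous (fun p => Num.max (f p) (g p)).
Proof.
move=> cf cg; rewrite (_ : (fun p => _) = (fun p => (f p + g p + `|f p - g p|) / 2)).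
  move=> x; apply: cvgM; last exact: cvg_cst.
  apply: cvgD; first exact: cvgD (cf x) (cg x).
  by apply: cvg_norm; apply: cvgB (cf x) (cg x).
by apply/funext => p; rewrite maxr_absE.
Qed.

(** The maps are extended by the identity on [Y]; they are continuous because regions are finite
    unions of closed squares and the definitions agree on overlaps. *)
Lemma homeo_glue (R : realType) (A B Y : {fset Z2}) (f g : R * R -> R * R) :
  (forall C : set (R * R), cont_on C f) -> (forall C : set (R * R), cont_on C g) ->
  (forall p, region R A p -> region R B (f p) /\ g (f p) = p) ->
  (forall p, region R B p -> region R A (g p) /\ f (g p) = p) ->
  (forall p, region R Y p -> region R A p -> f p = p) ->
  (forall p, region R Y p -> region R B p -> g p = p) ->
  homeo (region R (A `|` Y)%fset) (region R (B `|` Y)%fset).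
Proof.
move=> cf cg fg gf fY gY.
have regU (C D : {fset Z2}) p : region R (C `|` D)%fset p <-> region R C p \/ region R D p.
  split=> [[c]|[[c cS cp]|[c cS cp]]]; last 2 first.
  - by exists c; rewrite // inE cS.
  - by exists c; rewrite // inE cS orbT.
  by rewrite inE => /orP[] cS cp; [left|right]; exists c.
have glue (C D : {fset Z2}) (k l : R * R -> R * R) : (forall E : set (R * R), cont_on E k) ->
    (forall p, region R C p -> region R D (k p) /\ l (k p) = p) ->
    (forall p, region R Y p -> region R C p -> k p = p) ->
    (forall p, region R Y p -> region R D p -> l p = p) ->
    let k' p := if `[< region R C p >] then k p else p in
    let l' p := if `[< region R D p >] then l p else p in
    cont_on (region R (C `|` Y)%fset) k' /\
    forall p, region R (C `|` Y)%fset p -> region R (D `|` Y)%fset (k' p) /\ l' (k' p) = p.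
  move=> ck kl kY lY k' l'; split.
    apply: cont_on_region.
      by apply: cont_on_eq (ck _) => p Cp; rewrite /k'; case: asboolP.
    apply: (@cont_on_eq _ _ _ id) => [p Yp|p _ e e0]; last by exists e.
    by rewrite /k'; case: asboolP => // Cp; exact: kY.
  move=> p; rewrite regU regU /k' /l'; case: asboolP => [Cp _|nCp [//|Yp]].
    have [Dk lk] := kl p Cp; split; first by left.
    by case: asboolP.
  split; first by right.
  by case: asboolP => // Dp; exact: lY.
have [c1 h1] := glue A B f g cf fg fY gY; have [c2 h2] := glue B A g f cg gf gY fY.
by exists (fun p => if `[< region R A p >] then f p else p),
  (fun p => if `[< region R B p >] then g p else p).
Qed.

Lemma max_cases (R : realType) (a b : R) :
  (a <= b /\ Num.max a b = b) \/ (b <= a /\ Num.max a b = a).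
Proof. by case: leP => ab; [left | right; split => //; exact: ltW]. Qed.

(** Innermost maxima are split first, so that every case hypothesis is linear. *)
Ltac max_split := repeat match goal with
  | |- context [Num.max ?a ?b] => lazymatch a with context [Num.max _ _] => fail
      | _ => lazymatch b with context [Num.max _ _] => fail | _ =>
        case: (max_cases a b) => -[? ->] end end
  end.

(* In coordinates centred at the inner corner, adding the corner square
   [-1, 0]^2 to the L-shape is done by the piecewise linear map moving (0, 0) to
   (-1, -1) and fixing (0, -1), (-1, 0) and (1, 1). *)
Definition notch (R : realType) (x y : R) : R := Num.max 0 (1 + x + y - 3 * Num.max x y).

Lemma notchC (R : realType) (x y : R) : notch x y = notch y x.
Proof. by rewrite /notch (maxC x y) (addrAC _ x y). Qed.

Lemma notch_le (R : realType) (x y : R) : x <= y -> notch x y = Num.max 0 (1 + x - 2 * y).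
Proof.
move=> xy; rewrite /notch (max_idPr xy) (_ : 1 + x + y - 3 * y = 1 + x - 2 * y) //.
by lra.
Qed.

(** The second argument of the maximum in [notch] has slope -1 along (1, 1), so moving by
    [(- m, - m)] doubles a positive [m]; hence the inverse moves back by half of [notch]. *)
Lemma notch_out (R : realType) (x y : R) :
  -1 <= x <= 1 -> -1 <= y <= 1 -> 0 <= x \/ 0 <= y ->
  let m := notch x y in
  [/\ -1 <= x - m <= 1, -1 <= y - m <= 1 & notch (x - m) (y - m) = 2 * m].
Proof.
wlog xy : x y / x <= y => [H|] x1 y1 xy0.
  case: (lerP x y) => xy; first exact: H.
  have [|? ? ?] := H y x (ltW xy) y1 x1; first by case: xy0; [right | left].
  by rewrite (notchC x y); split; rewrite // notchC.
have y0 : 0 <= y by lra.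
rewrite /= !notch_le //; last by rewrite lerD2r.
case: (max_cases 0 (1 + x - 2 * y)) => -[h ->]; last first.
  by split; [lra|lra|rewrite !subr0; max_split; lra].
by split; [lra|lra|max_split; lra].
Qed.

Lemma notch_in (R : realType) (x y : R) :
  -1 <= x <= 1 -> -1 <= y <= 1 ->
  let m := notch x y / 2 in
  [/\ -1 <= x + m <= 1, -1 <= y + m <= 1, 0 <= x + m \/ 0 <= y + m & notch (x + m) (y + m) = m].
Proof.
wlog xy : x y / x <= y => [H|] x1 y1.
  case: (lerP x y) => xy; first exact: H.
  have [? ? D ?] := H y x (ltW xy) y1 x1; rewrite (notchC x y); split=> //.
    by case: D; [right | left].
  by rewrite notchC.
rewrite /= !notch_le //; last by rewrite lerD2r.
case: (max_cases 0 (1 + x - 2 * y)) => -[h ->]; last first.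
  by rewrite mul0r !addr0; split; [lra|lra|right; lra|max_split; lra].
by split; [lra|lra|right; lra|max_split; lra].
Qed.

(* In coordinates centred at a square, with y pointing to the leaf attached to
   it, the piecewise linear map shrinking the leaf into the square, and its
   inverse; they move only the points of the cone |x| < y. *)
Definition leaf_in (R : realType) (x y : R) : R * R :=
  let a := Num.max x (- x) in let z := Num.max y a in
  (x / 3 + Num.max 0 (x - z / 3) - Num.max 0 (- x - z / 3), y + Num.max (z / 3) a - z).

Definition leaf_out (R : realType) (x y : R) : R * R :=
  let a := Num.max x (- x) in let z := Num.max y a in
  (Num.max (- z) (- Num.max (- z) (- (3 * x))), y + 3 * z - 3 * Num.max a (z / 3)).

Lemma leaf_fix (R : realType) (x y : R) : y <= x \/ y <= - x ->
  leaf_in x y = (x, y) /\ leaf_out x y = (x, y).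
Proof.
rewrite /leaf_in /leaf_out; case: (max_cases x (- x)) => -[x0 ->] xy.
  have {}xy : y <= - x by case: xy; lra.
  by rewrite (max_idPr xy); split; congr pair; max_split; lra.
have {}xy : y <= x by case: xy; lra.
by rewrite (max_idPr xy); split; congr pair; max_split; lra.
Qed.

(** The ratio 1/3 sends the end of the leaf, at height 3/2, to the side of the square at height 1/2.
    The vertex (1/2, 3/2) goes to (1/6, 1/2), and the two outer pieces interpolate between this and
    the fixed vertices of the square. *)
Lemma leaf_cone (R : realType) (x y : R) : x <= y -> - x <= y ->
  [\/ [/\ - (y / 3) <= x, x <= y / 3, leaf_in x y = (x / 3, y / 3) & leaf_out x y = (3 * x, 3 * y)],
      [/\ y / 3 <= x, leaf_in x y = ((4 * x - y) / 3, x) & leaf_out x y = (y, 4 * y - 3 * x)] |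
      [/\ x <= - (y / 3), leaf_in x y = ((4 * x + y) / 3, - x) & leaf_out x y = (- y, 4 * y + 3 * x)]].
Proof.
move=> xy1 xy2; have zE : Num.max y (Num.max x (- x)) = y by max_split; lra.
rewrite /leaf_in /leaf_out zE.
case: (lerP x (y / 3)) => h1; last first.
  by constructor 2; split; [lra|congr pair; max_split; lra|congr pair; max_split; lra].
case: (lerP (- (y / 3)) x) => h2.
  by constructor 1; split; [lra|lra|congr pair; max_split; lra|congr pair; max_split; lra].
by constructor 3; split; [lra|congr pair; max_split; lra|congr pair; max_split; lra].
Qed.

Lemma leaf_inP (R : realType) (x y : R) :
  - (1 / 2) <= x <= 1 / 2 -> - (1 / 2) <= y <= 3 / 2 ->
  [/\ - (1 / 2) <= (leaf_in x y).1 <= 1 / 2, - (1 / 2) <= (leaf_in x y).2 <= 1 / 2 &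
    leaf_out (leaf_in x y).1 (leaf_in x y).2 = (x, y)].
Proof.
move=> x1 y1; have [xy|[xy1 xy2]] : (y <= x \/ y <= - x) \/ (x <= y /\ - x <= y) by lra.
  have [E1 E2] := leaf_fix xy; rewrite E1 /= E2; split=> //; case: xy; lra.
have [[h1 h2 E _]|[h1 E _]|[h1 E _]] := leaf_cone xy1 xy2; rewrite E /=.
- split; [lra|lra|].
  case: (@leaf_cone R (x / 3) (y / 3)) => [||[? ? ? H]|[? ? H]|[? ? H]]; [lra|lra| | | ];
    by rewrite H; congr pair; lra.
- split; [lra|lra|].
  case: (@leaf_cone R ((4 * x - y) / 3) x) => [||[? ? ? H]|[? ? H]|[? ? H]]; [lra|lra| | | ];
    by rewrite H; congr pair; lra.
- split; [lra|lra|].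
  case: (@leaf_cone R ((4 * x + y) / 3) (- x)) => [||[? ? ? H]|[? ? H]|[? ? H]]; [lra|lra| | | ];
    by rewrite H; congr pair; lra.
Qed.

Lemma leaf_outP (R : realType) (x y : R) :
  - (1 / 2) <= x <= 1 / 2 -> - (1 / 2) <= y <= 1 / 2 ->
  [/\ - (1 / 2) <= (leaf_out x y).1 <= 1 / 2, - (1 / 2) <= (leaf_out x y).2 <= 3 / 2 &
    leaf_in (leaf_out x y).1 (leaf_out x y).2 = (x, y)].
Proof.
move=> x1 y1; have [xy|[xy1 xy2]] : (y <= x \/ y <= - x) \/ (x <= y /\ - x <= y) by lra.
  have [E1 E2] := leaf_fix xy; rewrite E2 /= E1; split=> //; case: xy; lra.
have [[h1 h2 _ E]|[h1 _ E]|[h1 _ E]] := leaf_cone xy1 xy2; rewrite E /=.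
- split; [lra|lra|].
  case: (@leaf_cone R (3 * x) (3 * y)) => [||[? ? H ?]|[? H ?]|[? H ?]]; [lra|lra| | | ];
    by rewrite H; congr pair; lra.
- split; [lra|lra|].
  case: (@leaf_cone R y (4 * y - 3 * x)) => [||[? ? H ?]|[? H ?]|[? H ?]]; [lra|lra| | | ];
    by rewrite H; congr pair; lra.
- split; [lra|lra|].
  case: (@leaf_cone R (- y) (4 * y + 3 * x)) => [||[? ? H ?]|[? H ?]|[? H ?]]; [lra|lra| | | ];
    by rewrite H; congr pair; lra.
Qed.

Lemma continuous_lin (R : realType) (a b c : R) :
  continuous (fun p : R * R => a * p.1 + b * p.2 + c).
Proof.
move=> x; apply: cvgD; last exact: cvg_cst.
apply: cvgD; (apply: cvgM; first exact: cvg_cst); [exact: cvg_fst | exact: cvg_snd].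
Qed.

Lemma in_region1 (R : realType) (c : Z2) (p : R * R) :
  region R [fset c]%fset p <-> in_sq c p.
Proof.
split=> [[d]|cp]; first by rewrite inE => /eqP ->.
by exists c; rewrite // inE.
Qed.

Lemma in_regionU (R : realType) (C D : {fset Z2}) (p : R * R) :
  region R (C `|` D)%fset p <-> region R C p \/ region R D p.
Proof.
split=> [[c]|[[c cS cp]|[c cS cp]]]; last 2 first.
- by exists c; rewrite // inE cS.
- by exists c; rewrite // inE cS orbT.
by rewrite inE => /orP[] cS cp; [left|right]; exists c.
Qed.

Lemma homeo_linear (R : realType) (A B : set (R * R)) (a b c d : R * R -> R) :
  continuous a -> continuous b -> continuous c -> continuous d ->
  (forall p, A p -> B (a p, b p) /\ (c (a p, b p), d (a p, b p)) = p) ->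
  (forall p, B p -> A (c p, d p) /\ (a (c p, d p), b (c p, d p)) = p) -> homeo A B.
Proof.
move=> ca cb cc cd AB BA.
by exists (fun p => (a p, b p)), (fun p => (c p, d p)); split=> //; exact: cont_on_pair.
Qed.

Lemma homeo_neg (R : realType) (S : {fset Z2}) :
  homeo (region R (fimage neg S)) (region R S).
Proof.
have mS (c : Z2) : (c \in fimage neg S) = (neg c \in S) by rewrite mem_fimage //; exact: negK.
pose a (p : R * R) := -1 * p.1 + 0 * p.2 + 1; pose b (p : R * R) := 0 * p.1 + -1 * p.2 + 1.
have ab p : (a (a p, b p), b (a p, b p)) = p by case: p => x y; rewrite /a /b /=; congr pair; lra.
apply: (@homeo_linear _ _ _ a b a b); try exact: continuous_lin.
  move=> p [c]; rewrite mS => cS [p1 p2]; split; last exact: ab.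
  by exists (neg c); rewrite // /a /b /neg /= !intrN; split; lra.
move=> p [c cS [p1 p2]]; split; last exact: ab.
by exists (neg c); rewrite ?mS ?negK // /a /b /neg /= !intrN; split; lra.
Qed.

Lemma homeo_swap (R : realType) (S : {fset Z2}) :
  homeo (region R (fimage swap S)) (region R S).
Proof.
have mS (c : Z2) : (c \in fimage swap S) = (swap c \in S) by rewrite mem_fimage //; exact: swapK.
pose a (p : R * R) := 0 * p.1 + 1 * p.2 + 0; pose b (p : R * R) := 1 * p.1 + 0 * p.2 + 0.
have ab p : (a (a p, b p), b (a p, b p)) = p by case: p => x y; rewrite /a /b /=; congr pair; lra.
apply: (@homeo_linear _ _ _ a b a b); try exact: continuous_lin.
  move=> p [c]; rewrite mS => cS [p1 p2]; split; last exact: ab.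
  by exists (swap c); rewrite // /a /b /swap /=; split; lra.
move=> p [c cS [p1 p2]]; split; last exact: ab.
by exists (swap c); rewrite ?mS ?swapK // /a /b /swap /=; split; lra.
Qed.

Lemma homeo_flips (R : realType) (S T : {fset Z2}) : T \in flips S ->
  homeo (region R T) (region R S).
Proof.
rewrite !inE => /or4P[] /eqP ->.
- by exists id, id; split=> // x _ e e0; exists e.
- exact: homeo_neg.
- exact: homeo_swap.
- exact: homeo_trans (homeo_swap _ _) (homeo_neg _ _).
Qed.

Lemma homeo_square (R : realType) (c d : Z2) :
  homeo (region R [fset c]%fset) (region R [fset d]%fset).
Proof.
pose u : R := d.1%:~R - c.1%:~R; pose v : R := d.2%:~R - c.2%:~R.
apply: (@homeo_linear _ _ _ (fun p => 1 * p.1 + 0 * p.2 + u) (fun p => 0 * p.1 + 1 * p.2 + v)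
  (fun p => 1 * p.1 + 0 * p.2 + - u) (fun p => 0 * p.1 + 1 * p.2 + - v));
  try exact: continuous_lin; move=> p /in_region1[p1 p2]; split.
- by apply/in_region1; rewrite /u /v; split => /=; lra.
- by case: p {p1 p2} => x y /=; congr pair; lra.
- by apply/in_region1; rewrite /u /v; split => /=; lra.
- by case: p {p1 p2} => x y /=; congr pair; lra.
Qed.

Lemma intr_leD (R : realType) (x y n : int) : x <= y + n -> (x%:~R : R) <= y%:~R + n%:~R.
Proof. by rewrite -intrD ler_int. Qed.

Lemma homeo_free_corner (R : realType) (T : {fset Z2}) (c : Z2) :
  is_free_corner T c -> homeo (region R T) (region R (T `\ c)%fset).
Proof.
move=> [corner full].
pose r : Z2 := (c.1 + 1, c.2); pose u : Z2 := (c.1, c.2 + 1); pose v : Z2 := (c.1 + 1, c.2 + 1).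
pose L := ([fset r] `|` ([fset u] `|` [fset v]))%fset.
pose B := ([fset c] `|` L)%fset; pose Y := (T `\` B)%fset.
have BT d : d \in B -> d \in T.
  by rewrite !inE => /or4P[] /eqP ->; apply: full; rewrite /=; clear; lia.
have cL : c \notin L.
  have ne (d : Z2) : c.1 <> d.1 \/ c.2 <> d.2 -> (c == d) = false.
    by move=> cd; apply/negP => /eqP E; subst d; lia.
  by rewrite !inE !ne // /r /u /v /=; clear; lia.
have TE : T = (B `|` Y)%fset.
  apply/fsetP => d; rewrite in_fsetU in_fsetD; have := BT d.
  by case: (d \in B) => [-> //|_].
have TcE : (T `\ c)%fset = (L `|` Y)%fset.
  apply/fsetP => d; rewrite in_fsetD1 in_fsetU in_fsetD /B in_fsetU in_fset1.
  have [->|dc] /= := eqVneq d c; first by rewrite (negPf cL).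
  have := BT d; rewrite /B in_fsetU in_fset1 (negPf dc) /=.
  by case: (d \in L) => [-> //|_].
rewrite TcE [X in homeo (region R X)]TE; apply: homeo_sym.
pose X (p : R * R) : R := p.1 - c.1%:~R - 1; pose Z (p : R * R) : R := p.2 - c.2%:~R - 1.
pose m p := notch (X p) (Z p).
have cX : continuous X.
  rewrite (_ : X = fun p : R * R => 1 * p.1 + 0 * p.2 + (- c.1%:~R - 1)).
    exact: continuous_lin.
  by apply/funext => p; rewrite /X; lra.
have cZ : continuous Z.
  rewrite (_ : Z = fun p : R * R => 0 * p.1 + 1 * p.2 + (- c.2%:~R - 1)).
    exact: continuous_lin.
  by apply/funext => p; rewrite /Z; lra.
have cm : continuous m.
  apply: continuous_max2; first by move=> p; exact: cvg_cst.
  move=> p; apply: cvgB.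
    by apply: cvgD; [apply: cvgD; [exact: cvg_cst | exact: cX] | exact: cZ].
  by apply: cvgM; [exact: cvg_cst | exact: (continuous_max2 cX cZ)].
have BE p : region R B p <-> (-1 <= X p <= 1 /\ -1 <= Z p <= 1).
  rewrite /X /Z /B /L !in_regionU !in_region1 /in_sq /r /u /v /= !intrD !mulr1z; split.
    by case=> [|[|[|]]]; lra.
  move=> -[p1 p2]; case: (lerP p.1 (c.1%:~R + 1)) => h1; case: (lerP p.2 (c.2%:~R + 1)) => h2.
  - by left; lra.
  - by right; right; left; lra.
  - by right; left; lra.
  - by right; right; right; lra.
have LE p : region R L p <-> [/\ -1 <= X p <= 1, -1 <= Z p <= 1 & 0 <= X p \/ 0 <= Z p].
  rewrite /X /Z /L !in_regionU !in_region1 /in_sq /r /u /v /= !intrD !mulr1z; split.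
    by case=> [H|[H|H]]; (split; [lra|lra|]); [left|right|left]; lra.
  move=> -[p1 p2 p3]; case: (lerP p.1 (c.1%:~R + 1)) => h1; case: (lerP p.2 (c.2%:~R + 1)) => h2.
  - by case: p3 => p3; [left | right; left]; lra.
  - by right; left; lra.
  - by left; lra.
  - by right; right; lra.
(* By [corner], the rest of the board avoids the interiors of the two outer sides of [c] at its
   lower left vertex; [notch] vanishes on the remaining boundary of the block. *)
have YE p : region R Y p -> region R B p -> m p = 0.
  move=> [d]; rewrite inE => /andP[dn dT] [d1 d2] /BE[p1 p2].
  have dx : d.1 <= c.1 + -2 \/ c.1 <= d.1 + -2 \/ d.2 <= c.2 + -2 \/ c.2 <= d.2 + -2 \/
      (d.1 <= c.1 + -1 /\ c.2 <= d.2 + -1) \/ (d.2 <= c.2 + -1 /\ c.1 <= d.1 + -1).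
    apply: contrapT => nd; case/negP: dn; rewrite !inE.
    have [E|E] : (c.1 <= d.1 <= c.1 + 1 /\ c.2 <= d.2 <= c.2 + 1) \/
        (c.1 - 1 <= d.1 <= c.1 /\ c.2 - 1 <= d.2 <= c.2) by clear -nd; lia.
      have [E1|E1] : d.1 = c.1 \/ d.1 = c.1 + 1 by clear -E; lia.
        have [E2|E2] : d.2 = c.2 \/ d.2 = c.2 + 1 by clear -E; lia.
          by rewrite (_ : d = c) ?eqxx //; apply: pointP.
        by rewrite (_ : d = u) ?eqxx ?orbT //; apply: pointP.
      have [E2|E2] : d.2 = c.2 \/ d.2 = c.2 + 1 by clear -E; lia.
        by rewrite (_ : d = r) ?eqxx ?orbT //; apply: pointP.
      by rewrite (_ : d = v) ?eqxx ?orbT //; apply: pointP.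
    by case: E => E1 E2; rewrite (corner d dT E1 E2) eqxx.
  rewrite /m /notch; move: p1 p2; rewrite /X /Z => p1 p2.
  have N1 : (-1 : int)%:~R = -1 :> R by rewrite intrN mulr1z.
  have N2 : (-2 : int)%:~R = -2 :> R by rewrite intrN.
  move: dx => [|[|[|[|[[]|[]]]]]] => [/(@intr_leD R)|/(@intr_leD R)|/(@intr_leD R)|/(@intr_leD R)|
    /(@intr_leD R) + /(@intr_leD R)|/(@intr_leD R) + /(@intr_leD R)]; rewrite ?N1 ?N2 => *;
    max_split; lra.
apply: (@homeo_glue _ _ _ _ (fun p => (p.1 - m p, p.2 - m p))
    (fun p => (p.1 + m p / 2, p.2 + m p / 2))).
- by move=> C; apply: cont_on_pair => p; apply: cvgB; first [exact: cm | exact: cvg_fst | exact: cvg_snd].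
- move=> C; apply: cont_on_pair => p; apply: cvgD; first [exact: cvg_fst | exact: cvg_snd | idtac];
    by apply: cvgM; [exact: cm | exact: cvg_cst].
- move=> p /LE[p1 p2 p3]; have [q1 q2 qE] := notch_out p1 p2 p3.
  have E1 : X (p.1 - m p, p.2 - m p) = X p - notch (X p) (Z p) by rewrite /X /m /=; lra.
  have E2 : Z (p.1 - m p, p.2 - m p) = Z p - notch (X p) (Z p) by rewrite /Z /m /=; lra.
  split; first by apply/BE; rewrite E1 E2.
  by rewrite [m (_, _)]/m E1 E2 qE -/(m p) /=; case: (p) => x y /=; congr pair; lra.
- move=> p /BE[p1 p2]; have [q1 q2 q3 qE] := notch_in p1 p2.
  have E1 : X (p.1 + m p / 2, p.2 + m p / 2) = X p + notch (X p) (Z p) / 2 by rewrite /X /m /=; lra.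
  have E2 : Z (p.1 + m p / 2, p.2 + m p / 2) = Z p + notch (X p) (Z p) / 2 by rewrite /Z /m /=; lra.
  split; first by apply/LE; rewrite E1 E2.
  by rewrite [m (_, _)]/m E1 E2 qE -/(m p) /=; case: (p) => x y /=; congr pair; lra.
- move=> p Yp Lp; rewrite YE //; first by case: (p) => x y /=; rewrite !subr0.
  by apply/BE; case/LE: Lp.
- by move=> p Yp Bp; rewrite YE //; case: (p) => x y /=; rewrite mul0r !addr0.
Qed.

Lemma continuousD2 (R : realType) (f g : R * R -> R) :
  continuous f -> continuous g -> continuous (fun p => f p + g p).
Proof. by move=> cf cg x; apply: cvgD; [exact: cf | exact: cg]. Qed.

Lemma continuousZ2 (R : realType) (k : R) (f : R * R -> R) :
  continuous f -> continuous (fun p => k * f p).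
Proof. by move=> cf x; apply: cvgM; [exact: cvg_cst | exact: cf]. Qed.

Lemma continuousN2 (R : realType) (f : R * R -> R) :
  continuous f -> continuous (fun p => - f p).
Proof. by move=> cf x; apply: cvgN; exact: cf. Qed.

Lemma continuous_leaf (R : realType) (X Y : R * R -> R) :
  continuous X -> continuous Y ->
  [/\ continuous (fun p => (leaf_in (X p) (Y p)).1),
      continuous (fun p => (leaf_in (X p) (Y p)).2),
      continuous (fun p => (leaf_out (X p) (Y p)).1) &
      continuous (fun p => (leaf_out (X p) (Y p)).2)].
Proof.
move=> cX cY.
have cc (k : R) : continuous (fun _ : R * R => k) by move=> x; exact: cvg_cst.
have ca := continuous_max2 cX (continuousN2 cX); have cz := continuous_max2 cY ca.
have c3 (f : R * R -> R) : continuous f -> continuous (fun p => f p / 3).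
  by move=> cf x; apply: cvgM; [exact: cf | exact: cvg_cst].
split; rewrite /leaf_in /leaf_out /=.
- apply: continuousD2; [apply: continuousD2|apply: continuousN2].
  + exact: c3.
  + apply: continuous_max2 (cc 0) _; apply: continuousD2 cX _.
    by apply: continuousN2; exact: c3.
  + apply: continuous_max2 (cc 0) _; apply: continuousD2 (continuousN2 cX) _.
    by apply: continuousN2; exact: c3.
- apply: continuousD2 (continuousN2 cz); apply: continuousD2 cY _.
  by apply: continuous_max2 ca; exact: c3.
- apply: continuous_max2; first exact: continuousN2.
  apply: continuousN2; apply: continuous_max2; first exact: continuousN2.
  by apply: continuousN2; exact: continuousZ2.
- apply: continuousD2.
    by apply: continuousD2 cY _; exact: continuousZ2.
  apply: continuousN2; apply: continuousZ2; apply: continuous_max2 ca _; exact: c3.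
Qed.

Lemma homeo_leaf (R : realType) (T : {fset Z2}) (c : Z2) : c \in T ->
  is_leaf T c -> homeo (region R T) (region R (T `\ c)%fset).
Proof.
move=> cT [alone up].
pose n : Z2 := (c.1, c.2 + 1); have nT : n \in T by apply: up.
pose L := [fset n]%fset; pose B := ([fset c] `|` L)%fset; pose Y := (T `\` B)%fset.
have BT d : d \in B -> d \in T by rewrite !inE => /orP[] /eqP ->.
have cL : c \notin L.
  by rewrite !inE; apply/negP => /eqP/(congr1 snd); rewrite /n /=; clear; lia.
have TE : T = (B `|` Y)%fset.
  apply/fsetP => d; rewrite in_fsetU in_fsetD; have := BT d.
  by case: (d \in B) => [-> //|_].
have TcE : (T `\ c)%fset = (L `|` Y)%fset.
  apply/fsetP => d; rewrite in_fsetD1 in_fsetU in_fsetD /B in_fsetU in_fset1.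
  have [->|dc] /= := eqVneq d c; first by rewrite (negPf cL).
  have := BT d; rewrite /B in_fsetU in_fset1 (negPf dc) /=.
  by case: (d \in L) => [-> //|_].
rewrite TcE [X in homeo (region R X)]TE.
pose X (p : R * R) : R := p.1 - c.1%:~R - 1 / 2; pose V (p : R * R) : R := c.2%:~R + 3 / 2 - p.2.
have cX : continuous X.
  rewrite (_ : X = fun p : R * R => 1 * p.1 + 0 * p.2 + (- c.1%:~R - 1 / 2)).
    exact: continuous_lin.
  by apply/funext => p; rewrite /X; lra.
have cV : continuous V.
  rewrite (_ : V = fun p : R * R => 0 * p.1 + -1 * p.2 + (c.2%:~R + 3 / 2)).
    exact: continuous_lin.
  by apply/funext => p; rewrite /V; lra.
have BE p : region R B p <-> (- (1 / 2) <= X p <= 1 / 2 /\ - (1 / 2) <= V p <= 3 / 2).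
  rewrite /X /V /B /L in_regionU !in_region1 /in_sq /n /= !intrD !mulr1z; split.
    by case; lra.
  by move=> -[p1 p2]; case: (lerP p.2 (c.2%:~R + 1)) => h; [left|right]; lra.
have LE p : region R L p <-> (- (1 / 2) <= X p <= 1 / 2 /\ - (1 / 2) <= V p <= 1 / 2).
  by rewrite /X /V /L in_region1 /in_sq /n /= !intrD !mulr1z; split; lra.
(* The leaf is attached along one side only, so the rest of the board meets the two squares outside
   the open cone that is moved. *)
have YE p : region R Y p -> region R B p -> V p <= X p \/ V p <= - X p.
  move=> [d]; rewrite in_fsetD => /andP[dn dT] [d1 d2] /BE[p1 p2].
  have dx : d.1 <= c.1 + -2 \/ c.1 <= d.1 + -2 \/ d.2 <= c.2 + -2 \/ c.2 <= d.2 + -2 \/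
      (d.1 <= c.1 + -1 /\ c.2 <= d.2 + -1) \/ (c.1 <= d.1 + -1 /\ c.2 <= d.2 + -1).
    apply: contrapT => nd; case/negP: dn; rewrite in_fsetU !in_fset1.
    have [E|E] : (d.1 = c.1 /\ d.2 = c.2 + 1) \/
        (c.1 - 1 <= d.1 <= c.1 + 1 /\ c.2 - 1 <= d.2 <= c.2) by clear -nd; lia.
      by rewrite (_ : d = n) ?eqxx ?orbT //; case: E => *; apply: pointP.
    by case: E => E1 E2; rewrite (alone d dT E1 E2) eqxx.
  move: p1 p2; rewrite /X /V => p1 p2.
  have N1 : (-1 : int)%:~R = -1 :> R by rewrite intrN mulr1z.
  have N2 : (-2 : int)%:~R = -2 :> R by rewrite intrN.
  case: dx => [/(@intr_leD R)|[/(@intr_leD R)|[/(@intr_leD R)|[/(@intr_leD R)|[[]|[]]]]]].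
  - by rewrite N2; lra.
  - by rewrite N2; lra.
  - by rewrite N2; lra.
  - by rewrite N2 => ?; case: (lerP 0 (p.1 - c.1%:~R - 1 / 2)) => ?; [left|right]; lra.
  - by move=> /(@intr_leD R) + /(@intr_leD R); rewrite N1 => *; right; lra.
  - by move=> /(@intr_leD R) + /(@intr_leD R); rewrite N1 => *; left; lra.
have [ci1 ci2 co1 co2] := continuous_leaf cX cV.
have cc (k : R) : continuous (fun _ : R * R => k) by move=> x; exact: cvg_cst.
pose back (q : R * R) : R * R := (q.1 + (c.1%:~R + 1 / 2), - q.2 + (c.2%:~R + 3 / 2)).
have backX q : X (back q) = q.1 by rewrite /X /back /=; lra.
have backV q : V (back q) = q.2 by rewrite /V /back /=; lra.
have backK p q : q = (X p, V p) -> back q = p.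
  by move=> ->; case: p => x y; rewrite /back /X /V /=; congr pair; lra.
apply: (@homeo_glue _ _ _ _ (fun p => back (leaf_in (X p) (V p)))
    (fun p => back (leaf_out (X p) (V p)))).
- move=> C; apply: cont_on_pair; apply: continuousD2 (cc _) => //.
  exact: continuousN2.
- move=> C; apply: cont_on_pair; apply: continuousD2 (cc _) => //.
  exact: continuousN2.
- move=> p /BE[p1 p2]; have [q1 q2 qE] := leaf_inP p1 p2.
  by split; [apply/LE; rewrite backX backV | rewrite backX backV qE; exact: backK].
- move=> p /LE[p1 p2]; have [q1 q2 qE] := leaf_outP p1 p2.
  by split; [apply/BE; rewrite backX backV | rewrite backX backV qE; exact: backK].
- by move=> p Yp Bp; apply: backK; case: (leaf_fix (YE p Yp Bp)).
- move=> p Yp Lp; apply: backK; case: (@leaf_fix R (X p) (V p)) => //; apply: YE => //.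
  by apply/BE; case/LE: Lp; lra.
Qed.

Lemma homeo_comb_board (R : realType) (S : {fset Z2}) : comb_board S ->
  homeo (region R S) (region R [fset (0, 0)]%fset).
Proof.
have [n En] : exists n, #|` S| = n by eexists.
elim/ltn_ind: n S En => n IH S En cb.
have [S1|S2] := leqP #|` S| 1%N.
  have [S0 _ _] := cb; have /cardfs1P[c ->] : #|` S| == 1%N.
    by rewrite eqn_leq S1 cardfs_gt0.
  exact: homeo_square.
have [T [c [TS cbT cT cbT' free]]] := free_square cb S2.
apply: homeo_trans (homeo_sym (homeo_flips R TS)) _.
have h1 : homeo (region R T) (region R (T `\ c)%fset).
  by case: free; [exact: homeo_free_corner | exact: homeo_leaf].
apply: homeo_trans h1 _; apply: (IH #|` T `\ c|%fset) => //.
have -> : n = #|` T|.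
  rewrite -En; move: TS; rewrite !inE => /or4P[] /eqP -> //; rewrite !card_imfset //;
    first [exact: inv_inj negK | exact: inv_inj swapK].
by rewrite (cardfsD1 c T) cT.
Qed.

(** Both regions are homeomorphic to one square. Starting from a set already known to be a disk
    spares a homeomorphism between the round disk and the square. *)
Lemma comb_board_is_board (R : realType) (S T : {fset Z2}) :
  is_board R S -> comb_board S -> comb_board T -> is_board R T.
Proof.
move=> /topological_diskE dS cS cT; apply/topological_diskE.
apply: homeo_trans dS _; apply: homeo_trans (homeo_comb_board R cS) _.
exact: homeo_sym (homeo_comb_board R cT).
Qed.

(** * Lattice complexes *)

Lemma mem_verts (c p : Z2) :
  (p \in verts c) = (c.1 <= p.1 <= c.1 + 1) && (c.2 <= p.2 <= c.2 + 1).
Proof.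
rewrite /verts /= !inE /vertex /= /ccw /=.
have eqE (q r : Z2) : (q == r) = (q.1 == r.1) && (q.2 == r.2) by [].
by rewrite !eqE /=; lia.
Qed.

Lemma vertex_mem (c : Z2) (i : 'I_4) : vertex c i \in verts c.
Proof. by apply: map_f; rewrite mem_iota /=; case: i. Qed.

Lemma vertex_ccw (c : Z2) (i : 'I_4) : vertex c (i + 1)%R = ccw c (vertex c i).
Proof.
case: i => [[|[|[|[|//]]]] i4] //; apply: pointP; rewrite /vertex /ccw /=; lia.
Qed.

Definition adjacent (c d : Z2) : bool :=
  ((c.1 == d.1) && ((c.2 == d.2 + 1) || (d.2 == c.2 + 1))) ||
  ((c.2 == d.2) && ((c.1 == d.1 + 1) || (d.1 == c.1 + 1))).

(** Vertices are listed counterclockwise, so distinct squares run through a common side in opposite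
    directions; sides 0, 1, 2, 3 are the lower, right, upper and left one. *)
Lemma share_side_vertex (c d : Z2) :
  [exists i : 'I_4, exists j : 'I_4,
     (vertex c i == vertex d j) && (vertex c (i + 1)%R == vertex d (j + 1)%R) ||
     (vertex c i == vertex d (j + 1)%R) && (vertex c (i + 1)%R == vertex d j)] =
  (c == d) || adjacent c d.
Proof.
apply/existsP/orP => [[i /existsP[j ij]]|].
  have v1 : vertex c i \in verts d.
    by case/orP: ij => /andP[/eqP -> _]; exact: vertex_mem.
  have v2 : vertex c (i + 1)%R \in verts d.
    by case/orP: ij => /andP[_ /eqP ->]; exact: vertex_mem.
  have := vertex_mem c i; have := vertex_mem c (i + 1)%R; move: v1 v2.
  rewrite vertex_ccw; move: (vertex c i) => p; rewrite !mem_verts /ccw /= /adjacent => p1 p2 p3 p4.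
  have [->|cd] := eqVneq c d; [by left | right].
  have {}cd : ~ (c.1 = d.1 /\ c.2 = d.2) by move=> [e1 e2]; case/eqP: cd; exact: pointP.
  by move: p1 p2 p3 p4 cd; clear; lia.
pose o (n : nat) (n4 : (n < 4)%N) : 'I_4 := Ordinal n4.
have sol (i j : 'I_4) : vertex c i = vertex d (j + 1)%R -> vertex c (i + 1)%R = vertex d j ->
    exists i : 'I_4, [exists j : 'I_4,
     (vertex c i == vertex d j) && (vertex c (i + 1)%R == vertex d (j + 1)%R) ||
     (vertex c i == vertex d (j + 1)%R) && (vertex c (i + 1)%R == vertex d j)].
  by move=> e1 e2; exists i; apply/existsP; exists j; rewrite e1 e2 !eqxx orbT.
case=> [/eqP ->|].
  by exists 0; apply/existsP; exists 0; rewrite !eqxx.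
rewrite /adjacent => cd.
have [E|[E|[E|E]]] : (c.1 = d.1 /\ c.2 = d.2 + 1) \/ (c.1 = d.1 /\ d.2 = c.2 + 1) \/
  (c.2 = d.2 /\ c.1 = d.1 + 1) \/ (c.2 = d.2 /\ d.1 = c.1 + 1) by move: cd; clear; lia.
- by apply: (sol (@o 0%N isT) (@o 2%N isT)); apply: pointP; rewrite /vertex /= /ccw /=; lia.
- by apply: (sol (@o 2%N isT) (@o 0%N isT)); apply: pointP; rewrite /vertex /= /ccw /=; lia.
- by apply: (sol (@o 3%N isT) (@o 1%N isT)); apply: pointP; rewrite /vertex /= /ccw /=; lia.
- by apply: (sol (@o 1%N isT) (@o 3%N isT)); apply: pointP; rewrite /vertex /= /ccw /=; lia.
Qed.

Lemma vertex_shift (c v : Z2) (i : nat) :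
  vertex (c.1 + v.1, c.2 + v.2) i = ((vertex c i).1 + v.1, (vertex c i).2 + v.2).
Proof.
rewrite /vertex; elim: i => // i IH; rewrite !iterS.
by rewrite IH; apply: pointP; rewrite /ccw /=; clear; lia.
Qed.

(* A complex of unit squares glued along their common vertices is the disjoint
   union of the side-connected components of the set of its squares. *)
Lemma embedded_pieces (R : realType) (S U : {fset Z2}) (C : complex) (f : csq C -> Z2)
    (g : cvert C -> Z2) :
  is_board R S -> comb_board S -> board_like U ->
  (forall a (i : 'I_4), g (cnr a i) = vertex (f a) i) ->
  (forall a b (i j : 'I_4), g (cnr a i) = g (cnr b j) -> cnr a i = cnr b j) ->
  injective f -> (forall c, c \in U <-> exists a, c = f a) ->
  disjoint_union_of_boards R C.
Proof.
move=> bS cS bU gE ginj finj UE a.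
have shareE : @share_side C =2 fun x y => (f x == f y) || adjacent (f x) (f y).
  move=> x y; rewrite -share_side_vertex /share_side; apply: eq_existsb => i; apply: eq_existsb => j.
  have E (x' y' : csq C) (i' j' : 'I_4) : (cnr x' i' == cnr y' j') = (vertex (f x') i' == vertex (f y') j').
    by rewrite -!gE; apply/eqP/eqP => [->|/ginj].
  by rewrite !E.
pose P := [seq f x | x <- enum [pred b | connect (@share_side C) a b]].
pose B := seq_fset tt P.
have BE c : c \in B <-> exists2 b, connect (@share_side C) a b & c = f b.
  rewrite seq_fsetE; split=> [/mapP[b]|[b ab ->]].
    by rewrite mem_enum inE => ab ->; exists b.
  by apply/mapP; exists b; rewrite // mem_enum.
exists B; split.
  apply: (comb_board_is_board bS cS); apply: (board_like_component bU).
  - by move=> c /BE[b _ ->]; apply/UE; exists b.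
  - move=> c d /BE[b ab ->] /UE[e ->] be; apply/BE; exists e => //.
    apply: connect_trans ab (connect1 _); rewrite shareE /adjacent.
    by move: be; clear; lia.
  - move=> h [hx hy] c d /BE[b ab ->] /BE[e ae ->].
    suff H z : connect (@share_side C) a z -> h (f a) = h (f z) by rewrite -(H b) // (H e).
    move=> /connectP[p]; elim/last_ind: p z => [|p y IH] z; first by move=> _ ->.
    rewrite rcons_path last_rcons => /andP[pp py] ->; rewrite (IH _ pp erefl).
    have aw : connect (@share_side C) a (last a p) by apply/connectP; exists p.
    have ay := connect_trans aw (connect1 py).
    have wB : f (last a p) \in B by apply/BE; exists (last a p).
    have yB : f y \in B by apply/BE; exists y.
    move: py; rewrite shareE => /orP[/eqP -> //|]; rewrite /adjacent => wy.
    move: wB yB wy; move: (f (last a p)) (f y) => w v wB yB wy.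
    have [E|[E|[E|E]]] : above v w \/ above w v \/ right_of v w \/ right_of w v.
      by move: wy; clear; lia.
    + by symmetry; apply: hy.
    + by apply: hy.
    + by symmetry; apply: hx.
    + by apply: hx.
  - by apply/fset0Pn; exists (f a); apply/BE; exists a.
have inB (b : {b : csq C | connect (@share_side C) a b}) : f (val b) \in B.
  by apply/BE; exists (val b) => //; exact: valP b.
exists (fun b : csq (piece a) => [` inB b]%fset : csq (lattice_complex B)), g; split.
- have surj (y : csq (lattice_complex B)) :
      exists b : {b : csq C | connect (@share_side C) a b}, f (val b) = val y.
    by have /BE[b ab E] := valP y; exists (exist _ b ab); rewrite E.
  exists (fun y => projT1 (cid (surj y))) => [b|y].
    by case: cid => b' /= /finj; exact: val_inj.
  by case: cid => b /= E; exact: val_inj.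
- by move=> x y i j /=; exact: ginj.
- move=> x; exists 0; left=> i.
  have -> : (0 + i)%R = i :> 'I_4 by apply: val_inj; rewrite /= add0n modn_small.
  exact: gE.
Qed.

(** * Interior and boundary of a region *)

Lemma in_sq_verts (R : realType) (c p : Z2) : p \in verts c -> in_sq c (lpoint R p).
Proof.
have intE (x y : int) : x <= y <= x + 1 -> (x%:~R : R) <= y%:~R <= x%:~R + 1.
  by move=> xy; rewrite -[1 in X in _ && X](mulr1z 1) -intrD !ler_int.
by rewrite mem_verts => /andP[p1 p2]; split; apply: intE.
Qed.

(** A small move towards the centre of [c] reaches a point interior to [c], which belongs to no
    other square. *)
Lemma not_interior (R : realType) (S : {fset Z2}) (c : Z2) (x : R * R) :
  in_sq c x -> c \notin S -> ~ interior (region R S) x.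
Proof.
move=> [x1 x2] cS /nbhs_ballP[e /= e0 He].
have [t [t0 t1 te]] : exists t : R, [/\ 0 < t, t <= 1 / 2 & t < e].
  exists (Num.min (1 / 2) (e / 2)).
  by rewrite lt_min ge_min lexx gt_min; split=> //; [apply/andP; split; lra | apply/orP; right; lra].
pose y : R * R := (x.1 + t * (c.1%:~R + 1 / 2 - x.1), x.2 + t * (c.2%:~R + 1 / 2 - x.2)).
have y1 : c.1%:~R < y.1 < c.1%:~R + 1 by rewrite /y /=; nra.
have y2 : c.2%:~R < y.2 < c.2%:~R + 1 by rewrite /y /=; nra.
have [|d dS [d1 d2]] := He y.
  apply/close_ball; split; rewrite /y /= opprD addrA subrr add0r normrN normrM gtr0_norm //.
    by apply: le_lt_trans te; apply: ler_piMr; [exact: ltW | rewrite ler_norml; lra].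
  by apply: le_lt_trans te; apply: ler_piMr; [exact: ltW | rewrite ler_norml; lra].
have intE (m n : int) (a : R) : m%:~R < a < m%:~R + 1 -> n%:~R <= a <= n%:~R + 1 -> m = n.
  move=> ma na; have [E|[/(@intr_leD R)|/(@intr_leD R)]] : m = n \/ m <= n + -1 \/ n <= m + -1 by clear; lia.
  - by [].
  - by rewrite intrN mulr1z => ?; exfalso; lra.
  - by rewrite intrN mulr1z => ?; exfalso; lra.
by case/negP: cS; rewrite (_ : c = d) //; apply: pointP; [apply: intE y1 d1 | apply: intE y2 d2].
Qed.

Lemma interior_vertex (R : realType) (S : {fset Z2}) (p : Z2) :
  (forall c, p \in verts c -> c \in S) -> interior (region R S) (lpoint R p).
Proof.
move=> full; apply/nbhs_ballP; exists 1 => //= y /close_ball[]; rewrite /lpoint /= => y1 y2.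
have intE (m : int) (a : R) : `|m%:~R - a| < 1 ->
    exists2 n : int, n <= m <= n + 1 & (n%:~R : R) <= a <= n%:~R + 1.
  rewrite ltr_norml => ma; case: (lerP m%:~R a) => h.
    by exists m; [clear; lia | lra].
  by exists (m - 1); [clear; lia | rewrite intrD intrN mulr1z; lra].
have [n1 m1 a1] := intE _ _ y1; have [n2 m2 a2] := intE _ _ y2.
by exists (n1, n2) => //; apply: full; rewrite mem_verts m1 m2.
Qed.

Lemma boundary_vertex (R : realType) (S : {fset Z2}) (c d p : Z2) :
  c \in S -> p \in verts c -> d \notin S -> p \in verts d -> boundary R S (lpoint R p).
Proof.
move=> cS pc dS pd; split; first by exists c => //; exact: in_sq_verts.
exact: not_interior (in_sq_verts R pd) dS.
Qed.

Lemma segment_boundary (R : realType) (S : {fset Z2}) (c d p q : Z2) :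
  c \in S -> c <> d -> p <> q -> p \in verts c -> p \in verts d ->
  q \in verts c -> q \in verts d -> (segment R p q `<=` boundary R S <-> d \notin S).
Proof.
move=> cS cd pq pc pd qc qd; split=> [sub|dS].
  apply/negP => dS.
  (* If both squares were present, the midpoint of the side would be interior: its ball of radius
     1/2, for the maximum norm, is covered by them. *)
  have [|_] := sub ((1 - 1 / 2) *: lpoint R p + (1 / 2) *: lpoint R q).
    by exists (1 / 2) => //; lra.
  apply; apply/nbhs_ballP; exists (1 / 2); first by rewrite /=; lra.
  move=> y /close_ball; rewrite /close /lpoint /= /GRing.scale /= => -[y1 y2].
  have {}cd : ~ (c.1 = d.1 /\ c.2 = d.2) by move=> [*]; apply: cd; exact: pointP.
  have {}pq : ~ (p.1 = q.1 /\ p.2 = q.2) by move=> [*]; apply: pq; exact: pointP.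
  move: pc pd qc qd; rewrite !mem_verts => pc pd qc qd.
  have side (e : Z2) : e \in S -> in_sq e y -> region R S y by move=> eS ey; exists e.
  rewrite !ltr_norml in y1 y2.
  have [E|[E|[E|E]]] : (c.2 = d.2 /\ d.1 = c.1 + 1) \/ (c.2 = d.2 /\ c.1 = d.1 + 1) \/
      (c.1 = d.1 /\ d.2 = c.2 + 1) \/ (c.1 = d.1 /\ c.2 = d.2 + 1).
    by move: pc pd qc qd cd pq; clear; lia.
  - have [P1 [Q1 PQ]] : p.1 = d.1 /\ q.1 = d.1 /\ p.2 + q.2 = c.2 + c.2 + 1.
      by move: pc pd qc qd pq E; clear; lia.
    have {}PQ : p.2%:~R + q.2%:~R = c.2%:~R + c.2%:~R + 1 :> R by rewrite -intrD PQ !intrD mulr1z.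
    have [E1 E2] := E; have E3 : d.1%:~R = c.1%:~R + 1 :> R by rewrite E2 intrD mulr1z.
    rewrite P1 Q1 in y1; case: (lerP y.1 d.1%:~R) => h.
      by apply: (side c) => //; split; lra.
    by apply: (side d) => //; split; rewrite -?E1; lra.
  - have [P1 [Q1 PQ]] : p.1 = c.1 /\ q.1 = c.1 /\ p.2 + q.2 = c.2 + c.2 + 1.
      by move: pc pd qc qd pq E; clear; lia.
    have {}PQ : p.2%:~R + q.2%:~R = c.2%:~R + c.2%:~R + 1 :> R by rewrite -intrD PQ !intrD mulr1z.
    have [E1 E2] := E; have E3 : c.1%:~R = d.1%:~R + 1 :> R by rewrite E2 intrD mulr1z.
    rewrite P1 Q1 in y1; case: (lerP y.1 c.1%:~R) => h.
      by apply: (side d) => //; split; rewrite -?E1; lra.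
    by apply: (side c) => //; split; lra.
  - have [P1 [Q1 PQ]] : p.2 = d.2 /\ q.2 = d.2 /\ p.1 + q.1 = c.1 + c.1 + 1.
      by move: pc pd qc qd pq E; clear; lia.
    have {}PQ : p.1%:~R + q.1%:~R = c.1%:~R + c.1%:~R + 1 :> R by rewrite -intrD PQ !intrD mulr1z.
    have [E1 E2] := E; have E3 : d.2%:~R = c.2%:~R + 1 :> R by rewrite E2 intrD mulr1z.
    rewrite P1 Q1 in y2; case: (lerP y.2 d.2%:~R) => h.
      by apply: (side c) => //; split; lra.
    by apply: (side d) => //; split; rewrite -?E1; lra.
  - have [P1 [Q1 PQ]] : p.2 = c.2 /\ q.2 = c.2 /\ p.1 + q.1 = c.1 + c.1 + 1.
      by move: pc pd qc qd pq E; clear; lia.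
    have {}PQ : p.1%:~R + q.1%:~R = c.1%:~R + c.1%:~R + 1 :> R by rewrite -intrD PQ !intrD mulr1z.
    have [E1 E2] := E; have E3 : c.2%:~R = d.2%:~R + 1 :> R by rewrite E2 intrD mulr1z.
    rewrite P1 Q1 in y2; case: (lerP y.2 c.2%:~R) => h.
      by apply: (side d) => //; split; rewrite -?E1; lra.
    by apply: (side c) => //; split; lra.
move=> x [t t01 ->].
have conv e : p \in verts e -> q \in verts e ->
    in_sq e ((1 - t) *: lpoint R p + t *: lpoint R q).
  move=> /(in_sq_verts R)[] /= p1 p2 /(in_sq_verts R)[] /= q1 q2.
  by split; rewrite /= /GRing.scale /=; nra.
by split; [exists c => //; exact: conv | apply: not_interior dS; exact: conv].
Qed.

(** The symmetries behind [flips] as involutions indexed by two booleans; [w] tells whether the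
    orientation is reversed, hence [o (+) w] below. *)
Definition frame (s w : bool) (c : Z2) : Z2 :=
  let d := if w then swap c else c in if s then neg d else d.

(* The action on vertices corresponding to the action of frame on squares, which
   are named by their lower left vertices. *)
Definition vframe (s w : bool) (p : Z2) : Z2 :=
  ((frame s w p).1 + s%:Z, (frame s w p).2 + s%:Z).

Lemma frameK s w : involutive (frame s w).
Proof. by case: s w => [] [] [a b]; rewrite /frame /neg /swap /= ?opprK. Qed.

Lemma flips_frame (S T : {fset Z2}) : T \in flips S ->
  exists s w, forall c : Z2, (c \in T) = (frame s w c \in S).
Proof.
have nK := negK; have sK := swapK.
rewrite !inE => /or4P[] /eqP ->.
- by exists false, false.
- by exists true, false => c; rewrite mem_fimage.
- by exists false, true => c; rewrite mem_fimage.
- by exists true, true => c; rewrite !mem_fimage.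
Qed.

Lemma turn_frame s w o c p :
  turn o (frame s w c) (vframe s w p) = vframe s w (turn (o (+) w) c p).
Proof.
by case: s w o => [] [] [];
  rewrite /turn /vframe /frame /ccw /neg /swap /=; apply: pointP => /=; clear; lia.
Qed.

Lemma across_frame s w c p q :
  across (frame s w c) (vframe s w p) (vframe s w q) = frame s w (across c p q).
Proof.
by case: s w => [] []; rewrite /across /vframe /frame /neg /swap /=; apply: pointP => /=; clear; lia.
Qed.

Lemma mem_verts_frame s w c p : (vframe s w p \in verts (frame s w c)) = (p \in verts c).
Proof.
by rewrite !mem_verts; case: s w => [] []; rewrite /vframe /frame /neg /swap /=; clear; lia.
Qed.

Lemma vframe_inj s w : injective (vframe s w).
Proof.
move=> p q; rewrite /vframe => -[e1 e2]; apply: (can_inj (frameK s w)).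
by apply: pointP; [apply: addIr e1 | apply: addIr e2].
Qed.

Lemma frame_shift s w (c v : Z2) : frame s w (c.1 + v.1, c.2 + v.2) =
  ((frame s w c).1 + (frame s w v).1, (frame s w c).2 + (frame s w v).2).
Proof. by case: s w => [] []; rewrite /frame /neg /swap /=; apply: pointP => /=; clear; lia. Qed.

Lemma vframe_shift s w (p v : Z2) : vframe s w (p.1 + v.1, p.2 + v.2) =
  ((vframe s w p).1 + (frame s w v).1, (vframe s w p).2 + (frame s w v).2).
Proof. by rewrite /vframe frame_shift; apply: pointP => /=; clear; lia. Qed.

(* Moving the right part by (-1, 1) makes it touch the rest of the board only
   along the zig-zags. *)
Lemma stair_contact (T : {fset Z2}) (c0 : Z2) (k : nat) (h : Z2 -> bool) (a b p : Z2) :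
  comb_board T -> is_staircase T c0 k h -> a \in T -> h a -> b \in T -> ~~ h b ->
  ~~ on_diag c0 k b -> (p.1 + 1, p.2 - 1) \in verts a -> p \in verts b ->
  exists q : Z2, [\/ on_diag c0 k q /\ (p.1 = q.1 /\ p.2 = q.2 + 1),
    on_diag c0 k.-1 q /\ (p.1 = q.1 + 1 /\ p.2 = q.2 + 1) /\ b = (q.1, q.2 + 1) |
    on_diag c0 k.-1 q /\ (p.1 = q.1 /\ p.2 = q.2 + 2) /\ a = (q.1 + 1, q.2)].
Proof.
move=> cb st aT ha bT hb bD; rewrite !mem_verts /= => pa pb.
have C := stair_chord st; have [hx hy] := stair_cut st.
have [a' [a1 a2]] := point_ex (a.1 - 1) (a.2 + 1).
have [aT' haD] := stair_shift st aT ha a1 a2.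
have pa' : (a'.1 <= p.1 <= a'.1 + 1) && (a'.2 <= p.2 <= a'.2 + 1) by move: pa; clear -a1 a2; lia.
have k0 := stair_gt0 st.
(* In the other case [a] has jumped over the diagonal, from the angle between its consecutive
   squares [q] and [v]. *)
have [ha'|ha'] := boolP (h a' || on_diag c0 k a'); last first.
  move: haD; rewrite orbA (negPf ha') /= => /andP[D1 D2].
  have [q [q1 q2]] := point_ex (a.1 - 1) a.2.
  have qE : (a.1 - 1, a.2) = q by apply: pointP.
  rewrite qE in D1.
  have qk : on_diag c0 k.-1 q by move: D1 D2; rewrite /on_diag /=; clear -q1 q2; lia.
  have [v [v1 v2]] := point_ex a.1 (a.2 + 1).
  have vE : (a.1, a.2 + 1) = v by apply: pointP.
  rewrite vE in D2.
  have [P|[P|[P|P]]] : (p.1 = q.1 /\ p.2 = q.2 + 1) \/ (p.1 = q.1 + 1 /\ p.2 = q.2 + 1) \/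
      (p.1 = v.1 /\ p.2 = v.2 + 1) \/ (p.1 = q.1 /\ p.2 = q.2 + 2).
    by move: pa'; clear -q1 q2 v1 v2 a1 a2; lia.
  - by exists q; constructor 1.
  - exists q; constructor 2; split=> //; split=> //.
    have [b1|[b1|[b1|b1]]] : (b.1 = q.1 /\ b.2 = q.2) \/ (b.1 = q.1 + 1 /\ b.2 = q.2) \/
        (b.1 = q.1 /\ b.2 = q.2 + 1) \/ (b.1 = q.1 + 1 /\ b.2 = q.2 + 1).
      by move: pb; clear -P; lia.
    + by case/negP: bD; rewrite (_ : b = q) //; apply: pointP; case: b1.
    + by case/negP: hb; rewrite (_ : b = a) //; apply: pointP; clear -b1 q1 q2; lia.
    + by apply: pointP; case: b1.
    + by case/negP: bD; rewrite (_ : b = v) //; apply: pointP; clear -b1 q1 q2 v1 v2; lia.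
  - by exists v; constructor 1.
  - by exists q; constructor 3; split=> //; split=> //; apply: pointP => /=; clear -q1 q2; lia.
(* The four squares around [p]: [z] lower left, [e] lower right, [n] upper left, [u] upper right. *)
have [z [z1 z2]] := point_ex (p.1 - 1) (p.2 - 1).
have [e [e1 e2]] := point_ex (z.1 + 1) z.2.
have [n [n1 n2]] := point_ex z.1 (z.2 + 1).
have [u [u1 u2]] := point_ex (z.1 + 1) (z.2 + 1).
have blk (c : Z2) : (c.1 <= p.1 <= c.1 + 1) && (c.2 <= p.2 <= c.2 + 1) ->
    c = z \/ c = e \/ c = n \/ c = u.
  move=> cp; have [E|[E|[E|E]]] : (c.1 = z.1 /\ c.2 = z.2) \/ (c.1 = e.1 /\ c.2 = e.2) \/
      (c.1 = n.1 /\ c.2 = n.2) \/ (c.1 = u.1 /\ c.2 = u.2).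
    by move: cp; clear -z1 z2 e1 e2 n1 n2 u1 u2; lia.
  - by left; apply: pointP; case: E.
  - by right; left; apply: pointP; case: E.
  - by right; right; left; apply: pointP; case: E.
  - by right; right; right; apply: pointP; case: E.
have f1 : z \in T -> e \in T -> h z (+) h e = on_diag c0 k z by move=> *; apply: hx => //; clear -e1 e2 n1 n2 u1 u2; lia.
have f2 : n \in T -> u \in T -> h n (+) h u = on_diag c0 k n by move=> *; apply: hx => //; clear -e1 e2 n1 n2 u1 u2; lia.
have f3 : z \in T -> n \in T -> h z (+) h n = on_diag c0 k n by move=> *; apply: hy => //; clear -e1 e2 n1 n2 u1 u2; lia.
have f4 : e \in T -> u \in T -> h e (+) h u = on_diag c0 k u by move=> *; apply: hy => //; clear -e1 e2 n1 n2 u1 u2; lia.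
have np1 : z \in T -> u \in T -> e \notin T -> n \notin T -> False.
  move=> zT uT eT nT; apply: (@no_pinch T z u cb); split=> //; [clear -u1; lia|clear -u2; lia|].
  move=> c cT; split=> E.
    by case/negP: nT; rewrite (_ : n = c) //; apply: pointP; clear -E n1 n2 u1 u2; lia.
  by case/negP: eT; rewrite (_ : e = c) //; apply: pointP; clear -E e1 e2 u1 u2; lia.
have np2 : e \in T -> n \in T -> z \notin T -> u \notin T -> False.
  move=> eT nT zT uT; apply: (@no_pinch T e n cb); split=> //; [clear -e1 n1; lia|clear -e2 n2; lia|].
  move=> c cT; split=> E.
    by case/negP: uT; rewrite (_ : u = c) //; apply: pointP; clear -E e1 e2 n1 n2 u1 u2; lia.
  by case/negP: zT; rewrite (_ : z = c) //; apply: pointP; clear -E e1 e2 n1 n2; lia.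
have dT (c : Z2) : on_diag c0 k c -> (c \in T) && ~~ h c.
  by move=> ck; rewrite (stair_mem st ck) (stair_diag st ck).
have g1 : on_diag c0 k z -> on_diag c0 k u -> (e \in T) && (n \in T).
  move=> zk uk; have zk' : on_diag c0 k.-1 z.
    by move: zk uk; rewrite /on_diag; clear -u1 u2; lia.
  by rewrite !(chord_block C zk') //; clear -e1 e2 n1 n2; lia.
have g2 : on_diag c0 k z -> ~~ on_diag c0 k u -> e \notin T.
  move=> zk uk; apply: (stair_end st).
    by move: zk uk; rewrite /on_diag; clear -u1 u2 e1 e2; lia.
  by move: zk uk; rewrite /on_diag; clear -u1 u2 e1 e2; lia.
have g3 : ~~ on_diag c0 k z -> on_diag c0 k u -> [&& z \notin T, e \notin T & n \notin T].
  move=> zk uk; have [u1' u2'] : u.1 = c0.1 /\ u.2 = c0.2.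
    by move: zk uk; rewrite /on_diag; clear -u1 u2 k0; lia.
  have abs (c : Z2) : c.1 <> u.1 \/ c.2 <> u.2 -> c0.1 - 1 <= c.1 <= c0.1 ->
      c0.2 - 1 <= c.2 <= c0.2 -> c \notin T.
    move=> cu c1 c2; apply/negP => cT; have E := chord_corner C cT c1 c2.
    by move: cu; rewrite E u1' u2'; clear; lia.
  by apply/and3P; split; apply: abs; clear -u1' u2' z1 z2 e1 e2 n1 n2 u1 u2; lia.
have g4 : on_diag c0 k n -> ~~ on_diag c0 k z && ~~ on_diag c0 k e && ~~ on_diag c0 k u.
  by rewrite /on_diag; clear -z1 z2 e1 e2 n1 n2 u1 u2; lia.
have g5 : on_diag c0 k e -> ~~ on_diag c0 k z && ~~ on_diag c0 k n && ~~ on_diag c0 k u.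
  by rewrite /on_diag; clear -z1 z2 e1 e2 n1 n2 u1 u2; lia.
have last_z : on_diag c0 k z -> ~~ on_diag c0 k u -> a' <> z.
  move=> zk uk E; apply: (stair_last st aT ha); rewrite E in a1 a2.
  by move: zk uk; rewrite /on_diag; clear -a1 a2 u1 u2; lia.
have dz := dT z; have de := dT e; have dn := dT n; have du := dT u.
have ab : (a' = z \/ a' = e \/ a' = n \/ a' = u) by exact: blk.
have bb : (b = z \/ b = e \/ b = n \/ b = u) by exact: blk.
have [De|De] := boolP (on_diag c0 k e).
  by exists e; constructor 1; split=> //; clear -e1 e2 z1 z2; lia.
have [[Dz Du]|D] := pselect (on_diag c0 k z /\ on_diag c0 k u).
  exists z; constructor 2; split; first by move: Dz Du; rewrite /on_diag; clear -u1 u2; lia.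
  split; first by clear -z1 z2; lia.
  rewrite (_ : (_, _) = n); last by apply: pointP.
  case: bb => [E|[E|[//|E]]]; subst b; [by rewrite Dz in bD| |by rewrite Du in bD].
  have := f1; have := g1 Dz Du; have := dz Dz; rewrite Dz bT; move: hb; clear.
  by case: (h z) (h e) (z \in T) => [] [] [] //= _ _ _ /(_ erefl erefl).
exfalso; have {}np1 : ~~ [&& z \in T, u \in T, e \notin T & n \notin T].
  by apply/negP => /and4P[]; exact: np1.
have {}np2 : ~~ [&& e \in T, n \in T, z \notin T & u \notin T].
  by apply/negP => /and4P[]; exact: np2.
have [Dn|Dn] := boolP (on_diag c0 k n).
  have /andP[nT hn] := dn Dn; have /andP[/andP[/negPf Dz _] /negPf Du] := g4 Dn.
  move: f1 f2 f3 f4 np2; rewrite Dz Du Dn nT => f1 f2 f3 f4 np2.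
  case: bb => [E|[E|[E|E]]]; subst b; [| | by rewrite Dn in bD |];
    by move: bT hb hn f1 f2 f3 f4 np2; clear; lia.
have [Dz|Dz] := boolP (on_diag c0 k z).
  have Du : ~~ on_diag c0 k u by apply/negP => Du; apply: D.
  have eT := g2 Dz Du; have /andP[zT hz] := dz Dz.
  have {}ab : a' = n \/ a' = u.
    case: ab => [E|[E|//]]; first by case: (last_z Dz Du).
    by move: aT'; rewrite E (negPf eT).
  case: ab => E; subst a'.
    by move: ha' aT' f3 hz zT; rewrite (negPf Dn); clear; lia.
  by move: ha' aT' f2 f3 hz zT np1 eT; rewrite (negPf Dn) (negPf Du); clear; lia.
have [Du|Du] := boolP (on_diag c0 k u).
  have /and3P[zT eT nT] := g3 Dz Du.
  case: bb => [E|[E|[E|E]]]; subst b; [by rewrite bT in zT|by rewrite bT in eT|by rewrite bT in nT|].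
  by rewrite Du in bD.
(* No cut passes at [p] now, and no pinch separates the squares around it, so [h] is constant on
   them; but it differs on [a'] and [b]. *)
move: f1 f2 f3 f4 np1 np2; rewrite (negPf Dz) (negPf Dn) (negPf Du) => f1 f2 f3 f4 np1 np2.
have {}ha' : h a'.
  by case: ab ha' => [->|[->|[->|->]]]; rewrite ?(negPf Dz) ?(negPf De) ?(negPf Dn) ?(negPf Du) orbF.
case: bb => [E|[E|[E|E]]]; subst b; case: ab => [E|[E|[E|E]]]; subst a';
  by move: aT' ha' bT hb f1 f2 f3 f4 np1 np2; clear; lia.
Qed.

Lemma mem_sep (S : {fset Z2}) (P : Z2 -> bool) (c : Z2) :
  (c \in [fset e in S | P e]%fset) = (c \in S) && P c.
Proof. by rewrite !inE. Qed.

Lemma ccw2_frame s w c p :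
  iter 2 (ccw (frame s w c)) (vframe s w p) = vframe s w (iter 2 (ccw c) p).
Proof.
by case: s w => [] []; rewrite /vframe /frame /ccw /neg /swap /=; apply: pointP => /=; clear; lia.
Qed.

Lemma consecutive_squares s w (c p : Z2) :
  (p \in verts (frame s w c)) && (p \in verts (frame s w (c.1 + 1, c.2 + 1))) =
  (p == vframe s w (c.1 + 1, c.2 + 1)).
Proof.
have eqE (e f : Z2) : (e == f) = (e.1 == f.1) && (e.2 == f.2) by [].
by rewrite !mem_verts eqE; case: s w => [] []; rewrite /vframe /frame /neg /swap /=; clear; lia.
Qed.

(** * Cut and paste along a staircase *)

Section Paste.
Context (R : realType) (S T : {fset Z2}) (s w : bool).
Context (TE : forall c : Z2, (c \in T) = (frame s w c \in S)).
Context (cT : comb_board T) (c0 : Z2) (k : nat) (h : Z2 -> bool).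
Context (st : is_staircase T c0 k h).

Let fr := frame s w.
Let vf := vframe s w.
Let q (i : nat) : Z2 := (c0.1 + i%:Z, c0.2 + i%:Z).
Let C := stair_chord st.
Let k0 : (0 < k)%N := stair_gt0 st.

(** In the coordinates of [T], the point [q i] is the vertex v_i and also names the square s_{i+1}:
    squares are numbered from 1. *)
Definition stair_diagonal : diag :=
  Diag k (fun i => vf (q i)) (fun i => fr (c0.1 + i%:Z - 1, c0.2 + i%:Z - 1)).

Let d := stair_diagonal.

Let dsqS (i : nat) : dsq d i.+1 = fr (q i).
Proof. by congr fr; apply: pointP; rewrite /q /=; clear; lia. Qed.

Let q_diag (i : nat) : (i < k)%N -> on_diag c0 k (q i).
Proof. by rewrite /on_diag /q /=; clear; lia. Qed.

Let diag_q (j : nat) (c : Z2) : on_diag c0 j c -> exists2 i : nat, (i < j)%N & c = q i.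
Proof.
move=> cj; have [i Ei] : exists i : nat, c.1 - c0.1 = i%:Z.
  by apply: int_nat; move: cj; rewrite /on_diag; clear; lia.
exists i; first by move: cj; rewrite /on_diag; clear -Ei; lia.
by apply: pointP; rewrite /q /=; move: cj; rewrite /on_diag; clear -Ei; lia.
Qed.

Let frS (c : Z2) : (fr c \in S) = (c \in T). Proof. by rewrite TE. Qed.

Lemma stair_end_side o : end_side_in_boundary R S d o <->
  (c0.1 + k%:Z - 1 + (~~ (o (+) w))%:Z, c0.2 + k%:Z - 1 + (o (+) w)%:Z) \notin T.
Proof.
have E : (c0.1 + k%:Z - 1, c0.2 + k%:Z - 1) = q k.-1.
  by apply: pointP; rewrite /q /=; clear -k0; lia.
rewrite /end_side_in_boundary /= E turn_frame -frS.
have km : (k.-1 < k)%N by rewrite ltn_predL.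
have qk : q k = ((q k.-1).1 + 1, (q k.-1).2 + 1).
  by apply: pointP; rewrite /q /=; clear -k0; lia.
rewrite (_ : (_, _) = ((q k.-1).1 + (~~ (o (+) w))%:Z, (q k.-1).2 + (o (+) w)%:Z)); last first.
  by apply: pointP; rewrite /q /=; clear -k0; lia.
rewrite qk; move: (q k.-1) (q_diag km) => p pk.
apply: (@segment_boundary R S (fr p)).
- by rewrite frS; exact: (stair_mem st).
- move=> /(can_inj (frameK s w)); case: p {pk} => x y [e1 e2].
  by move: e1 e2; clear; case: (o (+) w); lia.
- move=> /(@vframe_inj s w); rewrite /turn /ccw; clear; case: p => x y /=.
  by case: (o (+) w) => -[e1 e2]; move: e1 e2; lia.
- by rewrite mem_verts_frame mem_verts /=; clear; lia.
- by rewrite mem_verts_frame mem_verts /=; clear; case: (o (+) w) => /=; lia.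
- by rewrite mem_verts_frame mem_verts /turn /ccw /=; clear; case: (o (+) w) => /=; lia.
- by rewrite mem_verts_frame mem_verts /turn /ccw /=; clear; case: (o (+) w) => /=; lia.
Qed.

Lemma stair_good : good R S d.
Proof.
have H : end_side_in_boundary R S d w.
  rewrite stair_end_side addbb /=; apply: (stair_end st) => /=; clear; lia.
by rewrite /good; move: H; case: (w); [left | right].
Qed.

Lemma stair_is_diagonal : is_diagonal R S d.
Proof.
have vS (p : Z2) (c : Z2) : p \in verts c -> vf p \in verts (fr c).
  by move=> pc; rewrite mem_verts_frame.
have q0 : q 0 = c0 by apply: pointP; rewrite /q /=; clear; lia.
have qS (i : nat) : (i < k)%N -> fr (q i) \in S.
  by move=> ik; rewrite frS; apply: (stair_mem st); exact: q_diag.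
split=> //.
- split.
    apply: (@boundary_vertex R S (fr (q 0)) (fr (c0.1 - 1, c0.2))).
    + exact: qS.
    + by apply: vS; rewrite mem_verts /q /=; clear; lia.
    + rewrite frS; apply/negP => cT'; have /(congr1 fst) := chord_corner C cT' ltac:(rewrite /=; clear; lia) ltac:(rewrite /=; clear; lia).
      by rewrite /=; clear; lia.
    + by rewrite /= q0; apply: vS; rewrite mem_verts /=; clear; lia.
  rewrite (_ : [fset _ in _ | _]%fset = [fset fr c0]%fset) ?cardfs1 //.
  apply/fsetP => e; rewrite (mem_sep S (fun c => dvert d 0 \in verts c)) in_fset1.
  rewrite -(frameK s w e) -/fr -/(fr (fr e)); move: (fr e) => c.
  rewrite frS (inj_eq (can_inj (frameK s w))) mem_verts_frame q0.
  apply/andP/eqP => [[cS]|->]; last first.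
    by split; [rewrite -q0; apply: (stair_mem st); exact: q_diag | rewrite mem_verts; clear; lia].
  by rewrite mem_verts => cc; apply: (chord_corner C cS); move: cc; clear; lia.
- move=> i /= /andP[i0 ik]; apply: interior_vertex => e.
  rewrite -(frameK s w e) -/fr -/(fr (fr e)); move: (fr e) => c; rewrite /= mem_verts_frame frS => cc.
  have [p [p1 p2]] := point_ex (c0.1 + i%:Z - 1) (c0.2 + i%:Z - 1).
  apply: (chord_block C (c := p)).
  + by rewrite /on_diag; clear -p1 p2 i0 ik; lia.
  + by move: cc; rewrite mem_verts /q /=; clear -p1; lia.
  + by move: cc; rewrite mem_verts /q /=; clear -p2; lia.
- have [e [eT e1 e2]] := chord_end C.
  apply: (@boundary_vertex R S (fr (q k.-1)) (fr e)).
  + by apply: qS; rewrite ltn_predL.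
  + by apply: vS; rewrite mem_verts /q /=; clear -k0; lia.
  + by rewrite frS.
  + by apply: vS; rewrite mem_verts /q /=; clear -e1 e2; lia.
- split=> [i ik|i /andP[i0 ik] e].
    rewrite dsqS; split; first exact: qS.
    split; first by apply: vS; rewrite mem_verts /q /=; clear; lia.
    rewrite ccw2_frame; congr vframe; apply: pointP; rewrite /q /ccw /=; clear; lia.
  have [p [p1 p2]] := point_ex (c0.1 + i%:Z - 1) (c0.2 + i%:Z - 1).
  rewrite dsqS /= (_ : (_, _) = p); last by apply: pointP.
  rewrite (_ : q i = (p.1 + 1, p.2 + 1)); last by apply: pointP; rewrite /q /=; clear -p1 p2; lia.
  exact: consecutive_squares.
Qed.

(** A unit step to the right or upwards, applied to vertices as well as to squares. In the
    coordinates of [T], the right of the diagonal is below it if [o (+) w] holds and above it if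
    not. *)
Let side (b : bool) (p : Z2) : Z2 := (p.1 + b%:Z, p.2 + (~~ b)%:Z).

Lemma stair_vr o i : vr d o i = vf (side (o (+) w) (q i)).
Proof.
rewrite /vr dsqS /= turn_frame; congr vframe; rewrite /turn /ccw /side.
by case: (o (+) w); apply: pointP => /=; clear; lia.
Qed.

Lemma stair_vl o i : vl d o i = vf (side (~~ (o (+) w)) (q i)).
Proof.
rewrite /vl dsqS /= !turn_frame; congr vframe; rewrite /turn /ccw /side.
by case: (o (+) w); apply: pointP => /=; clear; lia.
Qed.

Lemma stair_sl o i : sl d o i.+1 = fr (side (~~ (o (+) w)) (q i)).
Proof.
rewrite /sl dsqS /= stair_vl across_frame; congr frame; rewrite /across /side.
by case: (o (+) w); apply: pointP => /=; clear; lia.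
Qed.

Lemma stair_vll o i :
  vll d o i.+1 = vf (side (~~ (o (+) w)) (side (~~ (o (+) w)) (q i))).
Proof.
rewrite /vll stair_sl /= stair_vl !turn_frame; congr vframe; rewrite /turn /ccw /side.
by case: (o (+) w); apply: pointP => /=; clear; lia.
Qed.

(* The j-th vertices of the zig-zags, in the coordinates of T. *)
Let zr (b : bool) (j : nat) : Z2 :=
  if odd j then ((q j./2).1 + 1, (q j./2).2 + 1) else side b (q j./2).
Let zl (b : bool) (j : nat) : Z2 :=
  if odd j then side (~~ b) (side (~~ b) (q j./2)) else side (~~ b) (q j./2).

Lemma stair_zigzag_r o : zigzag_r d o = mkseq (fun j => vf (zr (o (+) w) j)) (2 * k).-1.
Proof.
apply: eq_mkseq => j; rewrite /zr; case: odd; last exact: stair_vr.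
by congr vframe; apply: pointP; rewrite /q /=; clear; lia.
Qed.

Lemma stair_zigzag_l o : zigzag_l d o = mkseq (fun j => vf (zl (o (+) w) j)) (2 * k).-1.
Proof.
by apply: eq_mkseq => j; rewrite /zl; case: odd; [exact: stair_vll | exact: stair_vl].
Qed.

(** Corresponding vertices of the zig-zags differ by one fixed diagonal step, so that pasting is a
    translation. *)
Lemma stair_zl_zr b j : zr b j =
  ((zl b j).1 + (if b then 1 else -1), (zl b j).2 + (if b then -1 else 1)).
Proof. by rewrite /zr /zl /side; case: odd b => [] []; apply: pointP => /=; clear; lia. Qed.

Lemma stair_zl_mem o (p : Z2) :
  (exists i : nat, [\/ (i < k)%N /\ p = side (~~ (o (+) w)) (q i) |
     (i.+1 < k)%N /\ p = side (~~ (o (+) w)) (side (~~ (o (+) w)) (q i))]) ->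
  vf p \in zigzag_l d o.
Proof.
rewrite stair_zigzag_l => -[i [[ik ->]|[ik ->]]]; apply/mapP.
  exists i.*2; first by rewrite mem_iota /=; clear -ik; lia.
  by rewrite /zl odd_double doubleK.
exists i.*2.+1; first by rewrite mem_iota /=; clear -ik; lia.
by rewrite /zl /= odd_double /= uphalf_double.
Qed.

Lemma stair_paste o right (p : Z2) :
  paste_vertex d o right (vf p) =
  if [&& (1 < k)%N, ~~ right & vf p \in zigzag_l d o] then
    (true, vf (p.1 + (if o (+) w then 1 else -1), p.2 + (if o (+) w then -1 else 1)))
  else (right, vf p).
Proof.
rewrite /paste_vertex /=; case: ifP => // /and3P[_ _ pl]; congr pair.
have := nth_index (vf p) pl; have := pl; rewrite -index_mem.
set j := index _ _; rewrite {1}stair_zigzag_l size_mkseq => jk.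
rewrite stair_zigzag_l nth_mkseq // stair_zigzag_r nth_mkseq // => /vframe_inj <-.
by rewrite stair_zl_zr.
Qed.

Let top : Z2 := (c0.1 + k%:Z - 1, c0.2 + k%:Z).

Lemma stair_balanced : balanced R S d <-> top \in T.
Proof.
have HA : end_side_in_boundary R S d w.
  by rewrite stair_end_side addbb /=; apply: (stair_end st) => /=; clear; lia.
have HB : end_side_in_boundary R S d (~~ w) <-> top \notin T.
  rewrite stair_end_side addNb addbb /= (_ : (_, _) = top) //.
  by apply: pointP; rewrite /top /=; clear; lia.
have U : unbalanced R S d <-> top \notin T.
  rewrite /unbalanced -HB; move: HA; clear; case: (w) => /= HA; split; try by case.
    by split.
  by split.
rewrite /balanced U; split=> [[_ /negP]|]; first by rewrite negbK.
by move=> tT; split; [exact: stair_good | rewrite tT].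
Qed.

(** For [o = w] the staircase part is on the left, which is possible only for an unbalanced
    diagonal. *)
Lemma stair_left_choice o : left_choice R S d o -> o = w -> top \notin T.
Proof.
move=> H ow; apply/negP => /stair_balanced /H; apply; rewrite ow stair_end_side addbb /=.
by apply: (stair_end st) => /=; clear; lia.
Qed.

Section Left.
Context (o : bool) (leftP : left_choice R S d o).
Let b : bool := o (+) w.
Let frK (c : Z2) : fr (fr c) = c. Proof. exact: frameK. Qed.

Let topP : b = false -> top \notin T.
Proof. by move=> b0; apply: stair_left_choice leftP _; move: b0; rewrite /b; case: (o) (w) => [] []. Qed.

(** The bound k' disappears for squares of [T]: the left neighbour of the last diagonal square is in
    [T] only in the balanced case. *)
Lemma stair_excised (c : Z2) : c \in T -> (fr c \in excised R S d o) =
  on_diag c0 k c || on_diag c0 k (c.1 - (~~ b)%:Z, c.2 - b%:Z).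
Proof.
move=> cT'; rewrite /excised mem_cat; congr orb.
  apply/mapP/idP => [[i]|/diag_q[i ik ->]].
    rewrite mem_iota => ik; case: i ik => // i ik; rewrite dsqS => /(can_inj (frameK s w)) ->.
    by apply: q_diag; move: ik => /=; clear; lia.
  by exists i.+1; [rewrite mem_iota /=; clear -ik; lia | rewrite dsqS].
apply/mapP/idP => [[i]|].
  rewrite mem_iota => ik; case: i ik => // i ik; rewrite stair_sl => /(can_inj (frameK s w)) E.
  rewrite (_ : (_, _) = q i); first by apply: q_diag; move: ik; case: ifP => _ /=; clear; lia.
  by rewrite E -/b; apply: pointP; rewrite /side /=; clear; lia.
move=> /diag_q[i ik E]; exists i.+1; last first.
  rewrite stair_sl -E /side -/b; congr frame; apply: pointP => /=; clear; lia.
rewrite mem_iota; case: asboolP => bal; first by rewrite /=; clear -ik; lia.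
have [ik1|ik1] := ltnP i.+1 k; first by rewrite /=; clear -ik1; lia.
have E1 := congr1 fst E; have E2 := congr1 snd E; rewrite /= in E1 E2.
exfalso; move: E1 E2 topP; case: b => E1 E2 tP.
  case: bal; apply/stair_balanced; rewrite (_ : top = c) //.
  by apply: pointP; rewrite /top /=; clear -E1 E2 ik ik1; lia.
have /negP[] : c \notin T by apply: (stair_end st); clear -E1 E2 ik ik1; lia.
by [].
Qed.

Lemma stair_remaining (c : Z2) : (fr c \in remaining R S d o) =
  [&& c \in T, ~~ on_diag c0 k c & ~~ on_diag c0 k (c.1 - (~~ b)%:Z, c.2 - b%:Z)].
Proof.
rewrite (mem_sep S (fun c => c \notin excised R S d o)) frS.
by have [cT'|//] := boolP (c \in T); rewrite /= stair_excised // negb_or.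
Qed.

Let hx := proj1 (stair_cut st).
Let hy := proj2 (stair_cut st).

Let adjE (x y : Z2) : adjacent x y ->
  right_of x y \/ right_of y x \/ above x y \/ above y x.
Proof. by rewrite /adjacent; clear; lia. Qed.

Let h_adj (x y : Z2) : x \in T -> y \in T -> ~~ on_diag c0 k x -> ~~ on_diag c0 k y ->
  adjacent x y -> h x = h y.
Proof.
move=> xT yT /negPf xk /negPf yk /adjE[|[|[|]]] xy.
- by have := hx xT yT xy; rewrite xk; clear; lia.
- by have := hx yT xT xy; rewrite yk; clear; lia.
- by have := hy xT yT xy; rewrite yk; clear; lia.
- by have := hy yT xT xy; rewrite xk; clear; lia.
Qed.

Let h_side (c p : Z2) : c \in T -> on_diag c0 k p -> c = side b p -> ~~ on_diag c0 k c -> h c = b.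
Proof.
move=> cT' pk E /negPf ck; have pT := stair_mem st pk; have hp := stair_diag st pk.
move: E; rewrite /side; case: b => E.
  by have := hx pT cT' ltac:(rewrite E /=; clear; lia); rewrite pk hp; clear; lia.
by have := hy pT cT' ltac:(rewrite E /=; clear; lia); rewrite ck hp; clear; lia.
Qed.

(** Off the two ends of the diagonal, such a square fills an angle of the right zig-zag; the ends
    are excluded by the corner, by [stair_end] and by [topP]. *)
Let h_touch (x y : Z2) : y \in T -> h y = b -> on_diag c0 k x -> ~~ on_diag c0 k y -> adjacent x y ->
  exists2 i : nat, (i.+1 < k)%N & y = side b (q i).
Proof.
move=> yT hyb xk /negPf yk xy; have xT := stair_mem st xk; have hx0 := stair_diag st xk.
have corner := chord_corner C yT; have yend := @stair_end _ _ _ _ st y; rewrite yT in yend.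
have ytop : b = false -> ~ (y.1 = c0.1 + k%:Z - 1 /\ y.2 = c0.2 + k%:Z).
  by move=> /topP/negP tT [y1 y2]; apply: tT; rewrite (_ : top = y) //; apply: pointP.
have [i Ei] : exists i : nat, x.1 - c0.1 = i%:Z.
  by apply: int_nat; move: xk; rewrite /on_diag; clear; lia.
have xE : x.2 - c0.2 = i%:Z /\ (i < k)%N by move: xk; rewrite /on_diag; clear -Ei; lia.
have c0E : y.1 = c0.1 -> y.2 = c0.2 -> False.
  by move=> y1 y2; move: yk; rewrite /on_diag y1 y2; clear -k0; lia.
have {}corner : ~ (c0.1 - 1 <= y.1 <= c0.1 /\ c0.2 - 1 <= y.2 <= c0.2).
  by move=> [y1 y2]; have E := corner y1 y2; apply: c0E; rewrite E.
have D : (b = true /\ (right_of x y \/ above y x)) \/ (b = false /\ (right_of y x \/ above x y)).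
  move: hyb; case: b => hyb; [left | right]; split=> //; move/adjE: xy => [|[|[|]]] xy; auto.
  - by have := hx yT xT xy; rewrite yk hyb hx0.
  - by have := hy xT yT xy; rewrite yk hyb hx0.
  - by have := hx xT yT xy; rewrite xk hyb hx0.
  - by have := hy yT xT xy; rewrite xk hyb hx0.
have [j jk [jy1 jy2]] : exists2 j : nat, (j.+1 < k)%N &
    y.1 = c0.1 + j%:Z + b%:Z /\ y.2 = c0.2 + j%:Z + (~~ b)%:Z.
  case: D => [[-> [xy'|xy']]|[b0 [xy'|xy']]]; rewrite ?b0.
  - by exists i; clear -xE Ei xy' yend; lia.
  - by exists i.-1; clear -xE Ei xy' corner; lia.
  - by exists i.-1; clear -xE Ei xy' corner; lia.
  - by exists i; move: (ytop b0); clear -xE Ei xy'; lia.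
by exists j => //; apply: pointP.
Qed.

Let adj_frame (x y : Z2) : adjacent (fr x) (fr y) = adjacent x y.
Proof.
by rewrite /adjacent /fr; case: s w => [] []; rewrite /frame /neg /swap /=; clear; lia.
Qed.

Let adjC (x y : Z2) : adjacent x y = adjacent y x.
Proof. by rewrite /adjacent; clear; lia. Qed.

Let Q := lattice_complex (remaining R S d o).

Let remT (a : csq Q) : [&& fr (val a) \in T, ~~ on_diag c0 k (fr (val a)) &
  ~~ on_diag c0 k ((fr (val a)).1 - (~~ b)%:Z, (fr (val a)).2 - b%:Z)].
Proof. by rewrite -stair_remaining frK; exact: valP a. Qed.

Let shareE (x y : csq Q) : @share_side Q x y = (x == y) || adjacent (fr (val x)) (fr (val y)).
Proof. by rewrite adj_frame -(inj_eq val_inj) -share_side_vertex. Qed.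

Let touches (e : Z2) : bool := has (fun pq => (pq.1 \in verts e) && (pq.2 \in verts e))
  (zip (zigzag_r d o) (behead (zigzag_r d o))).

Let touchesP (c : Z2) : reflect
  (exists2 j : nat, (j.+1 < (2 * k).-1)%N & (zr b j \in verts c) && (zr b j.+1 \in verts c))
  (touches (fr c)).
Proof.
have szE : size (zip (zigzag_r d o) (behead (zigzag_r d o))) = (2 * k).-1.-1.
  by rewrite size_zip size_behead stair_zigzag_r size_mkseq; clear; lia.
have nthE j : (j < (2 * k).-1.-1)%N ->
    nth (c0, c0) (zip (zigzag_r d o) (behead (zigzag_r d o))) j = (vf (zr b j), vf (zr b j.+1)).
  move=> jk; rewrite nth_zip_cond szE jk nth_behead stair_zigzag_r !nth_mkseq //; clear -jk; lia.
apply: (iffP (has_nthP (c0, c0))) => [[j]|[j jk jc]].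
  rewrite szE => jk; rewrite nthE //= !mem_verts_frame => jc.
  by exists j => //; clear -jk; lia.
have jk' : (j < (2 * k).-1.-1)%N by clear -jk; lia.
by exists j; rewrite ?szE // nthE //= !mem_verts_frame.
Qed.

Let touches_side (i : nat) : (i.+1 < k)%N -> touches (fr (side b (q i))).
Proof.
move=> ik; apply/touchesP; exists i.*2; first by clear -ik; lia.
rewrite /zr /= odd_double doubleK /= uphalf_double !mem_verts /side /q /=.
by case: b; clear; lia.
Qed.

Let touches_h (c : Z2) : c \in T -> ~~ on_diag c0 k c -> touches (fr c) -> h c = b.
Proof.
move=> cT' ck /touchesP[j jk jc].
have ik : (j./2.+1 < k)%N by move: jk (half_leq (leqnn j)); clear; lia.
have qk := @q_diag j./2 (ltnW ik); have qk' := @q_diag j./2.+1 ik.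
suff [E|[E|E]] : c = q j./2 \/ c = q j./2.+1 \/ c = side b (q j./2).
- by case/negP: ck; rewrite E.
- by case/negP: ck; rewrite E.
- exact: h_side qk E ck.
have PE (e : Z2) : c.1 = e.1 /\ c.2 = e.2 -> c = e by case; exact: pointP.
suff [E|[E|E]] : (c.1 = (q j./2).1 /\ c.2 = (q j./2).2) \/
    (c.1 = (q j./2.+1).1 /\ c.2 = (q j./2.+1).2) \/
    (c.1 = (side b (q j./2)).1 /\ c.2 = (side b (q j./2)).2) by auto.
move: jc; rewrite /zr !mem_verts /= uphalf_half; case: (odd j); rewrite /= ?add1n ?add0n /side /q /=;
  by case: b; clear; lia.
Qed.

Lemma stair_right_part (a : csq Q) : right_part a = (h (fr (val a)) == b).
Proof.
have hQ (x y : csq Q) : connect (@share_side Q) x y -> h (fr (val x)) = h (fr (val y)).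
  move=> /connectP[p]; elim: p x => [|z p IH] x /=; first by move=> _ ->.
  move=> /andP[xz zp] E; rewrite -(IH z zp E); move: xz; rewrite shareE => /orP[/eqP -> //|].
  have /and3P[xT xk _] := remT x; have /and3P[zT zk _] := remT z; exact: h_adj.
rewrite /right_part; apply/existsP/eqP => [[e /andP[ae te]]|ha].
  have /and3P[eT ek _] := remT e; rewrite (hQ _ _ ae).
  by apply: touches_h => //; rewrite frK.
(* Reachability of the zig-zag is propagated through all of [T], being void on the diagonal and off
   the right side; a path crossing the diagonal re-enters at a square with a side in the zig-zag. *)
pose F (x : Z2) : bool := `[< h x = b -> ~~ on_diag c0 k x -> exists e e' : csq Q,
  [/\ val e = fr x, connect (@share_side Q) e e' & touches (val e')] >].
have remQ (y : Z2) : y \in T -> h y = b -> ~~ on_diag c0 k y -> exists e : csq Q, val e = fr y.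
  move=> yT hyb yk; suff yQ : fr y \in remaining R S d o by exists [` yQ]%fset.
  rewrite stair_remaining yT yk; apply/negP => pk.
  have pT := stair_mem st pk; have hp := stair_diag st pk.
  move: pk pT hp hyb; case: b => /= pk pT hp hyb.
    have := hy pT yT ltac:(rewrite /=; clear; lia); rewrite hp hyb => /esym yk'.
    by rewrite yk' in yk.
  have := hx pT yT ltac:(rewrite /=; clear; lia); rewrite hp hyb => /esym pk'.
  by rewrite pk in pk'.
have Fadj (x y : Z2) : x \in T -> y \in T -> adjacent x y -> F x -> F y.
  move=> xT yT xy /asboolP Fx; apply/asboolP => hyb yk; have [e Ee] := remQ y yT hyb yk.
  have [xk|xk] := boolP (on_diag c0 k x).
    have [i ik yE] := h_touch yT hyb xk yk xy; exists e, e; split=> //.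
    by rewrite Ee yE; exact: touches_side.
  have [|f [f' [Ef ff' tf']]] := Fx _ xk; first by rewrite -hyb; apply: h_adj.
  exists e, f'; split=> //; apply: connect_trans (connect1 _) ff'.
  by rewrite shareE Ee Ef !frK adjC xy orbT.
have FC : side_const T F.
  split=> x y xT yT xy.
    by apply/idP/idP; apply: Fadj => //; rewrite /adjacent; clear -xy; lia.
  by apply/idP/idP; apply: Fadj => //; rewrite /adjacent; clear -xy; lia.
have [_ conn _] := cT; have q0k := @q_diag 0 k0; have /and3P[aT ak _] := remT a.
have F0 : F (q 0) by apply/asboolP => _; rewrite q0k.
have := conn F FC _ _ (stair_mem st q0k) aT; rewrite F0 => /esym/asboolP.
case=> // e [e' [Ee ee' te']]; exists e'.
by rewrite (_ : a = e) ?ee' //; apply: val_inj; rewrite /= Ee frK.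
Qed.

(** [stair_contact] puts the vertex on the left zig-zag, except in the case where [c] or [c'] would
    be an excised left neighbour of a diagonal square. *)
Let gluing (c c' p p' : Z2) : fr c \in remaining R S d o -> fr c' \in remaining R S d o ->
  h c -> ~~ h c' -> p \in verts c -> p' \in verts c' -> p' = (p.1 - 1, p.2 + 1) ->
  paste_vertex d o b (vf p) = paste_vertex d o (~~ b) (vf p').
Proof.
rewrite !stair_remaining => /and3P[cT' ck cl] /and3P[c'T c'k c'l] hc hc' pc p'c' E.
have k1 : (1 < k)%N.
  rewrite ltn_neqAle k0 andbT; apply/eqP => k1.
  by have := stair_part_nil cT st (esym k1) cT'; rewrite hc.
have pE : (p'.1 + 1, p'.2 - 1) = p by rewrite E; apply: pointP => /=; clear; lia.
have pE' : (p.1 - 1, p.2 + 1) = p' by rewrite E.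
have [|z Dz] := stair_contact cT st cT' hc c'T hc' c'k _ p'c' (p := p'); first by rewrite pE.
rewrite !stair_paste k1 -/b; have zlm := @stair_zl_mem o; rewrite -/b in zlm.
move: zlm cl c'l; case: b => zlm cl c'l; rewrite /= ?pE ?pE'; rewrite zlm ?pE ?pE' //.
- case: Dz => [[zk [z1 z2]]|[zk [_ c'E]]|[zk [[z1 z2] _]]].
  + have [i ik zE] := diag_q zk; exists i; left; split=> //; rewrite -zE.
    by apply: pointP; rewrite /side /=; clear -z1 z2; lia.
  + case/negP: c'l; rewrite c'E /=; move: zk; rewrite /on_diag /=; clear; lia.
  + have [i ik zE] := diag_q zk; exists i; right; split; first by clear -ik; lia.
    by rewrite -zE; apply: pointP; rewrite /side /=; clear -z1 z2; lia.
- have p1 : p.1 = p'.1 + 1 by rewrite E /=; clear; lia.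
  have p2 : p.2 = p'.2 - 1 by rewrite E /=; clear; lia.
  case: Dz => [[zk [z1 z2]]|[zk [[z1 z2] _]]|[zk [_ cE]]].
  + have [i ik zE] := diag_q zk; exists i; left; split=> //; rewrite -zE.
    by apply: pointP; rewrite /side /=; clear -z1 z2 p1 p2; lia.
  + have [i ik zE] := diag_q zk; exists i; right; split; first by clear -ik; lia.
    by rewrite -zE; apply: pointP; rewrite /side /=; clear -z1 z2 p1 p2; lia.
  + case/negP: cl; rewrite cE /=; move: zk; rewrite /on_diag /=; clear; lia.
Qed.

Let shift (c : Z2) : Z2 := if h c then (c.1 - 1, c.2 + 1) else c.

(** Before pasting, the tag [b] marks the vertices of the staircase part, which is the right region
    if [b] holds and the left one if not; this part is moved in both cases. *)
Let place (x : bool * Z2) : Z2 :=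
  if x.1 == b then (x.2.1 + (fr (-1, 1)).1, x.2.2 + (fr (-1, 1)).2) else x.2.

Let vf_shift (p : Z2) : ((vf p).1 + (fr (-1, 1)).1, (vf p).2 + (fr (-1, 1)).2) =
  vf (p.1 - 1, p.2 + 1).
Proof. by rewrite -(vframe_shift s w p (-1, 1)). Qed.

Let place_paste (right : bool) (p : Z2) : place (paste_vertex d o right (vf p)) =
  vf (if right == b then (p.1 - 1, p.2 + 1) else p).
Proof.
rewrite stair_paste -/b; case: ifP => [/and3P[_ /negPf -> _]|_]; rewrite /place /=.
  case: b => //=; rewrite vf_shift; congr vframe; apply: pointP => /=; clear; lia.
by case: ifP => // _; rewrite vf_shift.
Qed.

Let vf_surj (x : Z2) : exists p, x = vf p.
Proof.
exists (fr (x.1 - s%:Z, x.2 - s%:Z)); rewrite /vf /vframe [frame _ _ _]frK.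
by apply: pointP => /=; clear; lia.
Qed.

Lemma stair_paste_boards : is_board R S -> comb_board S ->
  disjoint_union_of_boards R (cut_and_paste R S d o).
Proof.
move=> bS cS; pose V := trim T c0 k h; pose U := fimage fr V.
have UE (c : Z2) : (c \in U) = (fr c \in V) by rewrite mem_fimage //; exact: frameK.
have bV : board_like V by apply: board_like_trim_stair.
have bU : board_like U.
  have bV1 := board_like_swap bV.
  have nV (W : {fset Z2}) (c : Z2) : (c \in fimage neg W) = (neg c \in W).
    by rewrite mem_fimage //; exact: negK.
  have sV (W : {fset Z2}) (c : Z2) : (c \in fimage swap W) = (swap c \in W).
    by rewrite mem_fimage //; exact: swapK.
  have -> : U = (if s then fimage neg else id) ((if w then fimage swap else id) V).
    by apply/fsetP => c; rewrite UE /fr; case: s w => [] []; rewrite ?nV ?sV.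
  by case: s w => [] []; rewrite //; apply: board_like_neg.
pose f (a : csq Q) : Z2 := fr (shift (fr (val a))).
have corner (a : csq Q) (i : 'I_4) : exists2 p, vertex (val a) i = vf p & p \in verts (fr (val a)).
  have [p Ep] := vf_surj (vertex (val a) i); exists p => //.
  by rewrite -(mem_verts_frame s w) -[vframe s w p]Ep [frame _ _ _]frK vertex_mem.
have rightE (a : csq Q) : (right_part a == b) = h (fr (val a)).
  by rewrite stair_right_part; case: (h _) b => [] [].
have cE (a : csq Q) (i : 'I_4) : place (paste_vertex d o (right_part a) (vertex (val a) i)) =
    vertex (f a) i.
  have [p Ep _] := corner a i; rewrite Ep place_paste rightE /f /shift.
  case: ifP => ha; last by rewrite frK.
  rewrite /fr (frame_shift s w _ (-1, 1)) frameK vertex_shift Ep.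
  exact: (vframe_shift s w p (-1, 1)).
apply: (@embedded_pieces R S U (cut_and_paste R S d o) f place) => //.
- move=> a a' i j; rewrite !cE /= -!cE.
  have [p Ep pa] := corner a i; have [p' Ep' pa'] := corner a' j.
  rewrite Ep Ep' !place_paste !rightE => /(@vframe_inj s w).
  have aQ : fr (fr (val a)) \in remaining R S d o by rewrite frK; exact: valP a.
  have aQ' : fr (fr (val a')) \in remaining R S d o by rewrite frK; exact: valP a'.
  have tb : (true == b) = b by case: b.
  have fb : (false == b) = ~~ b by case: b.
  rewrite !stair_right_part; have [ha|ha] := boolP (h (fr (val a)));
    have [ha'|ha'] := boolP (h (fr (val a'))).
  + by move=> [e1 e2]; congr (paste_vertex _ _ _ (vf _)); apply: pointP; clear -e1 e2; lia.
  + by move=> E; rewrite tb fb (gluing aQ aQ' ha ha' pa pa' (esym E)).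
  + by move=> E; rewrite tb fb (gluing aQ' aQ ha' ha pa' pa E).
  + by move=> ->.
(* A moved square can meet an unmoved one only by jumping over the diagonal, and then one of the two
   is an excised left neighbour of a diagonal square. *)
- move=> a a' /(can_inj (frameK s w)); have := remT a; have := remT a'.
  move=> P P' E; apply: val_inj; apply: (can_inj (frameK s w)); move: P P' E.
  rewrite -/fr; move: (fr (val a)) (fr (val a')).
  have aux (c c' : Z2) : [&& c' \in T, ~~ on_diag c0 k c' & ~~ on_diag c0 k (c'.1 - (~~ b)%:Z, c'.2 - b%:Z)] ->
    [&& c \in T, ~~ on_diag c0 k c & ~~ on_diag c0 k (c.1 - (~~ b)%:Z, c.2 - b%:Z)] ->
    h c -> ~~ h c' -> (c.1 - 1, c.2 + 1) = c' -> False.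
    move=> /and3P[c'T c'k c'l] /and3P[cT' ck cl] hc hc' E.
    have [_] := stair_shift st cT' hc (congr1 fst (esym E)) (congr1 snd (esym E)).
    rewrite (negPf hc') (negPf c'k) /= => /andP[E1 E2].
    by move: c'l cl E1 E2; rewrite -E /on_diag; case: b => /=; clear; lia.
  move=> c c' P' P; rewrite /shift; have [hc|hc] := boolP (h c); have [hc'|hc'] := boolP (h c').
  + by move=> [e1 e2]; apply: pointP; clear -e1 e2; lia.
  + by move/(aux c c' P' P hc hc').
  + by move/esym/(aux c' c P P' hc' hc).
  + by [].
- move=> x; rewrite UE /V mem_trim; split; last first.
    move=> [a ->]; have /and3P[aT ak al] := remT a; rewrite /f frK.
    move: (fr (val a)) aT ak al => c aT ak al; rewrite /shift; case: ifP => hc.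
      have [-> _] := stair_shift st aT hc (d := (c.1 - 1, c.2 + 1)) erefl erefl.
      rewrite /is_kept [X in X \in _](_ : _ = c); last by apply: pointP => /=; clear; lia.
      by rewrite mem_cut_part aT hc implybT.
    rewrite aT /is_kept /near_rim hc (negPf ak) /=; apply/implyP => /eqP cE'; exfalso.
    have tE : top = c by rewrite cE'.
    move: al topP; rewrite tE aT; case: b => al tP; last by have := tP erefl.
    by case/negP: al; rewrite cE' /on_diag /=; clear -k0; lia.
  have hrem (c : Z2) : fr c \in remaining R S d o -> exists a : csq Q, fr c = val a.
    by move=> cQ; exists [` cQ]%fset.
  move=> /andP[]; move: (frK x); move: (fr x) => y {x}<- yT yK.
  suff [c cQ cy] : exists2 c : Z2, fr c \in remaining R S d o & shift c = y.
    by have [a aE] := hrem c cQ; exists a; rewrite /f -aE frK cy.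
  have [e [e1 e2]] := point_ex (y.1 + 1) (y.2 - 1).
  have eE : (y.1 + 1, y.2 - 1) = e by apply: pointP.
  have ye : (e.1 - 1, e.2 + 1) = y by apply: pointP; rewrite /=; clear -e1 e2; lia.
  move: yK; rewrite /is_kept eE mem_cut_part.
  have [yR /= /andP[eT he]|yR _] := boolP (near_rim c0 k h y).
    exists e; last by rewrite /shift he.
    have ek : ~~ on_diag c0 k e by apply/negP => /(stair_diag st); rewrite he.
    rewrite stair_remaining eT ek /=; apply/negP.
    have [p [p1 p2]] := point_ex (e.1 - (~~ b)%:Z) (e.2 - b%:Z).
    rewrite (_ : (_, _) = p); last by apply: pointP.
    move=> pk; have pT := stair_mem st pk; have hp := stair_diag st pk.
    move: p1 p2; case: b => /= p1 p2.
      by have := hy pT eT ltac:(clear -p1 p2; lia); rewrite (negPf ek) he hp.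
    move: yR; rewrite /near_rim => /or3P[hy'|yk|/eqP yE].
    - have := hy pT yT ltac:(clear -p1 p2 e1 e2; lia); rewrite hy' hp => /esym.
      by move: pk; rewrite /on_diag; clear -p1 p2 e1 e2; lia.
    - by move: pk yk; rewrite /on_diag; clear -p1 p2 e1 e2; lia.
    - by have := stair_end st (d := e); rewrite eT yE in e1 e2 *; rewrite /= in e1 e2; move=> H;
        have := H ltac:(clear -e1; lia) ltac:(clear -e2; lia).
  move: yR; rewrite /near_rim !negb_or => /and3P[hy' yk /eqP yt].
  (* If [b] holds, a square just above a diagonal square is itself excised, but it is covered by the
     moved right neighbour [e] of that diagonal square; every other square of this case stays in
     place. *)
  have [D|D] := boolP (b && on_diag c0 k (y.1, y.2 - 1)); last first.
    exists y; last by rewrite /shift (negPf hy').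
    rewrite stair_remaining yT yk /=; apply/negP.
    have [p [p1 p2]] := point_ex (y.1 - (~~ b)%:Z) (y.2 - b%:Z).
    rewrite (_ : (_, _) = p); last by apply: pointP.
    move=> pk; have pT := stair_mem st pk; have hp := stair_diag st pk.
    move: p1 p2 D; case: b => /= p1 p2 D.
      by case/negP: D; move: pk; rewrite /on_diag /=; clear -p1 p2; lia.
    have := hx pT yT ltac:(clear -p1 p2; lia); rewrite pk hp /=; by rewrite (negPf hy').
  case/andP: D => b1 D.
  have [p [p1 p2]] := point_ex y.1 (y.2 - 1).
  rewrite (_ : (_, _) = p) in D; last by apply: pointP.
  have pk : on_diag c0 k.-1 p.
    have {}yt : ~ (y.1 = c0.1 + k%:Z - 1 /\ y.2 = c0.2 + k%:Z).
      by move=> [y1 y2]; apply: yt; apply: pointP.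
    by move: D; rewrite /on_diag; clear -yt p1 p2; lia.
  have eT : e \in T by apply: (chord_block C pk); clear -e1 e2 p1 p2; lia.
  have he : h e.
    have := hx (stair_mem st D) eT ltac:(clear -e1 e2 p1 p2; lia).
    by rewrite D (stair_diag st D).
  exists e; last by rewrite /shift he.
  rewrite stair_remaining eT b1 /=.
  by move: D; rewrite /on_diag /=; clear -e1 e2 p1 p2; lia.
Qed.
End Left.
End Paste.

Theorem theorem9 (R : realType) (Delta : {fset Z2}) (hDelta : is_board R Delta) :
  exists d : diag,
    [/\ is_diagonal R Delta d,
        good R Delta d &
        forall o : bool, left_choice R Delta d o ->
          disjoint_union_of_boards R (cut_and_paste R Delta d o)].
Proof.
have cD := disk_comb_board hDelta.
have [T TD [c0 [k [h st]]]] := staircase_exists cD.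
have cT := comb_board_flips cD TD; have [s [w TE]] := flips_frame TD.
exists (stair_diagonal s w c0 k); split.
- exact: (stair_is_diagonal R TE st).
- exact: (stair_good R TE st).
- by move=> o leftP; apply: (stair_paste_boards TE cT st leftP).
Qed.
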